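(* Let $\mathcal A$ be an exact category satisfying (AIC), let $X$ be an object of $\underleftrightarrow{\lim}\,\mathcal A$, and let $(h,\lambda)$ be a determinantal theory on $\mathcal A$ with values in a symmetric Picard category $\mathcal P$. Then the groupoid $\mathcal D_h(X)$ of $h$-relative determinantal theories on $X$ is a $\mathcal P$-torsor.
   Context: Exact categories are in the sense of Quillen, with admissible short exact sequences $a'\hookrightarrow a\twoheadrightarrow a''$, admissible monomorphisms $\hookrightarrow$ and admissible epimorphisms $\twoheadrightarrow$. (AIC): any pair of admissible monomorphisms with the same target $a'\hookrightarrow a\hookleftarrow a''$ has a pullback in $\mathcal A$, and all morphisms of the resulting square are admissible monomorphisms. $\mathrm{Pro}^a(\mathcal A)$ (resp. $\mathrm{Ind}^a(\mathcal A)$) is the full subcategory of $\mathrm{Pro}(\mathcal A)$ (resp. $\mathrm{Ind}(\mathcal A)$) of formal limits (resp. colimits) of countable systems whose structure morphisms are admissible epimorphisms (resp. monomorphisms); admissible short exact sequences are those isomorphic to the formal limit (resp. colimit) of a system of admissible short exact sequences of $\mathcal A$. The Beilinson category $\underleftrightarrow{\lim}\,\mathcal A$ is the full subcategory of $\mathrm{Ind}^a\mathrm{Pro}^a(\mathcal A)$ of objects $``\varinjlim_j''\,``\varprojlim_i''\,X_{i,j}$, $(i,j)\in\mathbb Z\times\mathbb Z$, $i\le j$, with admissible monomorphisms $X_{i,j}\hookrightarrow X_{i,j'}$ and admissible epimorphisms $X_{i,j}\twoheadrightarrow X_{i',j}$ ($i\le i'\le j\le j'$; formal limit over $i\to-\infty$,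 formal colimit over $j\to+\infty$), all the resulting squares being cartesian (hence cocartesian). Its admissible short exact sequences are those of $\mathrm{Ind}^a(\mathrm{Pro}^a(\mathcal A))$ with terms in $\underleftrightarrow{\lim}\,\mathcal A$. The Sato Grassmannian $\Gamma(X)$ is the set of admissible subobjects $[V\hookrightarrow X]$ (admissible monomorphisms up to isomorphism over $X$) with $V\in\mathrm{Pro}^a(\mathcal A)$, $X/V\in\mathrm{Ind}^a(\mathcal A)$. For $U\hookrightarrow V$ an admissible monomorphism in $\Gamma(X)$, $V/U\in\mathcal A$. A Picard category is a category $\mathcal P$ with a tensor product $\otimes$ and associativity isomorphisms $\alpha$ satisfying the pentagon, in which every morphism is an isomorphism and for each $p$ the functors $x\mapsto x\otimes p$, $x\mapsto p\otimes x$ are self-equivalences (hence it has a unit $\mathbf 1$ and duals). It is symmetric if endowed with a symmetry $\sigma$ making it symmetric monoidal. A $\mathcal P$-valued determinantal theory on $\mathcal A$ is a pair $(h,\lambda)$: a function $h:\mathrm{Ob}\,\mathcal A\to\mathrm{Ob}\,\mathcal P$ with $h(0)=\mathbf 1$, functorial for isomorphisms, and isomorphisms $\lambda:h(a')\otimes h(a'')\to h(a)$ for all admissible short exact sequences $a'\hookrightarrow a\twoheadrightarrow a''$, natural for isomorphisms of such sequences, such that for every admissible filtration $a_1\hookrightarrow a_2\hookrightarrow a_3$ with compatible quotients, $\lambda\circ(1\otimes\lambda)=\lambda\circ(\lambda\otimes1)$ as maps $h(a_1)\otimes h(a_2/a_1)\otimes h(a_3/a_2)\to h(a_3)$ (associator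 omitted). An $h$-relative determinantal theory on $X$ is a pair $(\Delta,\delta)$: a function $\Delta:\Gamma(X)\to\mathrm{Ob}\,\mathcal P$ and, for all admissible monomorphisms $U\hookrightarrow V$ in $\Gamma(X)$, an isomorphism $\delta_{U,V}:\Delta(U)\otimes h(V/U)\to\Delta(V)$, natural with respect to isomorphisms of admissible short exact sequences $U\hookrightarrow V\twoheadrightarrow V/U$, such that for all admissible filtrations $U_1\hookrightarrow U_2\hookrightarrow U_3$ in $\Gamma(X)$ one has $\delta_{U_1,U_3}\circ(1\otimes\lambda)=\delta_{U_2,U_3}\circ(\delta_{U_1,U_2}\otimes1)$ as maps $\Delta(U_1)\otimes h(U_2/U_1)\otimes h(U_3/U_2)\to\Delta(U_3)$ (associator omitted). A morphism $(\Delta,\delta)\to(\Delta',\delta')$ is a collection of isomorphisms $f_U:\Delta(U)\to\Delta'(U)$, $U\in\Gamma(X)$, with $f_V\circ\delta_{U,V}=\delta'_{U,V}\circ(f_U\otimes1)$ for all $U\hookrightarrow V$. These form the groupoid $\mathcal D_h(X)=\mathcal D_h(X,\mathcal P)$. $\mathcal P$ acts on it by $(a\otimes\Delta)(U)=a\otimes\Delta(U)$, with the obvious extension to $\delta$ and to morphisms. A torsor over $\mathcal P$ is a groupoid $\mathcal T$ with a bifunctor $\otimes:\mathcal P\times\mathcal T\to\mathcal T$, natural isomorphisms $\beta_{x_1,x_2,a}:x_1\otimes(x_2\otimes a)\to(x_1\otimes x_2)\otimes a$ satisfying the pentagon with $\alpha$ for $x_1\otimes(x_2\otimes(x_3\otimes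 a))$, natural isomorphisms $\lambda_a:\mathbf 1\otimes a\to a$ compatible with $\alpha$ and $\beta$, and such that for every object $a\in\mathcal T$ the functor $-\otimes a:\mathcal P\to\mathcal T$ is an equivalence of categories. *)

(* Defs.v *)
From HB Require Import structures.
From mathcomp Require Import all_boot all_order all_algebra.
From mathcomp Require Import boolp.
From mathcomp Require Import zify.

Set Implicit Arguments.
Unset Strict Implicit.
Unset Printing Implicit Defensive.

Import Order.TTheory GRing.Theory Num.Theory.

Declare Scope cat_scope.
Delimit Scope cat_scope with cat.
Local Open Scope cat_scope.

Record category := Category {
  obj :> Type;
  hom : obj -> obj -> Type;
  idc : forall a, hom a a;
  compc : forall a b c, hom b c -> hom a b -> hom a c;
  comp1c : forall a b (f : hom a b), compc (idc b) f = f;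
  compc1 : forall a b (f : hom a b), compc f (idc a) = f;
  compcA : forall a b c d (h : hom c d) (g : hom b c) (f : hom a b),
    compc h (compc g f) = compc (compc h g) f }.

Arguments hom {_} _ _.
Arguments idc {_} a.
Arguments compc {_} [_ _ _] _ _.
Notation "g \o f" := (compc g f) : cat_scope.
Notation "'id_ a" := (idc a) (at level 10, a at next level) : cat_scope.

Record iso (C : category) (a b : C) := Iso {
  fwd :> hom a b;
  bwd : hom b a;
  fwdK : bwd \o fwd = 'id_ a;
  bwdK : fwd \o bwd = 'id_ b }.

Definition is_iso (C : category) (a b : C) (f : hom a b) : Prop :=
  exists g : hom b a, g \o f = 'id_ a /\ f \o g = 'id_ b.

Definition groupoid (C : category) : Prop :=
  forall (a b : C) (f : hom a b), is_iso f.

Definition iso_id (C : category) (a : C) : iso a a :=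
  Iso (comp1c ('id_ a)) (comp1c ('id_ a)).

Lemma iso_compK (C : category) (a b c : C) (g : iso b c) (f : iso a b) :
  (bwd f \o bwd g) \o (fwd g \o fwd f) = 'id_ a.
Proof. by rewrite compcA -(compcA _ _ (fwd g)) fwdK compc1 fwdK. Qed.

Lemma iso_compKV (C : category) (a b c : C) (g : iso b c) (f : iso a b) :
  (fwd g \o fwd f) \o (bwd f \o bwd g) = 'id_ c.
Proof. by rewrite compcA -(compcA _ _ (bwd f)) bwdK compc1 bwdK. Qed.

Definition iso_comp (C : category) (a b c : C) (g : iso b c) (f : iso a b) :
  iso a c := Iso (iso_compK g f) (iso_compKV g f).

Definition opc (C : category) : category :=
  @Category C (fun a b => @hom C b a) (fun a => 'id_ a)
    (fun a b c g f => f \o g)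
    (fun a b f => compc1 f) (fun a b f => comp1c f)
    (fun a b c d h g f => esym (compcA f g h)).

Definition full (C : category) (P : C -> Prop) : category :=
  @Category {a : C | P a} (fun a b => hom (sval a) (sval b))
    (fun a => 'id_ (sval a)) (fun a b c g f => g \o f)
    (fun a b f => comp1c f) (fun a b f => compc1 f)
    (fun a b c d h g f => compcA h g f).

Record functor (C D : category) := Functor {
  fun_ob :> C -> D;
  fun_hom : forall a b, hom a b -> hom (fun_ob a) (fun_ob b);
  fun_id : forall a, fun_hom ('id_ a) = 'id_ (fun_ob a);
  fun_comp : forall a b c (g : hom b c) (f : hom a b),
    fun_hom (g \o f) = fun_hom g \o fun_hom f }.

Definition is_equivalence (C D : category) (F : functor C D) : Prop :=
  exists G : functor D C,
    (exists eta : forall a : C, iso a (G (F a)),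
       forall (a b : C) (f : hom a b),
         fwd (eta b) \o f = fun_hom G (fun_hom F f) \o fwd (eta a)) /\
    (exists eps : forall d : D, iso (F (G d)) d,
       forall (d e : D) (g : hom d e),
         fwd (eps e) \o fun_hom F (fun_hom G g) = g \o fwd (eps d)).

Section Limits.
Variable C : category.

Definition is_pullback (a1 a2 a p : C) (f : hom a1 a) (g : hom a2 a)
    (u : hom p a1) (v : hom p a2) : Prop :=
  f \o u = g \o v /\
  forall (t : C) (x : hom t a1) (y : hom t a2), f \o x = g \o y ->
    exists! w : hom t p, u \o w = x /\ v \o w = y.

Definition is_pushout (a1 a2 a p : C) (f : hom a a1) (g : hom a a2)
    (u : hom a1 p) (v : hom a2 p) : Prop :=
  u \o f = v \o g /\
  forall (t : C) (x : hom a1 t) (y : hom a2 t), x \o f = y \o g ->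
    exists! w : hom p t, w \o u = x /\ w \o v = y.

Definition is_zero (z : C) : Prop :=
  forall a : C, (exists! f : hom a z, True) /\ (exists! f : hom z a, True).

End Limits.

(* The formation of Ind^a and Pro^a and of their short exact sequences only
   uses the class of admissible short sequences (not the axioms of Quillen),
   and needs identities to be admissible. *)
Record ses_cat := SesCat {
  scat :> category;
  ses : forall a b c : scat, hom a b -> hom b c -> Prop;
  zero : scat;
  zeroP : is_zero zero;
  ses_id0 : forall (a : scat) (p : hom a zero), ses ('id_ a) p;
  ses_0id : forall (a : scat) (i : hom zero a), ses i ('id_ a) }.

Arguments ses {_} [_ _ _] _ _.
Arguments zero {_}.

Definition adm_mono (E : ses_cat) (a b : E) (i : hom a b) : Prop :=
  exists (c : E) (p : hom b c), ses i p.

Definition adm_epi (E : ses_cat) (b c : E) (p : hom b c) : Prop :=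
  exists (a : E) (i : hom a b), ses i p.

Lemma is_zero_op (C : category) (z : C) : is_zero z -> @is_zero (opc C) z.
Proof. by move=> zP a; case: (zP a). Qed.

Definition ops (E : ses_cat) : ses_cat :=
  @SesCat (opc E) (fun a b c i p => @ses E c b a p i) (@zero E)
    (is_zero_op (@zeroP E))
    (fun a p => @ses_0id E a p) (fun a i => @ses_id0 E a i).

Definition iso_ses (C : category) (a b c a' b' c' : C)
    (i : hom a b) (p : hom b c) (i' : hom a' b') (p' : hom b' c')
    (f : iso a a') (g : iso b b') (h : iso c c') : Prop :=
  i' \o fwd f = fwd g \o i /\ p' \o fwd g = fwd h \o p.

Record additive_cat := AdditiveCat {
  aobj : Type;
  ahom : aobj -> aobj -> zmodType;
  aid : forall a, ahom a a;
  acomp : forall a b c, ahom b c -> ahom a b -> ahom a c;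
  acomp1c : forall a b (f : ahom a b), acomp (aid b) f = f;
  acompc1 : forall a b (f : ahom a b), acomp f (aid a) = f;
  acompA : forall a b c d (h : ahom c d) (g : ahom b c) (f : ahom a b),
    acomp h (acomp g f) = acomp (acomp h g) f;
  acompDl : forall a b c (g g' : ahom b c) (f : ahom a b),
    acomp (g + g')%R f = (acomp g f + acomp g' f)%R;
  acompDr : forall a b c (g : ahom b c) (f f' : ahom a b),
    acomp g (f + f')%R = (acomp g f + acomp g f')%R;
  azero : aobj;
  azeroP : aid azero = 0%R;
  abiprod : forall a b, exists (c : aobj)
    (i1 : ahom a c) (i2 : ahom b c) (p1 : ahom c a) (p2 : ahom c b),
    [/\ acomp p1 i1 = aid a, acomp p2 i2 = aid b, acomp p1 i2 = 0%R,
        acomp p2 i1 = 0%R & (acomp i1 p1 + acomp i2 p2)%R = aid c] }.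

Definition add_cat (A : additive_cat) : category :=
  Category (@acomp1c A) (@acompc1 A) (@acompA A).

Section Exact.
Variable A : additive_cat.
Local Notation C := (add_cat A).

Definition zero_hom (a b : C) : hom a b := (0 : ahom a b)%R.

Definition is_biprod (a b c : C) (i1 : hom a c) (i2 : hom b c)
    (p1 : hom c a) (p2 : hom c b) : Prop :=
  [/\ p1 \o i1 = 'id_ a, p2 \o i2 = 'id_ b, p1 \o i2 = zero_hom b a,
      p2 \o i1 = zero_hom a b &
      ((i1 \o p1 : ahom c c) + (i2 \o p2 : ahom c c))%R = aid c].

Definition is_kernel (a b c : C) (i : hom a b) (p : hom b c) : Prop :=
  p \o i = zero_hom a c /\
  forall (t : C) (f : hom t b), p \o f = zero_hom t c ->
    exists! g : hom t a, i \o g = f.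

Definition is_cokernel (a b c : C) (i : hom a b) (p : hom b c) : Prop :=
  p \o i = zero_hom a c /\
  forall (t : C) (f : hom b t), f \o i = zero_hom a t ->
    exists! g : hom c t, g \o p = f.

Section Quillen.
Variable E : forall a b c : C, hom a b -> hom b c -> Prop.

Let mono (a b : C) (i : hom a b) : Prop :=
  exists (c : C) (p : hom b c), E i p.
Let epi (b c : C) (p : hom b c) : Prop :=
  exists (a : C) (i : hom a b), E i p.

(* Quillen's axioms; the last two fields are the (redundant) axiom c) of
   "Higher algebraic K-theory I", section 2. *)
Record quillen_exact : Prop := QuillenExact {
  q_iso : forall (a b c a' b' c' : C) (i : hom a b) (p : hom b c)
      (i' : hom a' b') (p' : hom b' c')
      (f : iso a a') (g : iso b b') (h : iso c c'),
    iso_ses i p i' p' f g h -> E i p -> E i' p';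
  q_split : forall (a b c : C) (i1 : hom a c) (i2 : hom b c)
      (p1 : hom c a) (p2 : hom c b), is_biprod i1 i2 p1 p2 -> E i1 p2;
  q_kernel : forall (a b c : C) (i : hom a b) (p : hom b c),
    E i p -> is_kernel i p;
  q_cokernel : forall (a b c : C) (i : hom a b) (p : hom b c),
    E i p -> is_cokernel i p;
  q_mono_comp : forall (a b c : C) (i : hom a b) (j : hom b c),
    mono i -> mono j -> mono (j \o i);
  q_epi_comp : forall (a b c : C) (p : hom a b) (q : hom b c),
    epi p -> epi q -> epi (q \o p);
  q_pushout : forall (a b c : C) (i : hom a b) (f : hom a c), mono i ->
    exists (d : C) (u : hom b d) (v : hom c d), is_pushout i f u v /\ mono v;
  q_pullback : forall (b c d : C) (p : hom b c) (f : hom d c), epi p ->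
    exists (a : C) (u : hom a b) (v : hom a d), is_pullback p f u v /\ epi v;
  q_obscure_epi : forall (k a b c : C) (i : hom k b) (f : hom b c)
      (g : hom a b), is_kernel i f -> epi (f \o g) -> epi f;
  q_obscure_mono : forall (k a b c : C) (p : hom b k) (f : hom a b)
      (g : hom b c), is_cokernel f p -> mono (g \o f) -> mono f }.

End Quillen.
End Exact.

Record exact_cat := ExactCat {
  xadd : additive_cat;
  xses : forall a b c : add_cat xadd, hom a b -> hom b c -> Prop;
  xquillen : quillen_exact xses }.

Lemma acomp0l (A : additive_cat) (b c d : aobj A) (f : ahom b c) :
  acomp (0 : ahom c d)%R f = 0%R.
Proof.
have /eqP := acompDl (0 : ahom c d)%R 0%R f.
by rewrite addr0 -subr_eq0 opprD addrA subrr sub0r oppr_eq0 => /eqP.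
Qed.

Lemma acomp0r (A : additive_cat) (b c d : aobj A) (f : ahom c d) :
  acomp f (0 : ahom b c)%R = 0%R.
Proof.
have /eqP := acompDr f (0 : ahom b c)%R 0%R.
by rewrite addr0 -subr_eq0 opprD addrA subrr sub0r oppr_eq0 => /eqP.
Qed.

Lemma add_zeroP (A : additive_cat) : @is_zero (add_cat A) (azero A).
Proof.
move=> a; split.
  exists (0 : ahom a (azero A))%R; split=> // f _.
  by rewrite -[RHS](acomp1c f) azeroP acomp0l.
exists (0 : ahom (azero A) a)%R; split=> // f _.
by rewrite -[RHS](acompc1 f) azeroP acomp0r.
Qed.

Lemma exact_ses_id0 (A : exact_cat) (a : add_cat (xadd A))
  (p : hom a (azero (xadd A))) : xses ('id_ a) p.
Proof.
have [_ [o [_ oU]]] := add_zeroP (azero (xadd A) : add_cat (xadd A)).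
apply: (q_split (xquillen A)
  (i2 := zero_hom (azero (xadd A) : add_cat (xadd A)) a) (p1 := 'id_ a)).
split.
- by rewrite comp1c.
- by rewrite -(oU ('id_ _)) // -(oU (_ \o _)).
- by rewrite comp1c.
- have [[q [_ qU]] _] := add_zeroP a.
  by rewrite -(qU (_ \o _)) // (qU (zero_hom _ _)).
- by rewrite [_ \o p]acomp0l addr0; apply: acompc1.
Qed.

Lemma exact_ses_0id (A : exact_cat) (a : add_cat (xadd A))
  (i : hom (azero (xadd A) : add_cat (xadd A)) a) : xses i ('id_ a).
Proof.
have [_ [o [_ oU]]] := add_zeroP (azero (xadd A) : add_cat (xadd A)).
apply: (q_split (xquillen A)
  (i2 := 'id_ a) (p1 := zero_hom a (azero (xadd A)))).
split.
- by rewrite -(oU ('id_ _)) // -(oU (_ \o _)).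
- by rewrite comp1c.
- by rewrite compc1.
- have [_ [q [_ qU]]] := add_zeroP a.
  by rewrite -(qU (_ \o _)) // (qU (zero_hom _ _)).
- by rewrite [i \o _]acomp0r add0r; apply: acompc1.
Qed.

Coercion exact_ses_cat (A : exact_cat) : ses_cat :=
  @SesCat (add_cat (xadd A)) (@xses A) (azero (xadd A)) (@add_zeroP (xadd A))
    (@exact_ses_id0 A) (@exact_ses_0id A).

Definition AIC (A : exact_cat) : Prop :=
  forall (a1 a2 a : A) (f : hom a1 a) (g : hom a2 a),
    adm_mono f -> adm_mono g ->
    exists (b : A) (u : hom b a1) (v : hom b a2),
      [/\ is_pullback f g u v, adm_mono u & adm_mono v].

Record filtered := Filtered {
  fob :> Set;
  fhom : fob -> fob -> Set;
  fid : forall i, fhom i i;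
  fcomp : forall i j k, fhom j k -> fhom i j -> fhom i k;
  fcomp1c : forall i j (u : fhom i j), fcomp (fid j) u = u;
  fcompc1 : forall i j (u : fhom i j), fcomp u (fid i) = u;
  fcompA : forall i j k l (w : fhom k l) (v : fhom j k) (u : fhom i j),
    fcomp w (fcomp v u) = fcomp (fcomp w v) u;
  fnonempty : inhabited fob;
  fbound : forall i j, exists k, inhabited (fhom i k) /\ inhabited (fhom j k);
  fcoeq : forall i j (u v : fhom i j),
    exists (k : fob) (w : fhom j k), fcomp w u = fcomp w v }.

Arguments fid {f} i.
Arguments fcomp {f} [i j k] _ _.

Definition countable_set (T : Type) : Prop :=
  exists f : T -> nat, injective f.

Definition countable_index (J : filtered) : Prop :=
  countable_set J /\ forall i j : J, countable_set (fhom i j).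

Record diagram (J : filtered) (C : category) := Diagram {
  dob :> J -> C;
  dmap : forall i j, fhom i j -> hom (dob i) (dob j);
  dmap1 : forall i, dmap (fid i) = 'id_ (dob i);
  dmapM : forall i j k (v : fhom j k) (u : fhom i j),
    dmap (fcomp v u) = dmap v \o dmap u }.

Record dtrans (J : filtered) (C : category) (X Y : diagram J C) := DTrans {
  dtr :> forall j, hom (X j) (Y j);
  dtr_nat : forall i j (u : fhom i j), dtr j \o dmap X u = dmap Y u \o dtr i }.

Record ind_ob (C : category) := IndOb {
  idx : filtered;
  idiag :> diagram idx C }.

Section Ind.
Variable C : category.
Implicit Types X Y Z : ind_ob C.

(* Hom(X, Y) = lim_i colim_j Hom(X_i, Y_j): a point of colim_j Hom(c, Y_j)
   is a class of germs, so that a morphism is a compatible family of classes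
   of germs indexed by i. *)
Definition germ Y (c : C) := {j : idx Y & hom c (Y j)}.

Definition Germ Y (c : C) (j : idx Y) (f : hom c (Y j)) : germ Y c :=
  existT (fun j => hom c (Y j)) j f.

Definition germ_eq Y (c : C) (s t : germ Y c) : Prop :=
  exists (k : idx Y) (u : fhom (tag s) k) (v : fhom (tag t) k),
    dmap Y u \o tagged s = dmap Y v \o tagged t.

Definition germ_pre Y (b c : C) (s : germ Y c) (f : hom b c) : germ Y b :=
  Germ (tagged s \o f).

Record ind_hom X Y := IndHom {
  germs : forall i : idx X, germ Y (X i) -> Prop;
  germsP : forall i, exists s, @germs i = germ_eq s;
  germs_compat : forall (i j : idx X) (u : fhom i j) (s : germ Y (X j)),
    germs s -> germs (germ_pre s (dmap X u)) }.

Lemma germ_eq_refl Y c (s : germ Y c) : germ_eq s s.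
Proof. by exists (tag s), (fid _), (fid _). Qed.

Lemma germ_eq_sym Y c (s t : germ Y c) : germ_eq s t -> germ_eq t s.
Proof. by move=> [k [u [v e]]]; exists k, v, u. Qed.

Lemma germ_eq_trans Y c (t s r : germ Y c) :
  germ_eq s t -> germ_eq t r -> germ_eq s r.
Proof.
move=> [k [u [v e]]] [k' [u' [v' e']]].
have [l [[x] [y]]] := fbound k k'.
have [m [w E]] := fcoeq (fcomp x v) (fcomp y u').
exists m, (fcomp w (fcomp x u)), (fcomp w (fcomp y v')).
rewrite !dmapM -!compcA e -e'.
by rewrite !compcA -!dmapM -!fcompA E.
Qed.

Lemma germ_eq_pre Y (b c : C) (s t : germ Y c) (f : hom b c) :
  germ_eq s t -> germ_eq (germ_pre s f) (germ_pre t f).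
Proof.
by move=> [k [u [v e]]]; exists k, u, v; rewrite /germ_pre /= !compcA e.
Qed.

Lemma germ_preA Y (a b c : C) (s : germ Y c) (g : hom b c) (f : hom a b) :
  germ_pre (germ_pre s g) f = germ_pre s (g \o f).
Proof. by rewrite /germ_pre /= -compcA. Qed.

Lemma germ_pre1 Y (c : C) (s : germ Y c) : germ_pre s ('id_ c) = s.
Proof. by case: s => j f; rewrite /germ_pre /= compc1. Qed.

Lemma germ_up Y c (s : germ Y c) (k : idx Y) (u : fhom (tag s) k) :
  germ_eq (Germ (dmap Y u \o tagged s)) s.
Proof. by exists k, (fid _), u; rewrite /= dmap1 comp1c. Qed.

Lemma germ_eqE Y c (s t : germ Y c) : germ_eq s t -> germ_eq s = germ_eq t.
Proof.
move=> st; apply: funext => r; apply: propext; split.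
  exact/germ_eq_trans/germ_eq_sym.
exact: germ_eq_trans.
Qed.

Lemma germs_ex X Y (f : ind_hom X Y) i : exists s, germs f (i := i) s.
Proof. by have [s ->] := germsP f i; exists s; apply: germ_eq_refl. Qed.

Lemma germs_eq X Y (f : ind_hom X Y) i (s t : germ Y (X i)) :
  germs f s -> germs f t <-> germ_eq s t.
Proof.
have [r ->] := germsP f i => rs; split.
  exact/germ_eq_trans/germ_eq_sym.
exact: germ_eq_trans.
Qed.

Lemma ind_homP X Y (f g : ind_hom X Y) :
  (forall i, exists2 s, germs f (i := i) s & germs g (i := i) s) -> f = g.
Proof.
move=> fg; have E : germs f = germs g.
  apply: functional_extensionality_dep => i; apply: funext => t.
  have [s fs gs] := fg i.
  by apply: propext; rewrite (germs_eq t fs) (germs_eq t gs).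
case: f g E {fg} => f f1 f2 [g g1 g2] /= E.
by case: _ / E g1 g2 => g1 g2; congr IndHom; apply: Prop_irrelevance.
Qed.

Lemma germ_eq_comp X Y (g : ind_hom X Y) c (s s' : germ X c) t t' :
  germ_eq s s' -> germs g (i := tag s) t -> germs g (i := tag s') t' ->
  germ_eq (germ_pre t (tagged s)) (germ_pre t' (tagged s')).
Proof.
move=> [k [u [v e]]] gt gt'; have [r gr] := germs_ex g k.
have /(germs_eq _ gt)/(germ_eq_pre (tagged s)) := germs_compat u gr.
rewrite germ_preA e -germ_preA => /germ_eq_trans; apply.
exact/germ_eq_pre/germ_eq_sym/(germs_eq _ gt')/germs_compat.
Qed.

Lemma ind_of_subproof1 X Y (s : forall i, germ Y (X i)) :
  forall i, exists t, germ_eq (s i) = germ_eq t.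
Proof. by move=> i; exists (s i). Qed.

Lemma ind_of_subproof2 X Y (s : forall i, germ Y (X i))
  (H : forall i j (u : fhom i j), germ_eq (germ_pre (s j) (dmap X u)) (s i)) :
  forall i j (u : fhom i j) t,
    germ_eq (s j) t -> germ_eq (s i) (germ_pre t (dmap X u)).
Proof.
move=> i j u t st; apply: germ_eq_trans (germ_eq_pre _ st).
exact/germ_eq_sym/H.
Qed.

Definition ind_of X Y (s : forall i, germ Y (X i))
    (H : forall i j (u : fhom i j),
       germ_eq (germ_pre (s j) (dmap X u)) (s i)) : ind_hom X Y :=
  IndHom (ind_of_subproof1 s) (ind_of_subproof2 H).

Lemma ind_id_subproof X (i j : idx X) (u : fhom i j) :
  germ_eq (germ_pre (Germ ('id_ (X j))) (dmap X u)) (Germ ('id_ (X i))).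
Proof. by exists j, (fid _), u; rewrite /= dmap1 !comp1c compc1. Qed.

Definition ind_id X : ind_hom X X :=
  ind_of (@ind_id_subproof X).

Section Comp.
Variables (X Y Z : ind_ob C) (g : ind_hom Y Z) (f : ind_hom X Y).

Definition ind_comp_germs (i : idx X) (t : germ Z (X i)) : Prop :=
  exists (s : germ Y (X i)) (r : germ Z (Y (tag s))),
    [/\ germs f s, germs g r & germ_eq (germ_pre r (tagged s)) t].

Lemma ind_comp_germsE i s r : germs f (i := i) s -> germs g r ->
  @ind_comp_germs i = germ_eq (germ_pre r (tagged s)).
Proof.
move=> fs gr; apply: funext => t; apply: propext; split; last by exists s, r.
move=> [s' [r' [fs' gr']]]; apply: germ_eq_trans.
by apply: (germ_eq_comp (g := g)) => //; apply/(germs_eq _ fs).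
Qed.

Lemma ind_comp_subproof1 i : exists t, @ind_comp_germs i = germ_eq t.
Proof.
have [s fs] := germs_ex f i; have [r gr] := germs_ex g (tag s).
by exists (germ_pre r (tagged s)); apply: ind_comp_germsE.
Qed.

Lemma ind_comp_subproof2 (i j : idx X) (u : fhom i j) t :
  @ind_comp_germs j t -> ind_comp_germs (germ_pre t (dmap X u)).
Proof.
move=> [s [r [fs gr /(germ_eq_pre (dmap X u)) e]]].
exists (germ_pre s (dmap X u)), r; split=> //; first exact: germs_compat.
by rewrite germ_preA in e.
Qed.

Definition ind_comp : ind_hom X Z :=
  IndHom ind_comp_subproof1 ind_comp_subproof2.

End Comp.

Lemma ind_comp_mem X Y Z (g : ind_hom Y Z) (f : ind_hom X Y) i s r :
  germs f (i := i) s -> germs g r ->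
  germs (ind_comp g f) (germ_pre r (tagged s)).
Proof. by move=> fs gr; exists s, r; split=> //; apply: germ_eq_refl. Qed.

Lemma ind_comp1c X Y (f : ind_hom X Y) : ind_comp (ind_id Y) f = f.
Proof.
apply: ind_homP => i; have [[j s] fs] := germs_ex f i.
have /(ind_comp_mem fs) : germs (ind_id Y) (i := j) (Germ ('id_ (Y j))).
  exact: germ_eq_refl.
by rewrite /germ_pre /= comp1c; exists (existT _ j s).
Qed.

Lemma ind_compc1 X Y (f : ind_hom X Y) : ind_comp f (ind_id X) = f.
Proof.
apply: ind_homP => i; have [s fs] := germs_ex f i.
have Ii : germs (ind_id X) (i := i) (Germ ('id_ (X i))).
  exact: germ_eq_refl.
by have := ind_comp_mem Ii fs; rewrite germ_pre1; exists s.
Qed.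

Lemma ind_compA X Y Z T (h : ind_hom Z T) (g : ind_hom Y Z) (f : ind_hom X Y) :
  ind_comp h (ind_comp g f) = ind_comp (ind_comp h g) f.
Proof.
apply: ind_homP => i; have [s fs] := germs_ex f i.
have [r gr] := germs_ex g (tag s); have [q hq] := germs_ex h (tag r).
exists (germ_pre q (tagged (germ_pre r (tagged s)))).
  exact: (ind_comp_mem (ind_comp_mem fs gr) hq).
have := ind_comp_mem fs (ind_comp_mem gr hq).
by rewrite germ_preA.
Qed.

Definition ind : category := Category ind_comp1c ind_compc1 ind_compA.

Section Level.
Variable J : filtered.

Lemma ind_level_subproof (X Y : diagram J C) (a : dtrans X Y)
    (i j : J) (u : fhom i j) :
  germ_eq (germ_pre (@Germ (IndOb Y) _ j (a j)) (dmap X u))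
    (@Germ (IndOb Y) _ i (a i)).
Proof. by exists j, (fid _), u; rewrite /= dmap1 comp1c dtr_nat. Qed.

Definition ind_level (X Y : diagram J C) (a : dtrans X Y) :
    @hom ind (IndOb X) (IndOb Y) :=
  @ind_of (IndOb X) (IndOb Y) _ (@ind_level_subproof X Y a).

End Level.
End Ind.

Lemma ind_level_id (C : category) (J : filtered) (X : diagram J C)
    (a : dtrans X X) : (forall j, a j = 'id_ (X j)) ->
  ind_level a = 'id_ (IndOb X : ind C).
Proof.
move=> aE; apply: ind_homP => i; exists (@Germ C (IndOb X) _ i (a i)).
  exact: germ_eq_refl.
by rewrite aE; apply: germ_eq_refl.
Qed.

Lemma ind_level_comp (C : category) (J : filtered) (X Y Z : diagram J C)
    (b : dtrans Y Z) (a : dtrans X Y) (c : dtrans X Z) :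
  (forall j, c j = b j \o a j) ->
  ind_level c = (ind_level b : @hom (ind C) _ _) \o ind_level a.
Proof.
move=> cE; apply: ind_homP => i; exists (@Germ C (IndOb Z) _ i (c i)).
  exact: germ_eq_refl.
rewrite cE.
have ai : germs (ind_level a) (i := i) (@Germ C (IndOb Y) _ i (a i)).
  exact: germ_eq_refl.
have bi : germs (ind_level b) (i := i) (@Germ C (IndOb Z) _ i (b i)).
  exact: germ_eq_refl.
exact: (ind_comp_mem ai bi).
Qed.

Section Const.
Variables (J : filtered) (C : category).

Definition dconst (a : C) : diagram J C :=
  @Diagram J C (fun _ => a) (fun _ _ _ => 'id_ a) (fun _ => erefl)
    (fun _ _ _ _ _ => esym (comp1c ('id_ a))).

Lemma dconst_hom_subproof (a b : C) (f : hom a b) (i j : J) (u : fhom i j) :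
  f \o dmap (dconst a) u = dmap (dconst b) u \o f.
Proof. by rewrite /= comp1c compc1. Qed.

Definition dconst_hom (a b : C) (f : hom a b) : dtrans (dconst a) (dconst b) :=
  @DTrans J C (dconst a) (dconst b) (fun _ => f) (dconst_hom_subproof f).

End Const.

Local Obligation Tactic := idtac.

Program Definition pt_index : filtered :=
  @Filtered unit (fun _ _ => unit) (fun _ => tt) (fun _ _ _ _ _ => tt)
    _ _ _ _ _ _.
Next Obligation. by move=> i j []. Qed.
Next Obligation. by move=> i j []. Qed.
Next Obligation. by []. Qed.
Next Obligation. exact: (inhabits tt). Qed.
Next Obligation. by move=> i j; exists tt. Qed.
Next Obligation. by move=> i j u v; exists tt, tt. Qed.

(* fhom m n is the proposition m <= n, which has at most one proof. *)
Program Definition nat_index : filtered :=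
  @Filtered nat (fun m n => (m <= n)%N) leqnn
    (fun m n p h h' => leq_trans h' h) _ _ _ _ _ _.
Next Obligation. by move=> *; apply: Prop_irrelevance. Qed.
Next Obligation. by move=> *; apply: Prop_irrelevance. Qed.
Next Obligation. by move=> *; apply: Prop_irrelevance. Qed.
Next Obligation. exact: (inhabits 0%N). Qed.
Next Obligation.
by move=> i j; exists (maxn i j); split; apply: inhabits; rewrite ?leq_maxl ?leq_maxr.
Qed.
Next Obligation. by move=> i j u v; exists j, (leqnn j); apply: Prop_irrelevance. Qed.

Program Definition int_index : filtered :=
  @Filtered int (fun i j => (i <= j)%R) (fun i => lexx i)
    (fun i j k h h' => le_trans h' h) _ _ _ _ _ _.
Next Obligation. by move=> *; apply: Prop_irrelevance. Qed.
Next Obligation. by move=> *; apply: Prop_irrelevance. Qed.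
Next Obligation. by move=> *; apply: Prop_irrelevance. Qed.
Next Obligation. exact: (inhabits 0%R). Qed.
Next Obligation.
by move=> i j; exists (Num.max i j); split; apply: inhabits; rewrite le_max lexx ?orbT.
Qed.
Next Obligation. by move=> i j u v; exists j, (lexx j); apply: Prop_irrelevance. Qed.

Lemma countable_pt : countable_index pt_index.
Proof. by split=> [|i j]; exists (fun _ => 0%N) => -[] []. Qed.

Lemma countable_nat : countable_index nat_index.
Proof.
split=> [|i j]; first by exists id.
by exists (fun _ => 0%N) => x y _; apply: (@Prop_irrelevance (is_true (i <= j)%N)).
Qed.

Section Inda.
Variable E : ses_cat.

Definition inda_ob (X : ind E) : Prop :=
  countable_index (idx X) /\
  forall (i j : idx X) (u : fhom i j), adm_mono (dmap X u).

Definition ind_ses (X' X X'' : ind E) (f : hom X' X) (g : hom X X'') : Prop :=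
  exists (J : filtered) (S' S S'' : diagram J E)
    (a : dtrans S' S) (b : dtrans S S''),
    [/\ inda_ob (IndOb S'), inda_ob (IndOb S), inda_ob (IndOb S''),
        forall j, ses (a j) (b j) &
        exists (x' : @iso (ind E) (IndOb S') X') (x : @iso (ind E) (IndOb S) X)
          (x'' : @iso (ind E) (IndOb S'') X''),
          @iso_ses (ind E) _ _ _ _ _ _ (ind_level a) (ind_level b) f g
            x' x x''].

Lemma to_zero (a : E) : {f : hom a zero | forall g, f = g}.
Proof.
by apply: cid; have [[f [_ fU]] _] := zeroP a; exists f => g; apply: fU.
Qed.

Lemma from_zero (a : E) : {f : hom zero a | forall g, f = g}.
Proof.
by apply: cid; have [_ [f [_ fU]]] := zeroP a; exists f => g; apply: fU.
Qed.

Lemma hom_to_zero (a : E) (f g : hom a zero) : f = g.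
Proof. by have [h hU] := to_zero a; rewrite -(hU f) -(hU g). Qed.

Lemma hom_from_zero (a : E) (f g : hom zero a) : f = g.
Proof. by have [h hU] := from_zero a; rewrite -(hU f) -(hU g). Qed.

Lemma adm_mono_id (a : E) : adm_mono ('id_ a).
Proof.
exists zero, (sval (to_zero a)).
exact: (ses_id0 (sval (to_zero a))).
Qed.

Lemma inda_const (J : filtered) (a : E) :
  countable_index J -> inda_ob (IndOb (dconst J a)).
Proof. by move=> cJ; split=> // i j u; apply: adm_mono_id. Qed.

Lemma ind_is_zero (J : filtered) : @is_zero (ind E) (IndOb (dconst J zero)).
Proof.
have [j0] := fnonempty J.
move=> X; split.
  have H (i j : idx X) (u : fhom i j) : germ_eq
      (germ_pre (@Germ _ (IndOb (dconst J zero)) _ j0 (sval (to_zero (X j))))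
         (dmap X u))
      (@Germ _ (IndOb (dconst J zero)) _ j0 (sval (to_zero (X i)))).
    by exists j0, (fid _), (fid _); apply: hom_to_zero.
  exists (ind_of H); split=> // f _; apply: ind_homP => i.
  have [[j t] ft] := germs_ex f i; exists (existT _ j t) => //.
  have [k [[u] [v]]] := fbound j0 j.
  by exists k, u, v; apply: hom_to_zero.
have [i0] := fnonempty (idx X).
have H (i j : J) (u : fhom i j) : germ_eq
    (germ_pre (Germ (sval (from_zero (X i0))))
       (dmap (IndOb (dconst J zero)) u))
    (Germ (sval (from_zero (X i0)))).
  by exists i0, (fid _), (fid _); apply: hom_from_zero.
exists (@ind_of _ (IndOb (dconst J zero)) _ _ H); split=> // f _.
apply: ind_homP => i.
have [[j t] ft] := germs_ex f i; exists (existT _ j t) => //.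
have [k [[u] [v]]] := fbound i0 j.
by exists k, u, v; apply: hom_from_zero.
Qed.

Lemma zero_iso (C : category) (z z' : C) :
  is_zero z -> is_zero z' -> exists f : iso z z', True.
Proof.
move=> zP z'P; have [_ [f _]] := zP z'; have [_ [g _]] := z'P z.
have fK : g \o f = 'id_ z.
  by have [_ [h [_ hU]]] := zP z; rewrite -(hU ('id_ z)) // -(hU (_ \o _)).
have gK : f \o g = 'id_ z'.
  by have [_ [h [_ hU]]] := z'P z'; rewrite -(hU ('id_ z')) // -(hU (_ \o _)).
by exists (Iso fK gK).
Qed.

Definition inda_cat : category := full inda_ob.

Definition icst (a : E) : inda_cat :=
  exist _ (IndOb (dconst pt_index a) : ind E) (inda_const a countable_pt).

Definition icst_hom (a b : E) (f : hom a b) : hom (icst a) (icst b) :=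
  ind_level (dconst_hom pt_index f).

Lemma icst_zeroP : is_zero (icst zero).
Proof. by move=> X; apply: (ind_is_zero pt_index (sval X)). Qed.

Lemma inda_ses_id0 (X : inda_cat) (p : hom X (icst zero)) :
  @ind_ses (sval X) (sval X) (sval (icst zero)) ('id_ X) p.
Proof.
case: X p => [[J X] XP] p; have cJ : countable_index J := proj1 XP.
have a1P (i j : J) (u : fhom i j) : 'id_ (X j) \o dmap X u = dmap X u \o 'id_ (X i).
  by rewrite comp1c compc1.
have bP (i j : J) (u : fhom i j) : sval (to_zero (X j)) \o dmap X u =
    dmap (dconst J zero) u \o sval (to_zero (X i)).
  exact: hom_to_zero.
have [z _] := zero_iso (ind_is_zero J) (ind_is_zero pt_index).
exists J, X, X, (dconst J zero), (DTrans a1P), (@DTrans _ _ X (dconst J zero) _ bP).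
split=> //; first exact: inda_const.
  by move=> j; apply: ses_id0.
exists (iso_id (IndOb X : ind E)), (iso_id (IndOb X : ind E)), z.
split; first by rewrite ind_level_id.
have [[q [_ qU]] _] := ind_is_zero pt_index (IndOb X).
by rewrite -(qU (_ \o _)) // -(qU (_ \o _)).
Qed.

Lemma inda_ses_0id (X : inda_cat) (m : hom (icst zero) X) :
  @ind_ses (sval (icst zero)) (sval X) (sval X) m ('id_ X).
Proof.
case: X m => [[J X] XP] m; have cJ : countable_index J := proj1 XP.
have b1P (i j : J) (u : fhom i j) : 'id_ (X j) \o dmap X u = dmap X u \o 'id_ (X i).
  by rewrite comp1c compc1.
have aP (i j : J) (u : fhom i j) : sval (from_zero (X j)) \o
    dmap (dconst J zero) u = dmap X u \o sval (from_zero (X i)).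
  exact: hom_from_zero.
have [z _] := zero_iso (ind_is_zero J) (ind_is_zero pt_index).
exists J, (dconst J zero), X, X, (@DTrans _ _ (dconst J zero) X _ aP), (DTrans b1P).
split=> //; first exact: inda_const.
  by move=> j; apply: ses_0id.
exists z, (iso_id (IndOb X : ind E)), (iso_id (IndOb X : ind E)).
split; last by rewrite ind_level_id.
have [_ [q [_ qU]]] := ind_is_zero J (IndOb X).
by rewrite -(qU (_ \o _)) // -(qU (_ \o _)).
Qed.

Definition inda : ses_cat :=
  @SesCat inda_cat (fun X' X X'' f g => @ind_ses (sval X') (sval X) (sval X'') f g)
    (icst zero) icst_zeroP inda_ses_id0 inda_ses_0id.

End Inda.

(* Pro^a(E) = Ind^a(E^op)^op: admissible epimorphisms of E are the admissible
   monomorphisms of E^op, and Hom(X, Y) = lim_j colim_i Hom(X_i, Y_j). *)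
Definition proa (E : ses_cat) : ses_cat := ops (inda (ops E)).

Definition pcst (E : ses_cat) (a : E) : proa E := icst (E := ops E) a.

Definition pcst_hom (E : ses_cat) (a b : E) (f : hom a b) :
    hom (pcst a) (pcst b) :=
  @icst_hom (ops E) b a f.

Lemma icst_hom_id (E : ses_cat) (a : E) : icst_hom ('id_ a) = 'id_ (icst a).
Proof. exact: ind_level_id. Qed.

Lemma icst_hom_comp (E : ses_cat) (a b c : E) (g : hom b c) (f : hom a b) :
  icst_hom (g \o f) = icst_hom g \o icst_hom f.
Proof. exact: ind_level_comp. Qed.

Lemma pcst_hom_id (E : ses_cat) (a : E) : pcst_hom ('id_ a) = 'id_ (pcst a).
Proof. exact: (@icst_hom_id (ops E)). Qed.

Lemma pcst_hom_comp (E : ses_cat) (a b c : E) (g : hom b c) (f : hom a b) :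
  pcst_hom (g \o f) = pcst_hom g \o pcst_hom f.
Proof. exact: (@icst_hom_comp (ops E)). Qed.

Lemma icst_ses (E : ses_cat) (a b c : E) (i : hom a b) (p : hom b c) :
  ses i p -> @ses (inda E) _ _ _ (icst_hom i) (icst_hom p).
Proof.
move=> ip; exists pt_index, (dconst _ a), (dconst _ b), (dconst _ c),
  (dconst_hom _ i), (dconst_hom _ p); split=> //.
- exact/inda_const/countable_pt.
- exact/inda_const/countable_pt.
- exact/inda_const/countable_pt.
exists (iso_id _), (iso_id _), (iso_id _).
by split; rewrite /icst_hom /= ind_comp1c ind_compc1.
Qed.

Lemma pcst_ses (E : ses_cat) (a b c : E) (i : hom a b) (p : hom b c) :
  ses i p -> ses (pcst_hom i) (pcst_hom p).
Proof. exact: (@icst_ses (ops E) c b a p i). Qed.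

Section IndPro.
Variable E : ses_cat.

Definition dpcst (J : filtered) (X : diagram J E) : diagram J (proa E) :=
  @Diagram J (proa E) (fun j => pcst (X j)) (fun i j u => pcst_hom (dmap X u))
    (fun i => etrans (congr1 (@pcst_hom E _ _) (dmap1 X i)) (pcst_hom_id (X i)))
    (fun i j k v u => etrans (congr1 (@pcst_hom E _ _) (dmapM X v u))
                        (pcst_hom_comp (dmap X v) (dmap X u))).

Lemma dpcst_inda (X : inda E) :
  inda_ob (IndOb (dpcst (idiag (sval X))) : ind (proa E)).
Proof.
case: X => X [cX aX]; split=> // i j u.
have [c [p sp]] := aX i j u.
by exists (pcst c), (pcst_hom p); apply: pcst_ses.
Qed.

Definition ipcst (X : inda E) : inda (proa E) := exist _ _ (dpcst_inda X).

(* Pro^a(E) and Ind^a(E) as (isomorphism closed) subcategories of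
   Ind^a(Pro^a(E)), through constant systems. *)
Definition in_proa (X : inda (proa E)) : Prop :=
  exists L : proa E, inhabited (iso X (icst L)).

Definition in_inda (X : inda (proa E)) : Prop :=
  exists Z : inda E, inhabited (iso X (ipcst Z)).

Definition emb (a : E) : inda (proa E) := icst (pcst a).

Definition emb_hom (a b : E) (f : hom a b) : hom (emb a) (emb b) :=
  icst_hom (pcst_hom f).

End IndPro.

(* X_{i,j} is only meaningful for i <= j.  That the cartesian squares are also
   cocartesian is a consequence of the exactness of E. *)
Record bsystem (E : ses_cat) := BSystem {
  bob : int -> int -> E;
  bup : forall i j j' : int, (i <= j)%R -> (j <= j')%R ->
    hom (bob i j) (bob i j');
  bdn : forall i i' j : int, (i <= i')%R -> (i' <= j)%R ->
    hom (bob i j) (bob i' j);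
  bup1 : forall i j (h : (i <= j)%R) (h' : (j <= j)%R),
    bup h h' = 'id_ (bob i j);
  bupM : forall i j j' j'' (h : (i <= j)%R) (h' : (j <= j')%R)
      (k : (i <= j')%R) (k' : (j' <= j'')%R) (l : (j <= j'')%R),
    bup k k' \o bup h h' = bup h l;
  bdn1 : forall i j (h : (i <= i)%R) (h' : (i <= j)%R),
    bdn h h' = 'id_ (bob i j);
  bdnM : forall i i' i'' j (h : (i <= i')%R) (h' : (i' <= j)%R)
      (k : (i' <= i'')%R) (k' : (i'' <= j)%R) (l : (i <= i'')%R),
    bdn k k' \o bdn h h' = bdn l k';
  bup_mono : forall i j j' (h : (i <= j)%R) (h' : (j <= j')%R),
    adm_mono (bup h h');
  bdn_epi : forall i i' j (h : (i <= i')%R) (h' : (i' <= j)%R),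
    adm_epi (bdn h h');
  bcart : forall i i' j j' (hi : (i <= i')%R) (hij : (i' <= j)%R)
      (hj : (j <= j')%R) (k : (i <= j)%R) (l : (i' <= j')%R),
    is_pullback (bup hij hj) (bdn hi l) (bdn hi hij) (bup k hj) }.

Section Beilinson.
Variables (E : ses_cat) (D : bsystem E).

Lemma subz_le (j : int) (m n : nat) : (m <= n)%N -> (j - n%:Z <= j - m%:Z)%R.
Proof. lia. Qed.

Lemma subz_le0 (j : int) (n : nat) : (j - n%:Z <= j)%R.
Proof. lia. Qed.

Lemma subz_le2 (j j' : int) (n : nat) :
  (j <= j')%R -> (j - n%:Z <= j' - n%:Z)%R.
Proof. lia. Qed.

(* "lim"_{i <= j} X_{i,j}, with the indices i <= j written as j - n *)
Program Definition brow_diag (j : int) : diagram nat_index (opc E) :=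
  @Diagram nat_index (opc E) (fun n : nat => bob D (j - n%:Z)%R j)
    (fun m n h => bdn D (subz_le j h) (subz_le0 j m)) _ _.
Next Obligation. by move=> j n; apply: bdn1. Qed.
Next Obligation.
by move=> j m n p v u; rewrite /= (bdnM _ _ _ _ _ (subz_le j (leq_trans u v))).
Qed.

Lemma brow_inda (j : int) : @inda_ob (ops E) (IndOb (brow_diag j)).
Proof. by split=> [|m n h]; [exact: countable_nat|exact: (bdn_epi D (subz_le j h) (subz_le0 j m))]. Qed.

Definition brow (j : int) : proa E :=
  exist _ (IndOb (brow_diag j) : ind (ops E)) (brow_inda j).

Section Map.
Variables (j j' : int) (h : (j <= j')%R).

Definition brow_map_at (n : nat) :
    hom (bob D (j - n%:Z)%R j) (bob D (j' - n%:Z)%R j') :=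
  bdn D (subz_le2 n h) (subz_le0 j' n) \o bup D (subz_le0 j n) h.

Lemma brow_map_subproof (m n : nat) (u : (m <= n)%N) :
  brow_map_at m \o bdn D (subz_le j u) (subz_le0 j m) =
  bdn D (subz_le j' u) (subz_le0 j' m) \o brow_map_at n.
Proof.
rewrite /brow_map_at -compcA.
have l : (j - m%:Z <= j')%R by lia.
have k : (j - n%:Z <= j' - m%:Z)%R by lia.
have [-> _] := bcart D (subz_le j u) (subz_le0 j m) h (subz_le0 j n) l.
rewrite !compcA (bdnM _ _ _ _ _ k).
by rewrite (bdnM _ _ _ _ _ k).
Qed.

Definition brow_map : hom (brow j) (brow j') :=
  @ind_level (opc E) nat_index (brow_diag j') (brow_diag j)
    (@DTrans nat_index (opc E) (brow_diag j') (brow_diag j) brow_map_at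
      (fun m n u => esym (brow_map_subproof u))).

End Map.

Lemma brow_map1 (j : int) (h : (j <= j)%R) : brow_map h = 'id_ (brow j).
Proof.
by apply: ind_level_id => n; rewrite /= /brow_map_at bup1 bdn1 comp1c.
Qed.

Lemma brow_mapM (j j' j'' : int) (h : (j <= j')%R) (h' : (j' <= j'')%R)
    (k : (j <= j'')%R) : brow_map k = brow_map h' \o brow_map h.
Proof.
apply: ind_level_comp => n /=; rewrite /brow_map_at.
have l : (j - n%:Z <= j')%R by lia.
have l' : (j' - n%:Z <= j'')%R by lia.
rewrite -!compcA.
rewrite [X in _ = _ \o X]compcA.
have [-> _] := bcart D (subz_le2 n h) (subz_le0 j' n) h' l l'.
rewrite -compcA (bupM _ _ _ _ _ k) compcA.
by rewrite (bdnM _ _ _ _ _ (subz_le2 n k)).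
Qed.

Definition bdiag : diagram int_index (proa E) :=
  @Diagram int_index (proa E) brow (fun j j' h => brow_map h)
    (fun j => brow_map1 (lexx j))
    (fun j j' j'' h' h => brow_mapM h h' (le_trans h h')).

(* "colim"_j "lim"_i X_{i,j} *)
Definition blim : ind (proa E) := IndOb bdiag.

End Beilinson.

(* The Beilinson category is taken closed under isomorphism. *)
Definition is_beilinson (E : ses_cat) (X : inda (proa E)) : Prop :=
  exists D : bsystem E, inhabited (@iso (ind (proa E)) (sval X) (blim D)).

Definition beilinson (E : ses_cat) : category := full (@is_beilinson E).

Definition bses (E : ses_cat) (X' X X'' : beilinson E)
    (i : hom X' X) (p : hom X X'') : Prop :=
  @ses (inda (proa E)) (sval X') (sval X) (sval X'') i p.

Section Grassmannian.
Variables (E : ses_cat) (X : beilinson E).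

Record subobject := Subobject {
  sub_ob : beilinson E;
  sub_hom : hom sub_ob X;
  sub_quo : exists (Q : beilinson E) (p : hom X Q),
    bses sub_hom p /\ in_inda (sval Q);
  sub_pro : in_proa (sval sub_ob) }.

Definition sub_eq (U V : subobject) : Prop :=
  exists f : iso (sub_ob U) (sub_ob V), sub_hom V \o fwd f = sub_hom U.

(* The set of equivalence classes of subobjects, a class being a predicate. *)
Definition gamma := {c : subobject -> Prop | exists U, c = sub_eq U}.

(* An admissible short exact sequence U >-> V ->> V/U with V/U in E, the
   inclusion being over X, with (u, v) representatives of (U, V). *)
Record rel_ses (U V : gamma) := RelSes {
  rs_u : subobject;
  rs_v : subobject;
  rs_uP : sval U rs_u;
  rs_vP : sval V rs_v;
  rs_i : hom (sub_ob rs_u) (sub_ob rs_v);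
  rs_over : sub_hom rs_v \o rs_i = sub_hom rs_u;
  rs_q : E;
  rs_p : @hom (inda (proa E)) (sval (sub_ob rs_v)) (emb rs_q);
  rs_ses : @ses (inda (proa E)) (sval (sub_ob rs_u)) _ _ rs_i rs_p }.

(* An isomorphism of such sequences over X, as Delta is only defined on
   subobjects of X. *)
Record rel_ses_iso (U V : gamma) (S T : rel_ses U V) := RelSesIso {
  rsi_u : iso (sub_ob (rs_u S)) (sub_ob (rs_u T));
  rsi_v : iso (sub_ob (rs_v S)) (sub_ob (rs_v T));
  rsi_q : iso (rs_q S) (rs_q T);
  rsi_uX : sub_hom (rs_u T) \o rsi_u = sub_hom (rs_u S);
  rsi_vX : sub_hom (rs_v T) \o rsi_v = sub_hom (rs_v S);
  rsi_i : rs_i T \o rsi_u = rsi_v \o rs_i S;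
  rsi_p : rs_p T \o fwd rsi_v = emb_hom (fwd rsi_q) \o rs_p S }.

End Grassmannian.

Reserved Notation "x ** y" (at level 40, left associativity).
Reserved Notation "f *** g" (at level 40, left associativity).

Record monoidal := Monoidal {
  mcat :> category;
  tob : mcat -> mcat -> mcat where "x ** y" := (tob x y);
  thom : forall a b c d : mcat, hom a b -> hom c d -> hom (a ** c) (b ** d)
    where "f *** g" := (thom f g);
  thom_id : forall a b, 'id_ a *** 'id_ b = 'id_ (a ** b);
  thom_comp : forall (a b c a' b' c' : mcat) (g : hom b c) (f : hom a b)
      (g' : hom b' c') (f' : hom a' b'),
    (g \o f) *** (g' \o f') = (g *** g') \o (f *** f');
  assoc : forall x y z, iso (x ** (y ** z)) ((x ** y) ** z);
  assoc_nat : forall (x y z x' y' z' : mcat)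
      (f : hom x x') (g : hom y y') (h : hom z z'),
    assoc x' y' z' \o (f *** (g *** h)) = ((f *** g) *** h) \o assoc x y z;
  pentagon : forall x y z w,
    assoc (x ** y) z w \o assoc x y (z ** w) =
    (assoc x y z *** 'id_ w) \o assoc x (y ** z) w \o ('id_ x *** assoc y z w);
  unit1 : mcat;
  lunit : forall x, iso (unit1 ** x) x;
  lunit_nat : forall (x y : mcat) (f : hom x y),
    lunit y \o ('id_ unit1 *** f) = f \o lunit x;
  runit : forall x, iso (x ** unit1) x;
  runit_nat : forall (x y : mcat) (f : hom x y),
    runit y \o (f *** 'id_ unit1) = f \o runit x;
  triangle : forall x y,
    (runit x *** 'id_ y) \o assoc x unit1 y = 'id_ x *** lunit y }.

Arguments unit1 {_}.
Notation "x ** y" := (tob x y) : cat_scope.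
Notation "f *** g" := (thom f g) : cat_scope.

Lemma thom_compl (P : monoidal) (a b c d : P) (g : hom b c) (f : hom a b) :
  (g \o f) *** 'id_ d = (g *** 'id_ d) \o (f *** 'id_ d).
Proof. by rewrite -thom_comp comp1c. Qed.

Lemma thom_compr (P : monoidal) (a b c d : P) (g : hom b c) (f : hom a b) :
  'id_ d *** (g \o f) = ('id_ d *** g) \o ('id_ d *** f).
Proof. by rewrite -thom_comp comp1c. Qed.

Definition tensor_right (P : monoidal) (p : P) : functor P P :=
  @Functor P P (fun x => x ** p) (fun a b f => f *** 'id_ p)
    (fun a => thom_id a p) (fun a b c g f => thom_compl p g f).

Definition tensor_left (P : monoidal) (p : P) : functor P P :=
  @Functor P P (fun x => p ** x) (fun a b f => 'id_ p *** f)
    (fun a => thom_id p a) (fun a b c g f => thom_compr p g f).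

Record picard := Picard {
  pmon :> monoidal;
  pgroupoid : groupoid pmon;
  ptensor_right : forall p : pmon, is_equivalence (tensor_right p);
  ptensor_left : forall p : pmon, is_equivalence (tensor_left p) }.

Record sym_picard := SymPicard {
  spic :> picard;
  braid : forall x y : spic, hom (x ** y) (y ** x);
  braid_nat : forall (x y x' y' : spic) (f : hom x x') (g : hom y y'),
    braid x' y' \o (f *** g) = (g *** f) \o braid x y;
  braidK : forall x y, braid y x \o braid x y = 'id_ (x ** y);
  hexagon : forall x y z : spic,
    assoc z x y \o braid (x ** y) z \o assoc x y z =
    (braid x z *** 'id_ y) \o assoc x z y \o ('id_ x *** braid y z) }.

(* A category on which P acts: all the data and axioms of a torsor over P
   except those expressed by is_torsor. *)
Record pmodule (P : monoidal) := PModule {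
  pmcat :> category;
  act : P -> pmcat -> pmcat;
  acth : forall (x y : P) (a b : pmcat),
    hom x y -> hom a b -> hom (act x a) (act y b);
  acth_id : forall x a, acth ('id_ x) ('id_ a) = 'id_ (act x a);
  acth_comp : forall (x y z : P) (a b c : pmcat)
      (g : hom y z) (f : hom x y) (k : hom b c) (h : hom a b),
    acth (g \o f) (k \o h) = acth g k \o acth f h;
  act_assoc : forall x y a, iso (act x (act y a)) (act (x ** y) a);
  act_assoc_nat : forall (x y x' y' : P) (a a' : pmcat)
      (f : hom x x') (g : hom y y') (h : hom a a'),
    act_assoc x' y' a' \o acth f (acth g h) =
    acth (f *** g) h \o act_assoc x y a;
  act_pentagon : forall x y z a,
    act_assoc (x ** y) z a \o act_assoc x y (act z a) =
    acth (assoc x y z) ('id_ a) \o act_assoc x (y ** z) a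
      \o acth ('id_ x) (act_assoc y z a);
  act_unit : forall a, iso (act unit1 a) a;
  act_unit_nat : forall (a b : pmcat) (h : hom a b),
    act_unit b \o acth ('id_ unit1) h = h \o act_unit a;
  act_triangle : forall x a,
    acth (runit x) ('id_ a) \o act_assoc x unit1 a =
    acth ('id_ x) (act_unit a);
  act_triangle_l : forall x a,
    acth (lunit x) ('id_ a) \o act_assoc unit1 x a = fwd (act_unit (act x a)) }.

Lemma acth_id_comp (P : monoidal) (T : pmodule P) (a : T) (x y z : P)
    (g : hom y z) (f : hom x y) :
  acth (g \o f) ('id_ a) = acth g ('id_ a) \o acth f ('id_ a).
Proof. by rewrite -acth_comp comp1c. Qed.

Definition act_on (P : monoidal) (T : pmodule P) (a : T) : functor P T :=
  @Functor P T (fun x => act x a) (fun x y f => acth f ('id_ a))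
    (fun x => acth_id x a) (fun x y z g f => acth_id_comp a g f).

Definition is_torsor (P : monoidal) (T : pmodule P) : Prop :=
  groupoid T /\ forall a : T, is_equivalence (act_on a).

(* Every morphism of P is invertible, so that deth_iso and detl (and rdd, rdh
   below) are isomorphisms. *)
Record det_theory (A : exact_cat) (P : picard) := DetTheory {
  deth :> A -> P;
  deth_iso : forall a b : A, iso a b -> hom (deth a) (deth b);
  deth_id : forall a, deth_iso (iso_id a) = 'id_ (deth a);
  deth_comp : forall (a b c : A) (g : iso b c) (f : iso a b),
    deth_iso (iso_comp g f) = deth_iso g \o deth_iso f;
  deth0 : deth zero = unit1;
  detl : forall (a' a a'' : A) (i : hom a' a) (p : hom a a''),
    ses i p -> hom (deth a' ** deth a'') (deth a);
  detl_nat : forall (a' a a'' b' b b'' : A) (i : hom a' a) (p : hom a a'')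
      (j : hom b' b) (q : hom b b'') (s : ses i p) (t : ses j q)
      (f' : iso a' b') (f : iso a b) (f'' : iso a'' b''),
    iso_ses i p j q f' f f'' ->
    deth_iso f \o detl s = detl t \o (deth_iso f' *** deth_iso f'');
  (* a1 >-> a2 >-> a3 with quotients q12 >-> q13 ->> q23 *)
  detl_assoc : forall (a1 a2 a3 q12 q13 q23 : A)
      (i : hom a1 a2) (j : hom a2 a3)
      (p12 : hom a2 q12) (p23 : hom a3 q23) (p13 : hom a3 q13)
      (k : hom q12 q13) (l : hom q13 q23)
      (s12 : ses i p12) (s23 : ses j p23) (s13 : ses (j \o i) p13)
      (sq : ses k l),
    k \o p12 = p13 \o j -> l \o p13 = p23 ->
    detl s13 \o ('id_ (deth a1) *** detl sq) =
    detl s23 \o (detl s12 *** 'id_ (deth q23))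
      \o assoc (deth a1) (deth q12) (deth q23) }.

Section Relative.
Variables (A : exact_cat) (P : picard) (h : det_theory A P).
Variable X : beilinson A.

Record rel_det := RelDet {
  rdD :> gamma X -> P;
  rdd : forall (U V : gamma X) (S : rel_ses U V),
    hom (rdD U ** h (rs_q S)) (rdD V);
  rdd_nat : forall (U V : gamma X) (S T : rel_ses U V) (f : rel_ses_iso S T),
    rdd S = rdd T \o ('id_ (rdD U) *** deth_iso h (rsi_q f));
  (* u1 >-> u2 >-> u3 over X with quotients q12 >-> q13 ->> q23 *)
  rdd_assoc : forall (U1 U2 U3 : gamma X) (u1 u2 u3 : subobject X)
      (m1 : sval U1 u1) (m2 : sval U2 u2) (m3 : sval U3 u3)
      (i : hom (sub_ob u1) (sub_ob u2)) (j : hom (sub_ob u2) (sub_ob u3))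
      (oi : sub_hom u2 \o i = sub_hom u1) (oj : sub_hom u3 \o j = sub_hom u2)
      (oji : sub_hom u3 \o (j \o i) = sub_hom u1)
      (q12 q13 q23 : A)
      (p12 : @hom (inda (proa A)) (sval (sub_ob u2)) (emb q12))
      (p23 : @hom (inda (proa A)) (sval (sub_ob u3)) (emb q23))
      (p13 : @hom (inda (proa A)) (sval (sub_ob u3)) (emb q13))
      (k : hom q12 q13) (l : hom q13 q23)
      (s12 : @ses (inda (proa A)) (sval (sub_ob u1)) _ _ i p12)
      (s23 : @ses (inda (proa A)) (sval (sub_ob u2)) _ _ j p23)
      (s13 : @ses (inda (proa A)) (sval (sub_ob u1)) _ _ (j \o i) p13)
      (sq : ses k l),
    emb_hom k \o p12 = p13 \o (j : @hom (inda (proa A)) _ _) ->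
    emb_hom l \o p13 = p23 ->
    rdd (RelSes m1 m3 oji s13) \o ('id_ (rdD U1) *** detl h sq) =
    rdd (RelSes m2 m3 oj s23)
      \o (rdd (RelSes m1 m2 oi s12) *** 'id_ (h q23))
      \o assoc (rdD U1) (h q12) (h q23) }.

Record rel_det_hom (D D' : rel_det) := RelDetHom {
  rdh :> forall U : gamma X, hom (D U) (D' U);
  rdhP : forall (U V : gamma X) (S : rel_ses U V),
    rdh V \o rdd D S = rdd D' S \o (rdh U *** 'id_ (h (rs_q S))) }.

Lemma rel_det_homP (D D' : rel_det) (f g : rel_det_hom D D') :
  (forall U, f U = g U) -> f = g.
Proof.
move=> fg; have E : rdh f = rdh g by apply: functional_extensionality_dep.
case: f g E {fg} => f fP [g gP] /= E.
by case: _ / E gP => gP; congr RelDetHom; apply: Prop_irrelevance.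
Qed.

Lemma rel_det_id_subproof (D : rel_det) (U V : gamma X) (S : rel_ses U V) :
  'id_ (D V) \o rdd D S = rdd D S \o ('id_ (D U) *** 'id_ (h (rs_q S))).
Proof. by rewrite thom_id comp1c compc1. Qed.

Definition rel_det_id (D : rel_det) : rel_det_hom D D :=
  RelDetHom (@rel_det_id_subproof D).

Lemma rel_det_comp_subproof (D D' D'' : rel_det) (g : rel_det_hom D' D'')
    (f : rel_det_hom D D') (U V : gamma X) (S : rel_ses U V) :
  (g V \o f V) \o rdd D S =
  rdd D'' S \o ((g U \o f U) *** 'id_ (h (rs_q S))).
Proof. by rewrite thom_compl -compcA rdhP !compcA rdhP. Qed.

Definition rel_det_comp (D D' D'' : rel_det) (g : rel_det_hom D' D'')
    (f : rel_det_hom D D') : rel_det_hom D D'' :=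
  RelDetHom (rel_det_comp_subproof g f).

Lemma rel_det_comp1c (D D' : rel_det) (f : rel_det_hom D D') :
  rel_det_comp (rel_det_id D') f = f.
Proof. by apply: rel_det_homP => U; apply: comp1c. Qed.

Lemma rel_det_compc1 (D D' : rel_det) (f : rel_det_hom D D') :
  rel_det_comp f (rel_det_id D) = f.
Proof. by apply: rel_det_homP => U; apply: compc1. Qed.

Lemma rel_det_compA (D1 D2 D3 D4 : rel_det) (h' : rel_det_hom D3 D4)
    (g : rel_det_hom D2 D3) (f : rel_det_hom D1 D2) :
  rel_det_comp h' (rel_det_comp g f) = rel_det_comp (rel_det_comp h' g) f.
Proof. by apply: rel_det_homP => U; apply: compcA. Qed.

Definition rel_det_cat : category :=
  Category rel_det_comp1c rel_det_compc1 rel_det_compA.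

Lemma iso_monic (C : category) (a b c : C) (f : iso b c) (x y : hom a b) :
  fwd f \o x = fwd f \o y -> x = y.
Proof.
by move=> /(congr1 (compc (bwd f))); rewrite !compcA fwdK !comp1c.
Qed.

Lemma iso_epic (C : category) (a b c : C) (f : iso a b) (x y : hom b c) :
  x \o fwd f = y \o fwd f -> x = y.
Proof.
by move=> /(congr1 (fun z => z \o bwd f)); rewrite -!compcA bwdK !compc1.
Qed.

Lemma assoc_bwd_nat (x y z x' y' z' : P)
    (f : hom x x') (g : hom y y') (k : hom z z') :
  bwd (assoc x' y' z') \o ((f *** g) *** k) =
  (f *** (g *** k)) \o bwd (assoc x y z).
Proof.
apply: (iso_monic (f := assoc x' y' z')); rewrite !compcA bwdK comp1c.
by rewrite assoc_nat -compcA bwdK compc1.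
Qed.

Lemma lunit_tensor (x y : P) :
  (lunit x *** 'id_ y) \o assoc unit1 x y = fwd (lunit (x ** y)).
Proof.
apply: (iso_epic (f := lunit _)); rewrite -!lunit_nat; congr (_ \o _).
apply: (iso_monic (f := assoc _ _ _)).
rewrite thom_compr compcA assoc_nat -triangle thom_compl.
rewrite -(triangle unit1 (x ** y)) compcA -(thom_id x y) assoc_nat.
by rewrite -!compcA pentagon -!compcA.
Qed.

Section Act.
Variables (x : P) (D : rel_det).

Definition act_rdd (U V : gamma X) (S : rel_ses U V) :
    hom ((x ** D U) ** h (rs_q S)) (x ** D V) :=
  ('id_ x *** rdd D S) \o bwd (assoc x (D U) (h (rs_q S))).

Lemma act_rdd_nat (U V : gamma X) (S T : rel_ses U V) (f : rel_ses_iso S T) :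
  act_rdd S = act_rdd T \o ('id_ (x ** D U) *** deth_iso h (rsi_q f)).
Proof.
rewrite /act_rdd (rdd_nat D f) thom_compr -!compcA; congr (_ \o _).
by rewrite -thom_id assoc_bwd_nat.
Qed.

Lemma act_assoc_aux (d1 d2 d3 a12 a13 a23 : P) (e13 : hom (d1 ** a13) d3)
    (e23 : hom (d2 ** a23) d3) (e12 : hom (d1 ** a12) d2)
    (l : hom (a12 ** a23) a13) :
  e13 \o ('id_ d1 *** l) = e23 \o (e12 *** 'id_ a23) \o assoc d1 a12 a23 ->
  (('id_ x *** e13) \o bwd (assoc x d1 a13)) \o ('id_ (x ** d1) *** l) =
  (('id_ x *** e23) \o bwd (assoc x d2 a23))
    \o ((('id_ x *** e12) \o bwd (assoc x d1 a12)) *** 'id_ a23)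
    \o assoc (x ** d1) a12 a23.
Proof.
move=> E; rewrite -thom_id -!compcA assoc_bwd_nat compcA -thom_compr E.
rewrite !thom_compr thom_compl -!compcA; congr (_ \o _).
rewrite [RHS]compcA [in RHS]compcA assoc_bwd_nat -!compcA; congr (_ \o _).
apply: (iso_epic (f := assoc x d1 (a12 ** a23))).
rewrite -!compcA fwdK compc1 pentagon.
rewrite [X in _ = _ \o X]compcA [X in _ = _ \o (X \o _)]compcA.
by rewrite -thom_compl fwdK thom_id comp1c compcA fwdK comp1c.
Qed.

Definition rel_det_act : rel_det :=
  @RelDet (fun U => x ** D U) act_rdd act_rdd_nat
    (fun U1 U2 U3 u1 u2 u3 m1 m2 m3 i j oi oj oji q12 q13 q23 p12 p23 p13
       k l s12 s23 s13 sq e e' =>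
       act_assoc_aux (rdd_assoc D m1 m2 m3 oi oj oji s12 s23 s13 sq e e')).

End Act.

Lemma rel_det_acth_subproof (x y : P) (D D' : rel_det) (f : hom x y)
    (g : rel_det_hom D D') (U V : gamma X) (S : rel_ses U V) :
  (f *** g V) \o act_rdd x D S =
  act_rdd y D' S \o ((f *** g U) *** 'id_ (h (rs_q S))).
Proof.
rewrite /act_rdd compcA -thom_comp compc1 -compcA assoc_bwd_nat compcA.
by rewrite -thom_comp comp1c rdhP.
Qed.

Definition rel_det_acth (x y : P) (D D' : rel_det) (f : hom x y)
    (g : rel_det_hom D D') : rel_det_hom (rel_det_act x D) (rel_det_act y D') :=
  @RelDetHom (rel_det_act x D) (rel_det_act y D') (fun U => f *** g U)
    (rel_det_acth_subproof f g).

Lemma assoc_bwdE (x y d a : P) :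
  fwd (assoc x y d) *** 'id_ a =
  assoc (x ** y) d a \o assoc x y (d ** a)
    \o ('id_ x *** bwd (assoc y d a)) \o bwd (assoc x (y ** d) a).
Proof.
rewrite pentagon -!compcA [X in _ = _ \o (_ \o X)]compcA -thom_compr bwdK.
by rewrite thom_id comp1c bwdK compc1.
Qed.

Lemma rel_det_assoc_subproof (x y : P) (D : rel_det) (U V : gamma X)
    (S : rel_ses U V) :
  assoc x y (D V) \o act_rdd x (rel_det_act y D) S =
  act_rdd (x ** y) D S \o (assoc x y (D U) *** 'id_ (h (rs_q S))).
Proof.
rewrite /act_rdd /= assoc_bwdE thom_compr !compcA assoc_nat thom_id.
rewrite -!compcA; congr (_ \o _).
by rewrite [RHS]compcA fwdK comp1c.
Qed.

Lemma rel_det_assocV_subproof (x y : P) (D : rel_det) (U V : gamma X)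
    (S : rel_ses U V) :
  bwd (assoc x y (D V)) \o act_rdd (x ** y) D S =
  act_rdd x (rel_det_act y D) S
    \o (bwd (assoc x y (D U)) *** 'id_ (h (rs_q S))).
Proof.
apply: (iso_monic (f := assoc x y (D V))).
rewrite compcA bwdK comp1c compcA rel_det_assoc_subproof -compcA.
by rewrite -thom_compl bwdK thom_id compc1.
Qed.

Program Definition rel_det_assoc (x y : P) (D : rel_det) :
    @iso rel_det_cat (rel_det_act x (rel_det_act y D)) (rel_det_act (x ** y) D) :=
  @Iso rel_det_cat _ _
    (@RelDetHom (rel_det_act x (rel_det_act y D)) (rel_det_act (x ** y) D)
       (fun U => assoc x y (D U)) (rel_det_assoc_subproof x y D))
    (@RelDetHom (rel_det_act (x ** y) D) (rel_det_act x (rel_det_act y D))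
       (fun U => bwd (assoc x y (D U))) (rel_det_assocV_subproof x y D))
    _ _.
Next Obligation. by move=> x y D; apply: rel_det_homP => U; apply: fwdK. Qed.
Next Obligation. by move=> x y D; apply: rel_det_homP => U; apply: bwdK. Qed.

Lemma rel_det_unit_subproof (D : rel_det) (U V : gamma X) (S : rel_ses U V) :
  lunit (D V) \o act_rdd unit1 D S =
  rdd D S \o (lunit (D U) *** 'id_ (h (rs_q S))).
Proof.
rewrite /act_rdd compcA lunit_nat -compcA -lunit_tensor -compcA bwdK.
by rewrite compc1.
Qed.

Lemma rel_det_unitV_subproof (D : rel_det) (U V : gamma X) (S : rel_ses U V) :
  bwd (lunit (D V)) \o rdd D S =
  act_rdd unit1 D S \o (bwd (lunit (D U)) *** 'id_ (h (rs_q S))).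
Proof.
apply: (iso_monic (f := lunit (D V))).
rewrite compcA bwdK comp1c compcA rel_det_unit_subproof -compcA.
by rewrite -thom_compl bwdK thom_id compc1.
Qed.

Program Definition rel_det_unit (D : rel_det) :
    @iso rel_det_cat (rel_det_act unit1 D) D :=
  @Iso rel_det_cat _ _
    (@RelDetHom (rel_det_act unit1 D) D (fun U => lunit (D U))
       (rel_det_unit_subproof D))
    (@RelDetHom D (rel_det_act unit1 D) (fun U => bwd (lunit (D U)))
       (rel_det_unitV_subproof D))
    _ _.
Next Obligation. by move=> D; apply: rel_det_homP => U; apply: fwdK. Qed.
Next Obligation. by move=> D; apply: rel_det_homP => U; apply: bwdK. Qed.

(* D_h(X) with the action (x ** Delta)(U) = x ** Delta(U); the structural
   isomorphisms are given by those of P at each U. *)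
Program Definition rel_det_module : pmodule P :=
  @PModule P rel_det_cat rel_det_act rel_det_acth _ _ rel_det_assoc _ _
    rel_det_unit _ _ _.
Next Obligation. by move=> x D; apply: rel_det_homP => U; apply: thom_id. Qed.
Next Obligation. by move=> *; apply: rel_det_homP => U; apply: thom_comp. Qed.
Next Obligation. by move=> *; apply: rel_det_homP => U; apply: assoc_nat. Qed.
Next Obligation. by move=> *; apply: rel_det_homP => U; apply: pentagon. Qed.
Next Obligation. by move=> *; apply: rel_det_homP => U; apply: lunit_nat. Qed.
Next Obligation. by move=> *; apply: rel_det_homP => U; apply: triangle. Qed.
Next Obligation.
by move=> x D; apply: rel_det_homP => U; apply: lunit_tensor.
Qed.

End Relative.

(* Main.v *)
From HB Require Import structures.
From mathcomp Require Import all_boot all_order all_algebra.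
From mathcomp Require Import boolp.
From mathcomp Require Import zify.
Require Import Defs.

Set Implicit Arguments.
Unset Strict Implicit.
Unset Printing Implicit Defensive.

Import Order.TTheory GRing.Theory Num.Theory.

Local Open Scope cat_scope.

(** * A P-torsor of relative determinantal theories

    The set Gamma(X) of lattices in X is nonempty and directed, and a morphism
    of relative determinantal theories D -> D' is determined along an inclusion
    U >-> V by its value at U as well as by its value at V: the structure
    isomorphism D(U) (x) h(V/U) -> D(V) carries one to the other, as tensoring
    with h(V/U) is an equivalence.  So any morphism f0 : D(U0) -> D'(U0) forces
    a value at every lattice U, through a lattice W above both U0 and U.  The
    value does not depend on W and the values together form a morphism because,
    for U1 >-> U2 >-> U3, compatibility along U1 >-> U3 follows from that along
    the two steps; this is the associativity axiom of D and D'
    (compatible_trans).  Thus evaluation at U0 is a bijection from Hom(D, D')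
    to Hom(D(U0), D'(U0)) (rel_det_hom_extend, rel_det_hom_uniq).  That x |->
    x (x) D is an equivalence from P to D_h(X) is then the same assertion as
    that x |-> x (x) D(U0) is an equivalence from P to P.

    The geometric input is in two statements on Gamma(X).

    - The rows of a system representing X are lattices, and every lattice lies
      in a row, a pro-object over a formal colimit of rows being defined over
      one of them (row_quotient, sub_le_row).  This makes Gamma(X) nonempty and
      directed.

    - For lattices U1, U2, U3 each contained in the next, the quotients exist
      in A and form an admissible sequence U2/U1 >-> U3/U1 ->> U3/U2
      (nested_quotients).  Indeed U1 is the kernel of U3 -> X/U1, a morphism
      from a pro-object to an ind-object, so one that comes from a morphism
      L_n -> Z_k of A.  Admissible intersections give each morphism of A an
      admissible kernel (AIC_factor); the quotient c of L_n obtained in this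
      way maps monomorphically to X/U1, so that U1 is the kernel of U3 -> c,
      and the same argument applied to c -> X/U2 gives U3/U2 as a quotient
      of c.  Kernels of the maps L_m ->> c, computed levelwise, form a
      pro-object which has to be U1 (inda_filtration, in the opposite of A).

    Only properties of kernels and cokernels that can be checked on germs are
    transported to Ind^a(Pro^a(A)) (good_inda).  An object is recognized there
    by being a kernel, and an explicit levelwise sequence shows that the kernel
    is admissible (ses_ker). *)

(** * Null morphisms, kernels and cokernels *)

Section Kernels.
Variable C : category.

Definition monic (a b : C) (f : hom a b) : Prop :=
  forall (t : C) (x y : hom t a), f \o x = f \o y -> x = y.

(** Ind- and pro-categories come without an additive structure: zero objects
    are enough to speak of kernels there. *)
Definition null (a b : C) (f : hom a b) : Prop :=
  exists2 z : C, is_zero z & exists (u : hom a z) (v : hom z b), f = v \o u.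

Definition ker_of (a b c : C) (i : hom a b) (p : hom b c) : Prop :=
  [/\ null (p \o i), monic i &
      forall (t : C) (x : hom t b), null (p \o x) -> exists y, i \o y = x].

Lemma null_uniq (a b : C) (f g : hom a b) : null f -> null g -> f = g.
Proof.
move=> [z zP [u [v ->]]] [z' z'P [u' [v' ->]]].
have [_ [w _]] := zP z'.
have <- : w \o u = u' by have [[h [_ hU]] _] := z'P a; rewrite -(hU (_ \o _)) // (hU u').
have <- : v' \o w = v by have [_ [h [_ hU]]] := zP b; rewrite -(hU (_ \o _)) // (hU v).
by rewrite compcA.
Qed.

Lemma null_l (a b c : C) (g : hom b c) (f : hom a b) : null f -> null (g \o f).
Proof. by move=> [z zP [u [v ->]]]; exists z => //; exists u, (g \o v); rewrite compcA. Qed.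

Lemma null_r (a b c : C) (g : hom b c) (f : hom a b) : null g -> null (g \o f).
Proof. by move=> [z zP [u [v ->]]]; exists z => //; exists (u \o f), v; rewrite compcA. Qed.

Lemma null_ex (z a b : C) : is_zero z -> exists f : hom a b, null f.
Proof.
move=> zP; have [[u _] _] := zP a; have [_ [v _]] := zP b.
by exists (v \o u), z => //; exists u, v.
Qed.

Lemma monic_null (a b t : C) (f : hom a b) (x : hom t a) :
  monic f -> null (f \o x) -> null x.
Proof.
move=> fm fx; have [z zP _] := fx; have [n nP] := null_ex t a zP.
by rewrite (fm _ x n) // (null_uniq fx (null_l f nP)).
Qed.

Lemma monic_iso (a b : C) (f : iso a b) : monic (fwd f).
Proof. by move=> t x y; apply: iso_monic. Qed.

Lemma monic_comp (a b c : C) (g : hom b c) (f : hom a b) :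
  monic g -> monic f -> monic (g \o f).
Proof. by move=> gm fm t x y; rewrite -!compcA => /gm/fm. Qed.

Lemma monic_factor (a b c : C) (g : hom b c) (f : hom a b) :
  monic (g \o f) -> monic f.
Proof. by move=> gfm t x y e; apply: gfm; rewrite -!compcA e. Qed.

Definition iso_sym (a b : C) (f : iso a b) : iso b a := Iso (bwdK f) (fwdK f).

Lemma ker_uniq (a a' b c : C) (i : hom a b) (i' : hom a' b) (p : hom b c) :
  ker_of i p -> ker_of i' p -> exists f : iso a a', i' \o fwd f = i.
Proof.
move=> [pi im iU] [pi' im' iU'].
have [f fP] := iU' _ _ pi; have [g gP] := iU _ _ pi'.
have fK : g \o f = 'id_ a by apply: im; rewrite compcA gP compc1.
have gK : f \o g = 'id_ a' by apply: im'; rewrite compcA fP compc1.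
by exists (Iso fK gK).
Qed.

Lemma ker_monic (a b c d : C) (i : hom a b) (p : hom b c) (m : hom c d) :
  monic m -> ker_of i (m \o p) -> ker_of i p.
Proof.
move=> mm [mpi im iU]; split=> //.
  by apply: (monic_null mm); rewrite compcA.
by move=> t x px; apply: iU; rewrite -compcA; apply: null_l.
Qed.

(** For lattices U and V in X with U contained in V, and p : X ->> X/U, this
    makes U the kernel of V -> X/U. *)
Lemma ker_restrict (a b c d : C) (i : hom a b) (y : hom b c) (p : hom c d) :
  monic y -> ker_of (y \o i) p -> ker_of i (p \o y).
Proof.
move=> ym [pyi yim yiU]; split.
- by rewrite -compcA.
- exact: monic_factor yim.
- move=> t x; rewrite -compcA => /yiU [z zP]; exists z; apply: ym.
  by rewrite compcA.
Qed.

Lemma iso_ses_sym (a b c a' b' c' : C) (i : hom a b) (p : hom b c)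
    (i' : hom a' b') (p' : hom b' c')
    (f : iso a a') (g : iso b b') (h : iso c c') :
  iso_ses i p i' p' f g h ->
  iso_ses i' p' i p (iso_sym f) (iso_sym g) (iso_sym h).
Proof.
move=> [e e']; split=> /=.
  by apply: (iso_monic (f := g)); rewrite !compcA -e bwdK comp1c -compcA bwdK compc1.
by apply: (iso_monic (f := h)); rewrite !compcA -e' bwdK comp1c -compcA bwdK compc1.
Qed.

Lemma iso_ses_comp (a b c a' b' c' a'' b'' c'' : C) (i : hom a b)
    (p : hom b c) (i' : hom a' b') (p' : hom b' c') (i'' : hom a'' b'')
    (p'' : hom b'' c'')
    (f : iso a a') (g : iso b b') (h : iso c c')
    (f' : iso a' a'') (g' : iso b' b'') (h' : iso c' c'') :
  iso_ses i p i' p' f g h -> iso_ses i' p' i'' p'' f' g' h' ->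
  iso_ses i p i'' p'' (iso_comp f' f) (iso_comp g' g) (iso_comp h' h).
Proof.
move=> [e1 e2] [e3 e4]; split=> /=.
  by rewrite compcA e3 -compcA e1 compcA.
by rewrite compcA e4 -compcA e2 compcA.
Qed.

Lemma ker_iso (a b c a' b' c' : C) (i : hom a b) (p : hom b c)
    (i' : hom a' b') (p' : hom b' c')
    (f : iso a a') (g : iso b b') (h : iso c c') :
  iso_ses i p i' p' f g h -> ker_of i p -> ker_of i' p'.
Proof.
move=> /iso_ses_sym [/= e e'] [pi im iU].
have E : bwd h \o (p' \o i') = (p \o i) \o bwd f.
  by rewrite compcA -e' -!compcA e.
split.
- apply: (monic_null (monic_iso (f := iso_sym h))).
  by rewrite /= E; apply: null_r.
- apply: (monic_factor (g := bwd g)); rewrite -e.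
  by apply: monic_comp => //; apply: (monic_iso (f := iso_sym f)).
- move=> t x nx; have [|y yP] := iU t (bwd g \o x).
    by rewrite compcA e' -compcA; apply: null_l.
  exists (fwd f \o y); apply: (monic_iso (f := iso_sym g)) => /=.
  by rewrite -yP !compcA -e -!compcA; congr (_ \o _); rewrite compcA fwdK comp1c.
Qed.

End Kernels.

Lemma null_op (C : category) (a b : C) (f : hom a b) :
  @null (opc C) b a f <-> null f.
Proof.
split=> -[z zP [u [v e]]]; exists z; try by exists v, u.
  exact: (is_zero_op zP).
exact: (is_zero_op zP).
Qed.

Definition coker_of (C : category) (a b c : C) (i : hom a b) (p : hom b c) :
  Prop := @ker_of (opc C) c b a p i.

Lemma coker_ofP (C : category) (a b c : C) (i : hom a b) (p : hom b c) :
  coker_of i p <->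
  [/\ null (p \o i),
      forall (t : C) (x y : hom c t), x \o p = y \o p -> x = y &
      forall (t : C) (x : hom b t), null (x \o i) -> exists y, y \o p = x].
Proof.
split=> -[n m U]; split=> //; try exact/null_op.
  by move=> t x /null_op /U.
by move=> t x /null_op /U.
Qed.

(** The properties of a class of short sequences that pass to ind- and
    pro-objects by arguments on germs alone. *)
Record good_ses (E : ses_cat) : Prop := GoodSes {
  good_ker : forall (a b c : E) (i : hom a b) (p : hom b c),
    ses i p -> ker_of i p;
  good_coker : forall (a b c : E) (i : hom a b) (p : hom b c),
    ses i p -> coker_of i p;
  good_iso : forall (a b c a' b' c' : E) (i : hom a b) (p : hom b c)
      (i' : hom a' b') (p' : hom b' c')
      (f : iso a a') (g : iso b b') (h : iso c c'),
    iso_ses i p i' p' f g h -> ses i p -> ses i' p' }.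

Lemma ses_null (E : ses_cat) (gE : good_ses E) (a b c : E) (i : hom a b)
  (p : hom b c) : ses i p -> null (p \o i).
Proof. by move=> /(good_ker gE) []. Qed.

Lemma adm_mono_monic (E : ses_cat) (gE : good_ses E) (a b : E) (i : hom a b) :
  adm_mono i -> monic i.
Proof. by move=> [c [p /(good_ker gE) []]]. Qed.

(** To show that a kernel is admissible, it is enough to find some admissible
    sequence ending in the same p. *)
Lemma ses_ker (E : ses_cat) (gE : good_ses E) (a a' b c : E) (i : hom a b)
    (i' : hom a' b) (p : hom b c) : ses i p -> ker_of i' p -> ses i' p.
Proof.
move=> s k; have [f fP] := ker_uniq (good_ker gE s) k.
apply: (good_iso gE (f := f) (g := iso_id b) (h := iso_id c)) s.
by split; rewrite /= !(comp1c, compc1).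
Qed.

Lemma coker_ex (E : ses_cat) (gE : good_ses E) (a b c t : E) (i : hom a b)
    (p : hom b c) (y : hom b t) : ses i p -> null (y \o i) ->
  exists z : hom c t, z \o p = y.
Proof. by move=> /(good_coker gE)/coker_ofP [_ _ U] n; apply: U. Qed.

Lemma ses_epic (E : ses_cat) (gE : good_ses E) (a b c t : E) (i : hom a b)
    (p : hom b c) (x y : hom c t) : ses i p -> x \o p = y \o p -> x = y.
Proof. by move=> /(good_coker gE)/coker_ofP [_ U _]; apply: U. Qed.

Definition op_iso (C : category) (a b : C) (f : iso a b) : @iso (opc C) b a :=
  @Iso (opc C) b a (fwd f) (bwd f) (bwdK f) (fwdK f).

Definition iso_op (C : category) (a b : C) (f : @iso (opc C) a b) : iso b a :=
  @Iso C b a (fwd f) (bwd f) (bwdK f) (fwdK f).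

Lemma good_ops (E : ses_cat) : good_ses E -> good_ses (ops E).
Proof.
move=> gE; split=> [a b c i p s|a b c i p s|].
- exact: (good_coker gE (a := c) (b := b) (c := a) s).
- exact: (good_ker gE (a := c) (b := b) (c := a) s).
- move=> a b c a' b' c' i p i' p' f g h [e e'] s.
  have /iso_ses_sym S : @iso_ses E c' b' a' c b a p' i' p i (iso_op h) (iso_op g) (iso_op f).
    by split.
  exact: (good_iso gE (a := c) (b := b) (c := a) (a' := c') (b' := b') (c' := a') S).
Qed.

Lemma adm_epi_iso (E : ses_cat) (gE : good_ses E) (b b' c : E) (g : iso b b')
  (p : hom b' c) : adm_epi p -> adm_epi (p \o fwd g).
Proof.
move=> [k [i s]]; exists k, (bwd g \o i).
apply: (good_iso gE (f := iso_id k) (g := iso_sym g) (h := iso_id c)) s.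
by split=> /=; rewrite ?comp1c ?compc1 // -compcA bwdK compc1.
Qed.

Lemma adm_mono_iso (E : ses_cat) (gE : good_ses E) (a b b' : E) (g : iso b b')
  (i : hom a b) : adm_mono i -> adm_mono (fwd g \o i).
Proof.
move=> [k [p s]]; exists k, (p \o bwd g).
apply: (good_iso gE (f := iso_id a) (g := g) (h := iso_id k)) s.
by split=> /=; rewrite ?comp1c ?compc1 // -compcA fwdK compc1.
Qed.

Lemma pullback_uniq (C : category) (a1 a2 a p p' : C) (f : hom a1 a)
    (g : hom a2 a) (u : hom p a1) (v : hom p a2) (u' : hom p' a1)
    (v' : hom p' a2) :
  is_pullback f g u v -> is_pullback f g u' v' ->
  exists w : iso p p', u' \o fwd w = u /\ v' \o fwd w = v.
Proof.
move=> [e U] [e' U']; have [w [[w1 w2] _]] := U' _ _ _ e.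
have [w' [[w1' w2'] _]] := U _ _ _ e'.
have wK : w' \o w = 'id_ p.
  have [z [_ zU]] := U _ _ _ e; rewrite -(zU ('id_ p)); last by rewrite !compc1.
  by rewrite -(zU (w' \o w)) // !compcA w1' w2'.
have wK' : w \o w' = 'id_ p'.
  have [z [_ zU]] := U' _ _ _ e'; rewrite -(zU ('id_ p')); last by rewrite !compc1.
  by rewrite -(zU (w \o w')) // !compcA w1 w2.
by exists (Iso wK wK').
Qed.

Lemma pushout_uniq (C : category) (a1 a2 a p p' : C) (f : hom a a1)
    (g : hom a a2) (u : hom a1 p) (v : hom a2 p) (u' : hom a1 p')
    (v' : hom a2 p') :
  is_pushout f g u v -> is_pushout f g u' v' ->
  exists w : iso p p', fwd w \o u = u' /\ fwd w \o v = v'.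
Proof.
move=> po po'; have [w [w1 w2]] := @pullback_uniq (opc C) _ _ _ _ _ _ _ _ _ _ _ po' po.
by exists (iso_op w).
Qed.

(** * Exact categories with admissible intersections *)

Section ExactCat.
Variable A : exact_cat.
Implicit Types a b c d : A.

Lemma null_zero a b (f : hom a b) : null f <-> f = zero_hom a b.
Proof.
have [n nP] := null_ex a b (@zeroP A).
have N : null (zero_hom a b).
  exists (@zero A); first exact: (@zeroP A).
  by exists (zero_hom a (@zero A)), (zero_hom (@zero A) b); symmetry; apply: acomp0l.
by split=> [/null_uniq|->]; [apply|].
Qed.

Lemma good_exact : good_ses A.
Proof.
split.
- move=> a b c i p /(q_kernel (xquillen A)) [pi U].
  have im : monic i.
    move=> t x y e; have [|z [_ zU]] := U t (i \o x).
      by rewrite compcA pi; apply: acomp0l.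
    by rewrite -(zU x) // -(zU y).
  split=> //; first exact/null_zero.
  by move=> t x /null_zero/U [y [yP _]]; exists y.
- move=> a b c i p /(q_cokernel (xquillen A)) [pi U].
  apply/coker_ofP; split; first exact/null_zero.
  + move=> t x y e; have [|z [_ zU]] := U t (x \o p).
      by rewrite -compcA pi; apply: acomp0r.
    by rewrite -(zU x) // -(zU y).
  + by move=> t x /null_zero/U [y [yP _]]; exists y.
- exact: (q_iso (xquillen A)).
Qed.

Lemma adm_epi_comp a b c (p : hom a b) (q : hom b c) :
  adm_epi p -> adm_epi q -> adm_epi (q \o p).
Proof. exact: (q_epi_comp (xquillen A)). Qed.

(** The square formed by e' and e is a pullback of the admissible epimorphism e. *)
Lemma adm_epi_ker a a' b b' c (e : hom a b) (p : hom b c) (k : hom b' b)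
    (k' : hom a' a) (e' : hom a' b') :
  adm_epi e -> ker_of k p -> ker_of k' (p \o e) -> k \o e' = e \o k' ->
  adm_epi e'.
Proof.
move=> eE [pk km kU] [pk' km' kU'] E.
have [d [u [v [pb vE]]]] := q_pullback (xquillen A) k eE.
have pb' : is_pullback e k k' e'.
  split=> // t x y exy; have [|w wP] := kU' t x.
    by rewrite -compcA exy compcA; apply: null_r.
  exists w; split; last by move=> w' [w1 _]; apply: km'; rewrite wP w1.
  by split=> //; apply: km; rewrite compcA E -compcA wP.
have [w [_ <-]] := pullback_uniq pb' pb.
exact: (adm_epi_iso good_exact).
Qed.

(** Dually, c is the quotient of b by x and c' that of b': the square formed
    by i and i' is a pushout of the admissible monomorphism i. *)
Lemma adm_mono_coker x b b' c c' (i : hom b b') (f : hom x b) (p : hom b c)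
    (p' : hom b' c') (i' : hom c c') :
  adm_mono i -> coker_of f p -> coker_of (i \o f) p' -> i' \o p = p' \o i ->
  adm_mono i'.
Proof.
move=> iM /coker_ofP [pf pm pU] /coker_ofP [pf' pm' pU'] E.
have [d [u [v [po vM]]]] := q_pushout (xquillen A) p iM.
have po' : is_pushout i p p' i'.
  split=> // t y z eyz.
  have n : null (y \o (i \o f)).
    by rewrite compcA eyz -compcA; apply: null_l.
  have [w wP] := pU' t y n.
  exists w; split; last by move=> w' [w1 _]; apply: pm'; rewrite w1.
  by split=> //; apply: pm; rewrite -compcA E compcA wP.
have [w [_ <-]] := pushout_uniq po po'.
exact: (adm_mono_iso good_exact).
Qed.

(** The kernel of f : a -> b is the intersection in the direct sum of a and b
    of the graph of f with a, so admissible intersections give every morphism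
    an admissible kernel.  The map induced on the quotient has no kernel, hence
    is monic, but it need not be admissible. *)
Lemma AIC_factor (hA : AIC A) a b (f : hom a b) :
  exists (k c : A) (i : hom k a) (p : hom a c) (m : hom c b),
    [/\ ses i p, m \o p = f & monic m].
Proof.
have [s [i1 [i2 [p1 [p2 [e1 e2 e3 e4 e5]]]]]] := abiprod (a : aobj (xadd A)) b.
(* The graph of f, the inclusion of a summand with complement i2. *)
pose g : ahom a s := (i1 + acomp i2 f)%R.
have compNr x y z (y1 : @ahom (xadd A) y z) (x1 : ahom x y) :
    acomp y1 (- x1)%R = (- acomp y1 x1)%R.
  by apply/eqP; rewrite -addr_eq0 -acompDr addNr acomp0r.
have compNl x y z (y1 : @ahom (xadd A) y z) (x1 : ahom x y) :
    acomp (- y1)%R x1 = (- acomp y1 x1)%R.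
  by apply/eqP; rewrite -addr_eq0 -acompDl addNr acomp0l.
have p1g : acomp p1 g = aid a by rewrite acompDr e1 acompA e3 acomp0l addr0.
have p2g : acomp p2 g = f by rewrite acompDr e4 acompA e2 acomp1c add0r.
have M1 : adm_mono (i1 : @hom A a s).
  exists (b : A), (p2 : @hom A s b); apply: (q_split (xquillen A)
    (i2 := i2 : @hom A b s) (p1 := p1 : @hom A s a)).
  by split.
have Mg : adm_mono (g : @hom A a s).
  exists (b : A), ((p2 - acomp f p1)%R : @hom A s b).
  apply: (q_split (xquillen A) (i2 := i2 : @hom A b s) (p1 := p1 : @hom A s a)).
  split=> //.
  - by rewrite [LHS]acompDl e2 compNl -acompA e3 acomp0r subr0.
  - by rewrite [LHS]acompDl p2g compNl -acompA p1g acompc1 subrr.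
  - rewrite -[RHS]e5 /= acompDl acompDr compNr acompA.
    by rewrite addrCA addrK addrC.
have [k [u [v [[e U] uM _]]]] := hA a a s _ _ M1 Mg.
have e' : acomp i1 u = acomp g v := e.
have uv : u = v.
  transitivity (acomp p1 (acomp i1 u)); first by rewrite acompA e1 acomp1c.
  by rewrite e' acompA p1g acomp1c.
have fu : acomp f u = 0%R.
  by rewrite -p2g {1}uv -acompA -e' acompA e4 acomp0l.
have kf : ker_of u f.
  split; [exact/null_zero | exact: (adm_mono_monic good_exact) |].
  move=> t x /null_zero fx; have [|w [[wP _] _]] := U t x x; last by exists w.
  have fx' : acomp f x = 0%R := fx.
  change (acomp i1 x = acomp g x).
  by rewrite /g acompDl -acompA fx' acomp0r addr0.
have [c [p up]] := uM.
have [m mP] := coker_ex good_exact up (proj2 (null_zero _) fu).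
exists k, c, u, p, m; split=> // t x y exy.
pose z : ahom t c := (x - y : ahom t c)%R.
have mz : acomp m z = 0%R.
  have exy' : acomp m x = acomp m y := exy.
  by rewrite acompDr compNr exy' subrr.
suff : null (z : @hom A t c) by move=> /null_zero /eqP; rewrite subr_eq0 => /eqP.
(* Pulled back along the admissible epimorphism p, z lifts to a morphism w
   to a, which is killed by f and so comes from k. *)
have pE : adm_epi p by exists k, u.
have [d [w [v' [[pw _] [k' [i' v's]]]]]] := q_pullback (xquillen A) (z : @hom A t c) pE.
have [_ _ kU] := kf.
have [|w' w'P] := kU d w.
  apply/null_zero; rewrite -mP -compcA pw compcA.
  by change (acomp (acomp m z) v' = 0%R); rewrite mz acomp0l.
apply/null_zero; apply: (ses_epic good_exact v's).
rewrite -pw -w'P compcA [RHS](acomp0l _ v'); apply/null_zero/null_r.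
exact: (ses_null good_exact up).
Qed.

End ExactCat.

(** * Morphisms of ind-objects *)

Section IndMorphisms.
Variable C : category.
Implicit Types X Y Z : ind_ob C.

(** A morphism may be prescribed by a relation on germs: the choice of a value
    at each index is made here once. *)
Lemma ind_hom_ex X Y (R : forall i, germ Y (X i) -> Prop) :
  (forall i, exists s, R i s) ->
  (forall (i j : idx X) (u : fhom i j) s t, R j s -> R i t ->
     germ_eq (germ_pre s (dmap X u)) t) ->
  exists f : ind_hom X Y, forall i s, R i s -> germs f s.
Proof.
move=> exR RR; pose s i := sval (cid (exR i)).
have sR i : R i (s i) := svalP (cid (exR i)).
exists (ind_of (fun i j u => RR i j u _ _ (sR j) (sR i))) => i t Rt /=.
by have := RR i i (fid i) _ _ (sR i) Rt; rewrite dmap1 germ_pre1.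
Qed.

Lemma ind_level_mem (J : filtered) (X Y : diagram J C) (a : dtrans X Y) i :
  germs (ind_level a) (i := i) (@Germ C (IndOb Y) _ i (a i)).
Proof. exact: germ_eq_refl. Qed.

Lemma germs_comp (X Y Z : ind C) (g : hom Y Z) (f : hom X Y) i j k
    (s : hom (X i) (Y j)) (r : hom (Y j) (Z k)) :
  germs f (Germ s) -> germs g (Germ r) -> germs (g \o f) (Germ (r \o s)).
Proof. exact: ind_comp_mem. Qed.

Lemma germs_fwd X Y (f : ind_hom X Y) i j k (t : hom (X i) (Y j))
  (u : fhom j k) : germs f (Germ t) -> germs f (Germ (dmap Y u \o t)).
Proof.
move=> ft; apply/(germs_eq _ ft); exists k, u, (fid k).
by rewrite /= dmap1 comp1c.
Qed.

Lemma germs_same X Y (f : ind_hom X Y) i j j' (t : hom (X i) (Y j))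
    (t' : hom (X i) (Y j')) : germs f (Germ t) -> germs f (Germ t') ->
  exists k (u : fhom j k) (v : fhom j' k), dmap Y u \o t = dmap Y v \o t'.
Proof. by move=> ft /(germs_eq _ ft). Qed.

Section Point.
Variables (c : C) (Y : ind_ob C) (n : idx Y) (f : hom c (Y n)).

Lemma ind_pt_subproof (i j : pt_index) (u : fhom i j) :
  germ_eq (germ_pre (Germ f) (dmap (IndOb (dconst pt_index c)) u)) (Germ f).
Proof. by exists n, (fid _), (fid _); rewrite /= compc1. Qed.

Definition ind_pt : ind_hom (IndOb (dconst pt_index c)) Y :=
  @ind_of C (IndOb (dconst pt_index c)) Y (fun _ => Germ f) ind_pt_subproof.

End Point.

Lemma ind_pt_mem c Y n (f : hom c (Y n)) : germs (ind_pt f) (i := tt) (Germ f).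
Proof. exact: germ_eq_refl. Qed.

Lemma ind_pt_ex c Y (g : ind_hom (IndOb (dconst pt_index c)) Y) :
  exists (n : idx Y) (f : hom c (Y n)), g = ind_pt f.
Proof.
have [[n f] gf] := germs_ex g tt; exists n, f; apply: ind_homP => -[].
by exists (Germ f) => //; apply: ind_pt_mem.
Qed.

Lemma ind_pt_eq c Y n n' (f : hom c (Y n)) (f' : hom c (Y n')) :
  ind_pt f = ind_pt f' <->
  exists k (u : fhom n k) (v : fhom n' k), dmap Y u \o f = dmap Y v \o f'.
Proof.
split=> [e|fE].
  by apply: (germs_same (ind_pt_mem f)); rewrite e; apply: ind_pt_mem.
apply: ind_homP => -[]; exists (Germ f); first exact: ind_pt_mem.
by apply/(germs_eq _ (ind_pt_mem f')); apply: germ_eq_sym.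
Qed.

Lemma ind_pt_comp c Y Z n k (f : hom c (Y n)) (g : ind_hom Y Z)
    (t : hom (Y n) (Z k)) :
  germs g (Germ t) -> ind_comp g (ind_pt f) = ind_pt (t \o f).
Proof.
move=> gt; apply: ind_homP => -[]; exists (Germ (t \o f)); last exact: ind_pt_mem.
exact: (germs_comp (ind_pt_mem f) gt).
Qed.

Lemma ind_pt_monic c Y n (f : hom c (Y n)) :
  (forall (i j : idx Y) (u : fhom i j), monic (dmap Y u)) -> monic f ->
  @monic (ind C) _ _ (ind_pt f).
Proof.
move=> Ym fm T x y e; apply: ind_homP => i.
have [[[] s] xs] := germs_ex x i; have [[[] t] yt] := germs_ex y i.
suff e' : s = t by rewrite e' in xs; exists (existT _ tt t).
have es := germs_comp xs (ind_pt_mem f).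
have et := germs_comp yt (ind_pt_mem f).
rewrite -e in et.
have [k [u [v /= E]]] := germs_same es et.
have [m [w W]] := fcoeq u v.
apply/fm/(Ym _ _ (fcomp w u)).
by rewrite {2}W !dmapM -!compcA -E.
Qed.

End IndMorphisms.

Arguments ind_pt {C c} Y n f.

Lemma icst_homE (E : ses_cat) (a b : E) (f : hom a b) :
  icst_hom f = ind_pt (sval (icst b)) tt f.
Proof.
apply: ind_homP => -[]; exists (@Germ _ (sval (icst b)) _ tt f).
  exact: ind_level_mem.
exact: ind_pt_mem.
Qed.

Lemma icst_hom_full (E : ses_cat) (a b : E) (g : hom (icst a) (icst b)) :
  exists f : hom a b, g = icst_hom f.
Proof. by have [[] [f ->]] := ind_pt_ex g; exists f; rewrite icst_homE. Qed.

Lemma icst_hom_inj (E : ses_cat) (a b : E) (f g : hom a b) :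
  icst_hom f = icst_hom g -> f = g.
Proof.
by rewrite !icst_homE => /ind_pt_eq [k [u [v /=]]]; rewrite !comp1c.
Qed.

Lemma icst_hom_monic (E : ses_cat) (a b : E) (f : hom a b) :
  monic f -> monic (icst_hom f).
Proof.
move=> fm T x y; rewrite icst_homE.
apply: (@ind_pt_monic E a (sval (icst b)) tt f _ fm (sval T)).
by move=> i j u t z w /=; rewrite !comp1c.
Qed.

Lemma icst_hom_epic (E : ses_cat) (a b : E) (f : hom a b) :
  (forall (t : E) (x y : hom b t), x \o f = y \o f -> x = y) ->
  forall (T : inda E) (x y : hom (icst b) T),
    x \o icst_hom f = y \o icst_hom f -> x = y.
Proof.
move=> fe T x y.
rewrite icst_homE; have [n [s ->]] := ind_pt_ex x; have [k [t ->]] := ind_pt_ex y.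
rewrite /compc /= !(ind_pt_comp _ (ind_pt_mem _)).
move=> /ind_pt_eq [m [u [v E']]]; apply/ind_pt_eq; exists m, u, v.
by apply: fe; rewrite /= -!compcA.
Qed.

Lemma pcst_hom_full (E : ses_cat) (a b : E) (g : hom (pcst a) (pcst b)) :
  exists f : hom a b, g = pcst_hom f.
Proof. exact: (@icst_hom_full (ops E)). Qed.

Lemma pcst_hom_inj (E : ses_cat) (a b : E) (f g : hom a b) :
  pcst_hom f = pcst_hom g -> f = g.
Proof. exact: (@icst_hom_inj (ops E)). Qed.

Lemma pcst_hom_monic (E : ses_cat) (a b : E) (f : hom a b) :
  monic f -> monic (pcst_hom f).
Proof. exact: (@icst_hom_epic (ops E)). Qed.

Lemma emb_hom_monic (E : ses_cat) (a b : E) (f : hom a b) :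
  monic f -> monic (emb_hom f).
Proof. by move=> fm; apply/icst_hom_monic/pcst_hom_monic. Qed.

Lemma emb_hom_full (E : ses_cat) (a b : E) (g : hom (emb a) (emb b)) :
  exists f : hom a b, g = emb_hom f.
Proof.
have [f ->] := icst_hom_full g; have [f' ->] := pcst_hom_full f.
by exists f'.
Qed.

Lemma emb_hom_inj (E : ses_cat) (a b : E) (f g : hom a b) :
  emb_hom f = emb_hom g -> f = g.
Proof. by move=> /icst_hom_inj /pcst_hom_inj. Qed.

Lemma emb_hom_comp (E : ses_cat) (a b c : E) (g : hom b c) (f : hom a b) :
  emb_hom (g \o f) = emb_hom g \o emb_hom f.
Proof. by rewrite /emb_hom pcst_hom_comp icst_hom_comp. Qed.

Lemma emb_hom_id (E : ses_cat) (a : E) : emb_hom ('id_ a) = 'id_ (emb a).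
Proof. by rewrite /emb_hom pcst_hom_id icst_hom_id. Qed.

(** * Kernels and cokernels of ind-objects *)

Lemma iso_mid (C : category) (a b c d : C) (w : iso b c) (v : hom b d)
  (u : hom a b) : (v \o bwd w) \o (fwd w \o u) = v \o u.
Proof. by rewrite compcA -(compcA v) fwdK compc1. Qed.

Lemma null_full (C : category) (P : C -> Prop) (z : C) (zP : is_zero z) :
  P z -> forall (a b : full P) (f : hom a b),
  null f <-> @null C (sval a) (sval b) f.
Proof.
move=> Pz a b f; pose zz : full P := exist _ z Pz.
have zzP : is_zero zz by move=> x; apply: zP.
split=> -[z' z'P [u [v ->]]].
  have [w _] := zero_iso z'P zzP.
  exists z => //; exists (fwd w \o u), (v \o bwd w).
  by symmetry; apply: (iso_mid w).
have [w _] := zero_iso z'P zP.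
exists zz => //; exists (fwd w \o u), (v \o bwd w).
by symmetry; apply: (iso_mid w).
Qed.

Section IndGood.
Variable E : ses_cat.
Implicit Types X Y Z : ind E.

Lemma ind_null_germs X Y (f : hom X Y) : null f ->
  forall i j (s : hom (X i) (Y j)), germs f (Germ s) ->
  exists k (u : fhom j k), null (dmap Y u \o s).
Proof.
move=> nf i j s fs; pose z : ind E := IndOb (dconst pt_index zero).
have zP : is_zero z := @ind_is_zero E pt_index.
have [[u _] [v _]] := (proj1 (zP X), proj2 (zP Y)).
have nvu : null (v \o u) by exists z => //; exists u, v.
rewrite (null_uniq nf nvu) in fs.
have [[[] u'] us] := germs_ex u i; have [[k v'] vs] := germs_ex v tt.
have [m [a [b e]]] := germs_same (germs_comp us vs) fs.
exists m, b; rewrite -e; exists zero; first exact: zeroP.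
by exists u', (dmap Y a \o v'); rewrite compcA.
Qed.

Lemma ind_nullP X Y (f : hom X Y) :
  (forall i, exists j (s : hom (X i) (Y j)), germs f (Germ s) /\ null s) ->
  null f.
Proof.
move=> H; have [g gn] := null_ex X Y (@ind_is_zero E pt_index).
suff -> : f = g by [].
apply: ind_homP => i; have [j [s [fs sn]]] := H i; exists (Germ s) => //.
have [[l t] gt] := germs_ex g i; have [k [u ut]] := ind_null_germs gn gt.
apply/(germs_eq _ gt).
have [m [[a] [b]]] := fbound k j.
exists m, (fcomp a u), b; apply: null_uniq; last exact: null_l.
by rewrite /= dmapM -compcA; apply: null_l.
Qed.

Section Level.
Variables (J : filtered) (S' S S'' : diagram J E).
Variables (a : dtrans S' S) (b : dtrans S S'').
Hypotheses (gE : good_ses E) (ab : forall j, ses (a j) (b j)).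

Lemma level_null : @null (ind E) _ _ ((ind_level b : @hom (ind E) _ _) \o ind_level a).
Proof.
apply: ind_nullP => j; exists j, (b j \o a j); split.
  exact: (germs_comp (ind_level_mem a j) (ind_level_mem b j)).
exact: ses_null (ab j).
Qed.

(** A germ killed by b is killed by some b k already at a later level k, and
    factors there through the kernel a k. *)
Lemma ind_level_ker : @ker_of (ind E) _ _ _ (ind_level a) (ind_level b).
Proof.
have am j : monic (a j) by have [] := good_ker gE (ab j).
split; first exact: level_null.
- move=> T x y e; apply: ind_homP => i.
  have [[j s] xs] := germs_ex x i; have [[j' t] yt] := germs_ex y i.
  exists (existT _ j s) => //; apply/(germs_eq _ yt).
  have es := germs_comp xs (ind_level_mem a j).
  have et := germs_comp yt (ind_level_mem a j').
  rewrite -e in et.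
  have [k [u [v /= E']]] := germs_same es et.
  exists k, v, u; apply: (am k); rewrite /= !compcA.
  by rewrite !dtr_nat -!compcA.
- move=> T x nx.
  pose R i (s : germ (IndOb S') (T i)) :=
    germs x (@Germ _ (IndOb S) _ (tag s) (a (tag s) \o tagged s)).
  have exR i : exists s, R i s.
    have [[j s] xs] := germs_ex x i.
    have [k [/= u us]] := ind_null_germs nx (germs_comp xs (ind_level_mem b j)).
    have [_ _ U] := good_ker gE (ab k).
    have [|t tP] := U _ (dmap S u \o s); first by rewrite compcA dtr_nat -compcA.
    by exists (@Germ _ (IndOb S') _ k t); rewrite /R /= tP; apply: germs_fwd.
  have [|y yP] := ind_hom_ex exR.
    move=> i j u [k s] [m t] Rs Rt.
    have [l [v [w /= e]]] := germs_same (germs_compat u Rs) Rt.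
    exists l, v, w; apply: (am l); rewrite /= !compcA !dtr_nat -!compcA -e.
    by rewrite !compcA.
  exists y; apply: ind_homP => i; have [[k s] Rs] := exR i.
  exists (@Germ _ (IndOb S) _ k (a k \o s)) => //.
  exact: (germs_comp (yP _ _ Rs) (ind_level_mem a k)).
Qed.

Lemma ind_level_coker : @coker_of (ind E) _ _ _ (ind_level a) (ind_level b).
Proof.
have be j (t : E) (x y : hom (S'' j) t) : x \o b j = y \o b j -> x = y.
  exact: (ses_epic gE (ab j)).
apply/coker_ofP; split; first exact: level_null.
- move=> T x y e; apply: ind_homP => j.
  have [[i s] xs] := germs_ex x j; have [[i' t] yt] := germs_ex y j.
  exists (existT _ i s) => //; apply/(germs_eq _ yt).
  have es := germs_comp (ind_level_mem b j) xs.
  have et := germs_comp (ind_level_mem b j) yt.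
  rewrite -e in et.
  have [k [u [v /= E']]] := germs_same es et.
  by exists k, v, u; apply: (be j); rewrite -!compcA.
- move=> T x nx.
  pose R j (s : germ T (S'' j)) := germs x (germ_pre s (b j)).
  have exR j : exists s, R j s.
    have [[i s] xs] := germs_ex x j.
    have [k [/= u us]] := ind_null_germs nx (germs_comp (ind_level_mem a j) xs).
    have [|t tP] := coker_ex gE (y := dmap T u \o s) (ab j).
      by rewrite -compcA.
    exists (Germ t); rewrite /R /germ_pre /= tP.
    exact: germs_fwd.
  have [|y yP] := @ind_hom_ex E (IndOb S'') T R exR.
    move=> i j u [k s] [m t] Rs Rt.
    have Rs' : germs x (i := j) (Germ (s \o b j)) := Rs.
    have Rt' : germs x (i := i) (Germ (t \o b i)) := Rt.
    have [l [v [w /= e]]] := germs_same (@germs_compat E (IndOb S) T x i j u _ Rs') Rt'.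
    exists l, v, w; apply: (be i); rewrite /= -!compcA -dtr_nat.
    by rewrite -e -!compcA.
  exists y; apply: ind_homP => j; have [[k s] Rs] := exR j.
  exists (Germ (s \o b j)) => //.
  exact: (germs_comp (ind_level_mem b j) (yP _ _ Rs)).
Qed.

End Level.

Lemma ind_ses_iso (X' X X'' Y' Y Y'' : ind E) (f : hom X' X) (g : hom X X'')
    (f' : hom Y' Y) (g' : hom Y Y'')
    (x' : iso X' Y') (x : iso X Y) (x'' : iso X'' Y'') :
  iso_ses f g f' g' x' x x'' -> ind_ses f g -> ind_ses f' g'.
Proof.
move=> e [J [S' [S [S'' [a [b [H1 H2 H3 H4 [y' [y [y'' H5]]]]]]]]]].
exists J, S', S, S'', a, b; split=> //.
exists (iso_comp x' y'), (iso_comp x y), (iso_comp x'' y'').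
exact: iso_ses_comp H5 e.
Qed.

Definition iso_full (C : category) (P : C -> Prop) (a b : full P)
    (f : iso a b) : @iso C (sval a) (sval b) :=
  @Iso C (sval a) (sval b) (fwd f) (bwd f) (fwdK f) (bwdK f).

Definition full_iso (C : category) (P : C -> Prop) (a b : full P)
    (f : @iso C (sval a) (sval b)) : iso a b :=
  @Iso (full P) a b (fwd f) (bwd f) (fwdK f) (bwdK f).

Lemma good_inda : good_ses E -> good_ses (inda E).
Proof.
move=> gE; have zE := null_full (ind_is_zero pt_index) (inda_const zero countable_pt).
split.
- move=> X' X X'' i p [J [S' [S [S'' [a [b [_ _ _ ab [x' [x [x'' e]]]]]]]]]].
  have [n m U] := ker_iso e (ind_level_ker gE ab); split.
  + exact/zE.
  + by move=> T y z; apply: m.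
  + by move=> T y /zE/U.
- move=> X' X X'' i p [J [S' [S [S'' [a [b [_ _ _ ab [x' [x [x'' e]]]]]]]]]].
  have e' : @iso_ses (opc (ind E)) _ _ _ _ _ _ (ind_level b) (ind_level a)
      p i (op_iso (iso_sym x'')) (op_iso (iso_sym x)) (op_iso (iso_sym x')).
    by have [] := iso_ses_sym e; split.
  have /coker_ofP [n m U] := ker_iso e' (ind_level_coker gE ab).
  apply/coker_ofP; split.
  + exact/zE.
  + by move=> T y z; apply: m.
  + by move=> T y /zE/U.
- move=> a b c a' b' c' i p i' p' f g h e.
  exact: (@ind_ses_iso _ _ _ _ _ _ i p i' p' (iso_full f) (iso_full g) (iso_full h)).
Qed.

End IndGood.

Lemma good_proa (E : ses_cat) : good_ses E -> good_ses (proa E).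
Proof. by move=> gE; apply/good_ops/good_inda/good_ops. Qed.

(** * Cofinal systems *)

Record cofinal (I J : filtered) := Cofinal {
  cof_ob :> I -> J;
  cof_map : forall i j, fhom i j -> fhom (cof_ob i) (cof_ob j);
  cof_id : forall i, cof_map (fid i) = fid (cof_ob i);
  cof_comp : forall i j k (v : fhom j k) (u : fhom i j),
    cof_map (fcomp v u) = fcomp (cof_map v) (cof_map u);
  cof_ex : forall j, exists i, inhabited (fhom j (cof_ob i));
  cof_eq : forall j i (u v : fhom j (cof_ob i)),
    exists (k : I) (w : fhom i k), fcomp (cof_map w) u = fcomp (cof_map w) v }.

Section Restrict.
Variables (C : category) (I J : filtered) (phi : cofinal I J).
Variable Y : diagram J C.

Definition restrict : diagram I C :=
  @Diagram I C (fun i => Y (phi i)) (fun i j u => dmap Y (cof_map phi u))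
    (fun i => etrans (congr1 (@dmap _ _ Y _ _) (cof_id phi i)) (dmap1 Y _))
    (fun i j k v u => etrans (congr1 (@dmap _ _ Y _ _) (cof_comp phi v u))
                        (dmapM Y _ _)).

Lemma restrict_hom_subproof (i j : I) (u : fhom i j) :
  germ_eq (germ_pre (@Germ C (IndOb Y) _ (phi j) ('id_ (Y (phi j))))
             (dmap restrict u)) (@Germ C (IndOb Y) _ (phi i) ('id_ (Y (phi i)))).
Proof.
exists (phi j), (fid _), (cof_map phi u).
by rewrite /= dmap1 !comp1c compc1.
Qed.

Definition restrict_hom : @hom (ind C) (IndOb restrict) (IndOb Y) :=
  @ind_of C (IndOb restrict) (IndOb Y) _ restrict_hom_subproof.

Lemma restrict_iso :
  exists f : @iso (ind C) (IndOb restrict) (IndOb Y), fwd f = restrict_hom.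
Proof.
pose R j (s : germ (IndOb restrict) (Y j)) :=
  exists u : fhom j (phi (tag s)), tagged s = dmap Y u.
have exR j : exists s, R j s.
  have [i [u]] := cof_ex phi j; exists (@Germ _ (IndOb restrict) _ i (dmap Y u)).
  by exists u.
have [|g gP] := @ind_hom_ex C (IndOb Y) (IndOb restrict) R exR.
  move=> i j u [k s] [m t] [v /= ->] [w /= ->].
  have [l [[v'] [w']]] := fbound k m.
  have [r [x xE]] := cof_eq (fcomp (cof_map phi v') (fcomp v u))
    (fcomp (cof_map phi w') w).
  exists r, (fcomp x v'), (fcomp x w').
  by rewrite /= -!dmapM !cof_comp -!fcompA xE.
have mem i : germs restrict_hom (i := i) (@Germ _ (IndOb Y) _ (phi i) ('id_ _)).
  exact: germ_eq_refl.
unshelve eexists; first apply: (@Iso (ind C) _ _ restrict_hom g); last by [].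
- apply: ind_homP => i.
  have Ri : R (phi i) (@Germ _ (IndOb restrict) _ i ('id_ _)).
    by exists (fid _); rewrite dmap1.
  exists (@Germ _ (IndOb restrict) _ i ('id_ _ \o 'id_ _)).
    exact: (germs_comp (mem i) (gP _ _ Ri)).
  by rewrite comp1c; apply: germ_eq_refl.
- apply: ind_homP => j; have [[i s] Rs] := exR j.
  have [u /= sE] := Rs.
  exists (@Germ _ (IndOb Y) _ (phi i) ('id_ _ \o s)).
    exact: (germs_comp (gP _ _ Rs) (mem i)).
  by exists (phi i), u, (fid _); rewrite /= dmap1 !comp1c compc1 sE.
Qed.

End Restrict.

(** Isomorphisms t, in place of an equality between X and the restriction of Y
    to I, avoid the comparison of proofs of functoriality. *)
Lemma cofinal_iso (C : category) (I J : filtered) (phi : cofinal I J)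
    (X : diagram I C) (Y : diagram J C) (t : forall i, iso (X i) (Y (phi i))) :
  (forall i j (u : fhom i j),
     fwd (t j) \o dmap X u = dmap Y (cof_map phi u) \o fwd (t i)) ->
  exists f : @iso (ind C) (IndOb X) (IndOb Y),
    forall i, germs (fwd f) (i := i) (@Germ C (IndOb Y) _ (phi i) (fwd (t i))).
Proof.
move=> tN.
have tV i j (u : fhom i j) :
    bwd (t j) \o dmap (restrict phi Y) u = dmap X u \o bwd (t i).
  apply: (iso_monic (f := t j)); rewrite compcA bwdK comp1c compcA tN -compcA.
  by rewrite bwdK compc1.
pose a := @DTrans I C X (restrict phi Y) (fun i => fwd (t i)) tN.
pose b := @DTrans I C (restrict phi Y) X (fun i => bwd (t i)) tV.
have aK : (ind_level b : @hom (ind C) _ _) \o ind_level a = 'id_ _.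
  apply: ind_homP => i; exists (@Germ _ (IndOb X) _ i (bwd (t i) \o fwd (t i))).
    exact: (germs_comp (ind_level_mem a i) (ind_level_mem b i)).
  by rewrite fwdK; apply: germ_eq_refl.
have bK : (ind_level a : @hom (ind C) _ _) \o ind_level b = 'id_ _.
  apply: ind_homP => i.
  exists (@Germ _ (IndOb (restrict phi Y)) _ i (fwd (t i) \o bwd (t i))).
    exact: (germs_comp (ind_level_mem b i) (ind_level_mem a i)).
  by rewrite bwdK; apply: germ_eq_refl.
have [r rE] := restrict_iso phi Y.
exists (iso_comp r (Iso aK bK)) => i.
rewrite /= rE -[fwd (t i)]comp1c.
apply: (germs_comp (ind_level_mem a i)).
exact: (@germ_eq_refl C (IndOb Y)).
Qed.

Local Obligation Tactic := idtac.

Program Definition cof_pt (J : filtered) : cofinal J pt_index :=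
  @Cofinal J pt_index (fun _ => tt) (fun _ _ _ => tt) _ _ _ _.
Next Obligation. by []. Qed.
Next Obligation. by []. Qed.
Next Obligation. by move=> J; have [j] := fnonempty J; exists j; apply: (inhabits tt). Qed.
Next Obligation. by move=> J j i u v; exists i, (fid i); case: u v => -[]. Qed.

Lemma dconst_iso (C : category) (J : filtered) (a : C) :
  exists f : @iso (ind C) (IndOb (dconst J a)) (IndOb (dconst pt_index a)),
    forall j, germs (fwd f) (i := j)
      (@Germ C (IndOb (dconst pt_index a)) _ tt ('id_ a)).
Proof.
exact: (@cofinal_iso C J pt_index (cof_pt J) (dconst J a) (dconst pt_index a)
  (fun _ => iso_id a)).
Qed.

(** The coslice of J under n. It is cofinal in J, and whatever is defined at
    the level n is defined at all its levels. *)
Section Under.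
Variables (J : filtered) (n : J).

Program Definition under : filtered :=
  @Filtered {m : J & fhom n m}
    (fun i j => {u : fhom (tag i) (tag j) | fcomp u (tagged i) = tagged j})
    (fun i => exist _ (fid (tag i)) (fcomp1c _))
    (fun i j k v u => exist _ (fcomp (sval v) (sval u)) _) _ _ _ _ _ _.
Next Obligation. by move=> i j k [v /= <-] [u /= <-]; rewrite fcompA. Qed.
Next Obligation. by move=> i j [u e]; apply: eq_exist; apply: fcomp1c. Qed.
Next Obligation. by move=> i j [u e]; apply: eq_exist; apply: fcompc1. Qed.
Next Obligation. by move=> i j k l [w ?] [v ?] [u ?]; apply: eq_exist; apply: fcompA. Qed.
Next Obligation. by apply: inhabits; exists n; apply: fid. Qed.
Next Obligation.
move=> [i a] [j b]; have [k [[u] [v]]] := fbound i j.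
have [l [w e]] := fcoeq (fcomp u a) (fcomp v b).
exists (existT _ l (fcomp w (fcomp u a))); split; apply: inhabits.
  by exists (fcomp w u); rewrite /= fcompA.
by exists (fcomp w v); rewrite /= -fcompA -e.
Qed.
Next Obligation.
move=> [i a] [j b] [u /= ue] [v /= ve]; have [k [w e]] := fcoeq u v.
exists (existT _ k (fcomp w b)).
exists (exist (fun x : fhom j k => fcomp x b = fcomp w b) w erefl).
exact: eq_exist.
Qed.

Program Definition cof_under : cofinal under J :=
  @Cofinal under J (fun i => tag i) (fun i j u => sval u) _ _ _ _.
Next Obligation. by []. Qed.
Next Obligation. by []. Qed.
Next Obligation.
move=> j; have [k [[u] [v]]] := fbound n j.
by exists (existT _ k u); apply: inhabits.
Qed.
Next Obligation.
move=> j [i a] u v; have [k [w e]] := fcoeq u v.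
exists (existT _ k (fcomp w a)).
by exists (exist (fun x : fhom i k => fcomp x a = fcomp w a) w erefl).
Qed.

Lemma countable_under : countable_index J -> countable_index under.
Proof.
move=> [[f fI] cH]; split.
  pose g (i : under) := (f (tag i), sval (cid (cH n (tag i))) (tagged i)).
  exists (fun i => pickle (g i)) => -[i a] [j b] /(pcan_inj pickleK) [/fI ij].
  rewrite /g /=; case: _ / ij b => b.
  by case: (cid _) => h hI /= /hI ->.
move=> i j; have [h hI] := cH (tag i) (tag j).
by exists (fun u => h (sval u)) => -[u eu] [v ev] /= /hI; apply: eq_exist.
Qed.

End Under.

Lemma inda_restrict (E : ses_cat) (I J : filtered) (phi : cofinal I J)
    (Y : diagram J E) : countable_index I ->
  (forall i j (u : fhom i j), adm_mono (dmap Y u)) ->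
  inda_ob (IndOb (restrict phi Y) : ind E).
Proof. by move=> cI aY; split=> // i j u; apply: aY. Qed.

(** * Quotients of ind-objects by objects *)

(** By noether_quot, b/x >-> b'/x is admissible when b >-> b' is.  These
    properties hold in an exact category and in its opposite, so that what
    follows applies both to Ind^a(A) and, dually, to Pro^a(A). *)
Record noether_ses (E : ses_cat) : Prop := NoetherSes {
  noether_good : good_ses E;
  noether_comp : forall (a b c : E) (g : hom b c) (f : hom a b),
    adm_mono g -> adm_mono f -> adm_mono (g \o f);
  noether_quot : forall (x b b' c c' : E) (i : hom b b') (f : hom x b)
      (p : hom b c) (p' : hom b' c') (i' : hom c c'),
    adm_mono i -> coker_of f p -> coker_of (i \o f) p' ->
    i' \o p = p' \o i -> adm_mono i' }.

Lemma noether_exact (A : exact_cat) : noether_ses A.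
Proof.
split; first exact: good_exact.
  by move=> a b c g f gM fM; apply: (q_mono_comp (xquillen A)).
exact: (@adm_mono_coker A).
Qed.

Lemma noether_op_exact (A : exact_cat) : noether_ses (ops A).
Proof.
split; first exact/good_ops/good_exact.
  move=> a b c g f gM fM; exact: (q_epi_comp (xquillen A) gM fM).
move=> x b b' c c' i f p p' i' iM pk pk' e.
exact: (@adm_epi_ker A b' c' b c x i f p p' i' iM pk pk' e).
Qed.

Section Quotients.
Variables (E : ses_cat) (nE : noether_ses E).
Let gE := noether_good nE.

(** The structure maps of Z are admissible by noether_quot. *)
Lemma quot_diagram (J : filtered) (Y : diagram J E) (c : E)
    (f : forall j, hom c (Y j)) :
  inda_ob (IndOb Y : ind E) ->
  (forall i j (u : fhom i j), dmap Y u \o f i = f j) ->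
  (forall j, adm_mono (f j)) ->
  exists (Z : diagram J E) (p : dtrans Y Z),
    inda_ob (IndOb Z : ind E) /\ forall j, ses (f j) (p j).
Proof.
move=> [cJ aY] fN fM.
pose z j := sval (cid (fM j)).
pose p j : hom (Y j) (z j) := sval (cid (svalP (cid (fM j)))).
have fp j : ses (f j) (p j) := svalP (cid (svalP (cid (fM j)))).
have ex i j (u : fhom i j) : exists t : hom (z i) (z j), t \o p i = p j \o dmap Y u.
  apply: (coker_ex gE (fp i)); rewrite -compcA fN.
  exact: ses_null (fp j).
pose t i j (u : fhom i j) := sval (cid (ex i j u)).
have tP i j (u : fhom i j) : t i j u \o p i = p j \o dmap Y u := svalP (cid (ex i j u)).
have t1 i : t i i (fid i) = 'id_ (z i).
  by apply: (ses_epic gE (fp i)); rewrite tP dmap1 comp1c compc1.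
have tM i j k (v : fhom j k) (u : fhom i j) : t i k (fcomp v u) = t j k v \o t i j u.
  by apply: (ses_epic gE (fp i)); rewrite tP -compcA tP compcA tP -compcA dmapM.
exists (Diagram t1 tM), (@DTrans _ _ Y (Diagram t1 tM) p (fun i j u => esym (tP i j u))).
split=> //; split=> // i j u /=.
apply: (noether_quot nE (aY i j u) (good_coker gE (fp i)) _ (tP i j u)).
by rewrite fN; apply: good_coker.
Qed.

Definition cone (J : filtered) (Y : diagram J E) (c : E)
    (f : forall j, hom c (Y j))
    (fN : forall i j (u : fhom i j), dmap Y u \o f i = f j) :
  dtrans (dconst J c) Y :=
  @DTrans J E (dconst J c) Y f
    (fun i j u => etrans (compc1 (f j)) (esym (fN i j u))).

(** Given a filtration c'' >-> c of a subobject c of Y coming from the level n,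
    with quotient c', the filtration c' >-> Y / c'' ->> Y / c is computed
    levelwise over the indices under n.  In the opposite category, Y is a
    pro-object with a quotient c of Y_n, and Y1 and Y2 are the kernels of
    Y ->> c and of Y ->> c ->> c''. *)
Lemma inda_filtration (Y : inda E) (n : idx (sval Y)) (c c' c'' : E)
    (l : hom c'' c) (k : hom c c') (q : hom c (sval Y n)) :
  ses l k -> adm_mono q ->
  exists (Y1 Y2 : inda E) (j2 : hom Y Y2) (j1 : hom Y2 Y1)
      (r : hom (icst c') Y2),
    let f : hom (icst c) Y := ind_pt (sval Y) n q in
    [/\ @ses (inda E) _ _ _ (f \o icst_hom l) j2, @ses (inda E) _ _ _ r j1,
        @ses (inda E) _ _ _ f (j1 \o j2) & j2 \o f = r \o icst_hom k].
Proof.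
case: Y n q => -[I Y] [cY aY] /= n q lk qM.
pose J := under n; have cJ : countable_index J := countable_under n cY.
pose phi := cof_under n; pose W := restrict phi Y.
have WI : inda_ob (IndOb W : ind E) := inda_restrict phi cJ aY.
pose f (m : J) : hom c (W m) := dmap Y (tagged m) \o q.
have fN i j (u : fhom i j) : dmap W u \o f i = f j.
  by rewrite /f compcA -dmapM (svalP u).
have fM j : adm_mono (f j) by apply: (noether_comp nE) => //; apply: aY.
pose f2 m := f m \o l.
have f2N i j (u : fhom i j) : dmap W u \o f2 i = f2 j by rewrite /f2 compcA fN.
have f2M j : adm_mono (f2 j).
  by apply: (noether_comp nE) => //; exists c', k.
have [Z2 [p2 [Z2I s2]]] := quot_diagram WI f2N f2M.
have exr m : exists t : hom c' (Z2 m), t \o k = p2 m \o f m.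
  by apply: (coker_ex gE lk); rewrite -compcA; apply: ses_null (s2 m).
pose r m := sval (cid (exr m)).
have rP m : r m \o k = p2 m \o f m := svalP (cid (exr m)).
have rN i j (u : fhom i j) : dmap Z2 u \o r i = r j.
  by apply: (ses_epic gE lk); rewrite -compcA !rP compcA -dtr_nat -compcA fN.
have rM j : adm_mono (r j).
  exact: (noether_quot nE (fM j) (good_coker gE lk) (good_coker gE (s2 j)) (rP j)).
have [Z1 [p1 [Z1I s1]]] := quot_diagram Z2I rN rM.
(* Y_m / c is the quotient of Y_m / c'' by c'. *)
have s12 m : ses (f m) (p1 m \o p2 m).
  have [d [e fe]] := fM m.
  have [pn pe pU] := proj1 (coker_ofP _ _) (good_coker gE (s1 m)).
  have [pn2 pe2 pU2] := proj1 (coker_ofP _ _) (good_coker gE (s2 m)).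
  have ck : coker_of (f m) (p1 m \o p2 m).
    apply/coker_ofP; split.
    - by rewrite -compcA -rP compcA; apply: null_r.
    - by move=> t x y; rewrite !compcA => /pe2/pe.
    - move=> t x nx; have [|y yP] := pU2 t x; first by rewrite compcA; apply: null_r.
      have [|z zP] := pU t y; last by exists z; rewrite compcA zP.
      have ln : null ((y \o r m) \o k) by rewrite -compcA rP compcA yP.
      have [_ ke _] := proj1 (coker_ofP _ _) (good_coker gE lk).
      have zn := null_ex c' t (@zeroP E); have [z zn'] := zn.
      by rewrite (ke _ _ z (null_uniq ln (null_r k zn'))).
  have [w wP] := ker_uniq (C := opc E) (good_coker gE fe) ck.
  apply: (good_iso gE (f := iso_id c) (g := iso_id (W m)) (h := iso_sym (iso_op w))) fe.
  split; first by rewrite /= comp1c compc1.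
  apply: (iso_monic (f := iso_op w)).
  rewrite compc1 -[fwd (iso_sym _)]/(bwd (iso_op w)) [RHS]compcA.
  by rewrite (bwdK (iso_op w)) comp1c.
have [om omP] := cofinal_iso (phi := phi) (X := W) (Y := Y)
  (t := fun i => iso_id (Y (phi i))) (fun i j u => etrans (comp1c _) (esym (compc1 _))).
have [ka kaP] := dconst_iso J c; have [ka' ka'P] := dconst_iso J c'.
have [ka2 ka2P] := dconst_iso J c''.
(* What is compared below is levelwise over the indices under n. *)
pose F : @hom (ind E) (IndOb (dconst pt_index c)) (IndOb Y) := ind_pt (IndOb Y) n q.
have Fm := @ind_pt_mem E c (IndOb Y) n q.
have E1 : F \o fwd ka = fwd om \o ind_level (cone fN).
  apply: ind_homP => m; exists (@Germ _ (IndOb Y) _ n (q \o 'id_ c)).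
    exact: (germs_comp (kaP m) Fm).
  apply/(germs_eq _ (germs_comp (ind_level_mem (cone fN) m) (omP m))).
  exists (phi m), (fid _), (tagged m).
  by rewrite /= dmap1 !comp1c compc1.
have E2 : F \o icst_hom l \o fwd ka2 = fwd om \o ind_level (cone f2N).
  apply: ind_homP => m; exists (@Germ _ (IndOb Y) _ n ((q \o l) \o 'id_ c'')).
    apply: (germs_comp (ka2P m)).
    by rewrite icst_homE; apply: (germs_comp (@ind_pt_mem E c'' (sval (icst c)) tt l) Fm).
  apply/(germs_eq _ (germs_comp (ind_level_mem (cone f2N) m) (omP m))).
  exists (phi m), (fid _), (tagged m).
  by rewrite /= dmap1 !comp1c compc1 /f2 /f compcA.
pose r' : @hom (ind E) (IndOb (dconst pt_index c')) (IndOb Z2) :=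
  (ind_level (cone rN) : @hom (ind E) _ _) \o bwd ka'.
pose j2 : @hom (ind E) (IndOb Y) (IndOb Z2) := (ind_level p2 : @hom (ind E) _ _) \o bwd om.
pose j1 : @hom (ind E) (IndOb Z2) (IndOb Z1) := ind_level p1.
exists (exist _ _ Z1I), (exist _ _ Z2I), j2, j1, r'; split.
- exists J, (dconst J c''), W, Z2, (cone f2N), p2; split=> //; first exact: inda_const.
  exists ka2, om, (iso_id _); split; first by [].
  by rewrite /j2 -compcA fwdK compc1 [RHS]comp1c.
- exists J, (dconst J c'), Z2, Z1, (cone rN), p1; split=> //; first exact: inda_const.
  exists ka', (iso_id _), (iso_id _); split; last by rewrite [LHS]compc1 [RHS]comp1c.
  by rewrite /r' -compcA fwdK compc1 [RHS]comp1c.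
- have pN i j (u : fhom i j) : (p1 j \o p2 j) \o dmap W u = dmap Z1 u \o (p1 i \o p2 i).
    by rewrite -compcA dtr_nat !compcA dtr_nat.
  exists J, (dconst J c), W, Z1, (cone fN), (DTrans pN); split=> //.
    exact: inda_const.
  exists ka, om, (iso_id _); split; first by [].
  rewrite (@ind_level_comp _ _ _ _ _ p1 p2) // [RHS]comp1c.
  change ((j1 \o j2) \o fwd om = j1 \o ind_level p2).
  by rewrite -compcA /j2 -(compcA _ _ (fwd om)) fwdK compc1.
- pose K : @hom (ind E) (IndOb (dconst pt_index c)) (IndOb (dconst pt_index c')) :=
    icst_hom k.
  change (j2 \o F = r' \o K); apply: (iso_epic (f := ka)).
  have E3 : K \o fwd ka = fwd ka' \o ind_level (dconst_hom J k).
    apply: ind_homP => m.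
    exists (@Germ _ (IndOb (dconst pt_index c')) _ tt (k \o 'id_ c)).
      exact: (germs_comp (kaP m) (ind_level_mem (dconst_hom pt_index k) tt)).
    have H : germs (fwd ka' \o ind_level (dconst_hom J k)) (i := m)
        (@Germ _ (IndOb (dconst pt_index c')) _ tt ('id_ c' \o k)).
      exact: (germs_comp (ind_level_mem (dconst_hom J k) m) (ka'P m)).
    by rewrite comp1c in H; rewrite compc1.
  rewrite -compcA E1 /j2 -compcA [bwd om \o _]compcA fwdK comp1c.
  rewrite -compcA E3 /r' -compcA [bwd ka' \o _]compcA fwdK comp1c.
  have H i j (u : fhom i j) :
    (p2 j \o f j) \o dmap (dconst J c) u = dmap Z2 u \o (p2 i \o f i).
    by rewrite compc1 compcA -dtr_nat -compcA fN.
  rewrite -(@ind_level_comp _ _ _ _ _ p2 (cone fN) (DTrans H)) //.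
  by rewrite -(@ind_level_comp _ _ _ _ _ (cone rN) (dconst_hom J k) (DTrans H)).
Qed.

End Quotients.

(** * Quotients of nested lattices *)

Section Lattices.
Variables (A : exact_cat) (hA : AIC A).
Local Notation B := (inda (proa A)).

Let gB : good_ses B := good_inda (good_proa (good_exact A)).

Definition pro_pt (L : proa A) (n : idx (sval L)) (c : A)
    (q : @hom A (sval L n) c) : hom L (pcst c) :=
  @ind_pt (opc A) c (sval L) n q.
Arguments pro_pt L n {c} q.

Lemma pro_pt_ex (L : proa A) (c : A) (f : hom L (pcst c)) :
  exists n (q : @hom A (sval L n) c), f = pro_pt L n q.
Proof. exact: (@ind_pt_ex (opc A) c (sval L) f). Qed.

Lemma pro_pt_comp (L : proa A) n (c d : A) (q : @hom A (sval L n) c)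
  (m : hom c d) : pcst_hom m \o pro_pt L n q = pro_pt L n (m \o q).
Proof.
rewrite /pcst_hom (@icst_homE (ops A) d c m).
exact: (@ind_pt_comp (opc A) d (sval (pcst c)) (sval L) tt n m
  (pro_pt L n q) q (@ind_pt_mem (opc A) c (sval L) n q)).
Qed.

Lemma pro_pt_pcst (c d : A) (f : hom c d) : pro_pt (pcst c) tt f = pcst_hom f.
Proof. by rewrite /pcst_hom (@icst_homE (ops A) d c f). Qed.

Lemma proa_filtration (L : proa A) n (c c' c'' : A) (k : hom c' c)
    (l : hom c c'') (q : @hom A (sval L n) c) : ses k l -> adm_epi q ->
  exists (K1 K2 : proa A) (j2 : hom K2 L) (j1 : hom K1 K2)
      (r : hom K2 (pcst c')),
    [/\ ses j2 (pcst_hom l \o pro_pt L n q), ses j1 r,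
        ses (j2 \o j1) (pro_pt L n q) &
        pro_pt L n q \o j2 = pcst_hom k \o r].
Proof.
move=> kl qE; have [K1 [K2 [j2 [j1 [r [H1 H2 H3 H4]]]]]] :=
  @inda_filtration (ops A) (noether_op_exact A) L n c c' c'' l k q kl qE.
by exists K1, K2, j2, j1, r.
Qed.

(** With Q the formal colimit of a system Z, f comes from some L_n -> Z_k in A.
    By AIC_factor this has an image c, an admissible quotient of L_n; the map
    from c to Z_k, hence to Q, is monic but need not be admissible. *)
Lemma proa_inda_image (L : proa A) (Q : B) (f : hom (icst L) Q) :
  in_inda Q -> exists n (c : A) (q : @hom A (sval L n) c) (m : hom (emb c) Q),
    [/\ adm_epi q, monic m & f = m \o icst_hom (pro_pt L n q)].
Proof.
move=> [Z [psi]].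
have [k [a aE]] := @ind_pt_ex (proa A) L (sval (ipcst Z)) (fwd psi \o f).
have [n [phi phiE]] := @pro_pt_ex L (sval Z k) a.
have [k0 [c [i [q [m [iq mq mM]]]]]] := AIC_factor hA phi.
pose m' : hom (emb c) (ipcst Z) := @ind_pt (proa A) (pcst c) (sval (ipcst Z)) k (pcst_hom m).
have m'M : monic m'.
  move=> T x y; apply: (@ind_pt_monic (proa A) (pcst c) (sval (ipcst Z)) k (pcst_hom m) _ _ (sval T)).
    move=> i0 j0 u; apply: pcst_hom_monic.
    exact: (adm_mono_monic (good_exact A) (proj2 (svalP Z) i0 j0 u)).
  exact: pcst_hom_monic.
exists n, c, q, (bwd psi \o m'); split.
- by exists k0, i.
- by apply: monic_comp => //; apply: (monic_iso (f := iso_sym psi)).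
- apply: (iso_monic (f := psi)); rewrite !compcA bwdK comp1c.
  rewrite [LHS]aE phiE -mq -pro_pt_comp icst_homE.
  symmetry; apply: (@ind_pt_comp (proa A) L (sval (emb c)) (sval (ipcst Z))).
  exact: ind_pt_mem.
Qed.

Lemma icst_hom_compc (K L M : proa A) (g : hom L M) (f : hom K L) :
  (icst_hom (g \o f) : @hom B _ _) = @compc B _ _ _ (icst_hom g) (icst_hom f).
Proof. exact: icst_hom_comp. Qed.

(** U1 and U2 are the kernels of the maps from U3 to X / U1 and X / U2.  As
    U3 is a pro-object and these are ind-objects, they factor through objects
    c of A and c'' respectively; since X / U2 is a quotient of X / U1, the
    second may be chosen as a quotient of the first. *)
Lemma nested_quotients (U1 U2 U3 X Q1 Q2 : B) (i : hom U1 U2) (j : hom U2 U3)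
    (x : hom U3 X) (p1 : hom X Q1) (p2 : hom X Q2) :
  ses (x \o (j \o i)) p1 -> ses (x \o j) p2 -> monic x ->
  in_inda Q1 -> in_inda Q2 -> in_proa U3 ->
  exists (q12 q13 q23 : A) (p12 : hom U2 (emb q12)) (p23 : hom U3 (emb q23))
      (p13 : hom U3 (emb q13)) (k : hom q12 q13) (l : hom q13 q23),
    [/\ ses i p12, ses j p23, ses (j \o i) p13, ses k l &
        emb_hom k \o p12 = p13 \o j /\ emb_hom l \o p13 = p23].
Proof.
move=> s1 s2 xm Q1I Q2I [L [w]].
have [g gP] : exists g : hom Q1 Q2, g \o p1 = p2.
  apply: (coker_ex gB s1); rewrite compcA compcA -(compcA p2).
  by apply: null_r; apply: ses_null s2.
have jm : monic j by apply: (monic_factor (g := x)); have [] := good_ker gB s2.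
have [n [c [q [m1 [qE m1M f1]]]]] := proa_inda_image (p1 \o x \o bwd w) Q1I.
have [[] [c'' [l [m2 [[c' [k kl]] m2M]]]]] := @proa_inda_image (pcst c) _ (g \o m1) Q2I.
rewrite pro_pt_pcst => f2.
have [K1 [K2 [j2 [j1 [r [h2 h12 h1 e]]]]]] := proa_filtration kl qE.
pose p13 : hom U3 (emb c) := icst_hom (pro_pt L n q) \o fwd w.
pose p23 : hom U3 (emb c'') := emb_hom l \o p13.
have P1 : p1 \o x = m1 \o p13 by rewrite compcA -f1 -compcA fwdK compc1.
have P2 : p2 \o x = m2 \o p23.
  by rewrite -gP -compcA P1 compcA f2 -compcA.
have k13 : ker_of (j \o i) p13.
  apply: (ker_monic m1M); rewrite -P1; apply: (ker_restrict xm).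
  exact: good_ker s1.
have k23 : ker_of j p23.
  apply: (ker_monic m2M); rewrite -P2; apply: (ker_restrict xm).
  exact: good_ker s2.
have S13 : @ses B _ _ _ (bwd w \o icst_hom (j2 \o j1)) p13.
  apply: (good_iso gB (f := iso_id _) (g := iso_sym w) (h := iso_id _)) (icst_ses h1).
  by split; rewrite ?compc1 // /p13 -compcA bwdK compc1 comp1c.
have S23 : @ses B _ _ _ (bwd w \o icst_hom j2) p23.
  apply: (good_iso gB (f := iso_id _) (g := iso_sym w) (h := iso_id _)) (icst_ses h2).
  split; rewrite ?compc1 // /p23 /p13 -!compcA bwdK compc1 [RHS]comp1c.
  by rewrite icst_hom_compc.
have s13 := ses_ker gB S13 k13; have s23 := ses_ker gB S23 k23.
have [v vP] := ker_uniq k23 (good_ker gB S23).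
pose p12 : hom U2 (emb c') := icst_hom r \o fwd v.
have kM : monic k by have [] := good_ker (good_exact A) kl.
have ek : emb_hom k \o p12 = p13 \o j.
  have e' : @compc B _ _ _ (emb_hom k) (icst_hom r) =
      @compc B _ _ _ (icst_hom (pro_pt L n q)) (icst_hom j2).
    apply: etrans (esym (icst_hom_compc _ _)) (etrans _ (icst_hom_compc _ _)).
    by rewrite e.
  rewrite /p12 compcA e' /p13 -vP -!compcA; congr (_ \o _).
  by rewrite !compcA bwdK comp1c.
have S12 : @ses B _ _ _ (bwd v \o icst_hom j1) p12.
  apply: (good_iso gB (f := iso_id _) (g := iso_sym v) (h := iso_id _)) (icst_ses h12).
  by split; rewrite ?compc1 // /p12 -compcA bwdK compc1 comp1c.
have k12 : ker_of i p12.
  apply: (ker_monic (emb_hom_monic kM)); rewrite ek; exact: ker_restrict.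
by exists c', c, c'', p12, p23, p13, k, l; split=> //; apply: ses_ker S12 k12.
Qed.

End Lattices.

Arguments pro_pt {A} L n {c} q.

(** * The rows of a Beilinson system are lattices *)

(** The inverse of an isomorphism has no explicit germs; this recognizes one. *)
Lemma germs_bwd (C : category) (X Y : ind C) (f : iso X Y) j k l
    (s : hom (Y j) (X k)) (t : hom (X k) (Y l)) (u : fhom j l) :
  germs (fwd f) (Germ t) -> t \o s = dmap Y u -> germs (bwd f) (Germ s).
Proof.
move=> ft ts; have [[p r] br] := germs_ex (bwd f) l.
have br' : germs (bwd f) (Germ r) := br.
have := germs_comp ft br'; rewrite fwdK => idr.
have idk : germs ('id_ X) (i := k) (Germ ('id_ (X k))) by apply: germ_eq_refl.
have [q [a [b e]]] := germs_same idk idr.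
have H := germs_fwd b (germs_compat u br').
apply/(germs_eq _ H); exists q, (fid q), a.
by rewrite /= dmap1 comp1c -ts -[dmap X a]compc1 e -!compcA.
Qed.

(** The row m of a system is defined along the sequence of columns m - n.
    Indexing it by all the columns i <= m, in decreasing order, makes it
    comparable with the same row taken along other sequences. *)
Section Columns.
Variable m : int.

Program Definition columns : filtered :=
  @Filtered {i : int | (i <= m)%R} (fun i i' => (sval i' <= sval i)%R)
    (fun i => lexx (sval i)) (fun i j k v u => le_trans v u) _ _ _ _ _ _.
Next Obligation. by move=> *; apply: Prop_irrelevance. Qed.
Next Obligation. by move=> *; apply: Prop_irrelevance. Qed.
Next Obligation. by move=> *; apply: Prop_irrelevance. Qed.
Next Obligation. exact: (inhabits (exist (fun i : int => (i <= m)%R) m (lexx m))). Qed.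
Next Obligation.
move=> [i hi] [j hj].
have h : (Num.min i j <= m)%R by rewrite ge_min hi.
by exists (exist (fun i : int => (i <= m)%R) _ h); split; apply: inhabits; rewrite /= ge_min lexx ?orbT.
Qed.
Next Obligation. by move=> i j u v; exists j, (lexx _); apply: Prop_irrelevance. Qed.

Lemma columns_thin (i j : columns) (u v : fhom i j) : u = v.
Proof. exact: (@Prop_irrelevance (is_true (sval j <= sval i)%R)). Qed.

Section Sequence.
Variable f : nat -> int.
Hypotheses (fm : forall n, (f n <= m)%R)
  (f_mono : forall n p, (n <= p)%N -> (f p <= f n)%R)
  (f_unbounded : forall i : int, exists n, (f n <= i)%R).

Program Definition cof_columns : cofinal nat_index columns :=
  @Cofinal nat_index columns (fun n => exist _ (f n) (fm n))
    (fun n p h => f_mono h) _ _ _ _.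
Next Obligation. by move=> *; apply: columns_thin. Qed.
Next Obligation. by move=> *; apply: columns_thin. Qed.
Next Obligation.
by move=> [i hi]; have [n hn] := f_unbounded i; exists n; apply: inhabits.
Qed.
Next Obligation. by move=> i n u v; exists n, (leqnn n); apply: columns_thin. Qed.

End Sequence.
End Columns.

Section Rows.
Variables (A : exact_cat) (D : bsystem A).
Local Notation X := (bob D).

Lemma bdn_irr i i' j (h k : (i <= i')%R) (h' k' : (i' <= j)%R) :
  bdn D h h' = bdn D k k'.
Proof. by congr (bdn D _ _); apply: Prop_irrelevance. Qed.

Program Definition row_diag (m : int) : diagram (columns m) (opc A) :=
  @Diagram (columns m) (opc A) (fun i => X (sval i) m)
    (fun i i' h => bdn D h (proj2_sig i)) _ _.
Next Obligation. by move=> m i; apply: bdn1. Qed.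
Next Obligation.
move=> m i j k v u; symmetry.
exact: (bdnM D v (proj2_sig j) u (proj2_sig i) (le_trans v u)).
Qed.

Definition col (m i : int) (h : (i <= m)%R) : columns m := exist _ i h.

Lemma sub_unbounded (m i : int) : exists n : nat, (m - n%:Z <= i)%R.
Proof. exists `|m - i|%N; lia. Qed.

Lemma brow_columns (m : int) :
  exists w : @iso (ind (opc A)) (IndOb (brow_diag D m)) (IndOb (row_diag m)),
    forall n, germs (fwd w) (i := n)
      (@Germ (opc A) (IndOb (row_diag m)) _ (col (subz_le0 m n)) ('id_ (X (m - n%:Z)%R m))).
Proof.
apply: (@cofinal_iso (opc A) nat_index (columns m)
  (cof_columns (subz_le0 m) (@subz_le m) (sub_unbounded m))
  (brow_diag D m) (row_diag m) (fun n => iso_id _)).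
by move=> n p u; rewrite comp1c compc1; apply: bdn_irr.
Qed.

(** The row m along the columns of the row j: the inclusion of the row j in the
    row m becomes a levelwise map. *)
Program Definition row_from (j m : int) (h : (j <= m)%R) : diagram nat_index (opc A) :=
  @Diagram nat_index (opc A) (fun n : nat => X (j - n%:Z)%R m)
    (fun n p u => bdn D (subz_le j u) (le_trans (subz_le0 j n) h)) _ _.
Next Obligation. by move=> j m h n; apply: bdn1. Qed.
Next Obligation.
by move=> j m h n p r v u; symmetry; apply: bdnM.
Qed.

Lemma row_from_columns (j m : int) (h : (j <= m)%R) :
  exists w : @iso (ind (opc A)) (IndOb (row_from h)) (IndOb (row_diag m)),
    forall n, germs (fwd w) (i := n)
      (@Germ (opc A) (IndOb (row_diag m)) _
         (col (le_trans (subz_le0 j n) h)) ('id_ (X (j - n%:Z)%R m))).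
Proof.
apply: (@cofinal_iso (opc A) nat_index (columns m)
  (cof_columns (fun n => le_trans (subz_le0 j n) h) (@subz_le j) (sub_unbounded j))
  (row_from h) (row_diag m) (fun n => iso_id _)).
by move=> n p u; rewrite comp1c compc1; apply: bdn_irr.
Qed.

Section RowSes.
Variables (j m : int) (h : (j <= m)%R) (c : A) (p : hom (X j m) c).

(** In the row m, the column j - n is the one of number n + (m - j). *)
Lemma shift_le (n : nat) : (m - (n + `|m - j|)%N%:Z <= j - n%:Z)%R.
Proof. move: h; lia. Qed.

(** The projection of the row m on the quotient c of X_{j,m}: the column j is
    the one of number m - j in the row m. *)
Definition row_pt : hom (brow D m) (pcst c) :=
  pro_pt (brow D m) `|m - j|%N
    (p \o bdn D (le_trans (shift_le 0) (subz_le0 j 0)) h).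

(** Levelwise, these are the sequences X_{i,j} >-> X_{i,m} ->> c for i <= j:
    as the squares are cartesian, X_{i,j} is the kernel of
    X_{i,m} ->> X_{j,m} ->> c. *)
Lemma row_ses : ses (bup D (lexx j) h) p -> ses (brow_map D h) row_pt.
Proof.
move=> s; pose fm n := le_trans (subz_le0 j n) h.
have [w wP] := brow_columns m.
have [w' w'P] := row_from_columns h.
have [ka kaP] := dconst_iso nat_index (c : opc A).
pose a n : @hom A (X (j - n%:Z)%R m) c := p \o bdn D (subz_le0 j n) h.
have aN n q (u : @fhom nat_index n q) :
    a n \o bdn D (subz_le j u) (le_trans (subz_le0 j n) h) = a q.
  by rewrite /a -compcA (bdnM _ _ _ _ _ (subz_le0 j q)).
pose b n : @hom A (X (j - n%:Z)%R j) (X (j - n%:Z)%R m) := bup D (subz_le0 j n) h.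
have bN n q (u : @fhom nat_index n q) :
    b n \o bdn D (subz_le j u) (subz_le0 j n) =
    bdn D (subz_le j u) (le_trans (subz_le0 j n) h) \o b q.
  have [e _] := bcart D (subz_le j u) (subz_le0 j n) h (subz_le0 j q) (le_trans (subz_le0 j n) h).
  by rewrite /b e.
have ab n : ses (b n) (a n).
  have pE : adm_epi p by eexists; eexists; apply: s.
  have aE : adm_epi (a n) by apply: adm_epi_comp => //; apply: bdn_epi.
  have [k [y ya]] := aE; apply: (ses_ker (good_exact A) ya).
  have [pn pm pU] := good_ker (good_exact A) s.
  have [e U] := bcart D (subz_le0 j n) (lexx j) h (subz_le0 j n) h.
  split.
  - by rewrite /a -compcA -e compcA; apply: null_r.
  - by apply: (adm_mono_monic (good_exact A)); apply: bup_mono.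
  - move=> t x; rewrite /a -compcA => /pU [z zP].
    by have [v [[_ vP] _]] := U _ _ _ zP; exists v.
pose aT := @DTrans nat_index (opc A) (dconst nat_index (c : opc A)) (row_from h) a
  (fun n q u => etrans (comp1c (a q)) (esym (aN n q u))).
pose bT := @DTrans nat_index (opc A) (row_from h) (brow_diag D j) b
  (fun n q u => esym (bN n q u)).
exists nat_index, (dconst nat_index (c : opc A)), (row_from h), (brow_diag D j), aT, bT.
split=> //.
- exact: (@inda_const (ops A) nat_index c countable_nat).
- split=> [|n q u]; first exact: countable_nat.
  exact: (bdn_epi D (subz_le j u) (le_trans (subz_le0 j n) h)).
- exact: brow_inda.
exists ka, (iso_comp (iso_sym w) w'), (iso_id _); split.
- pose pt : @hom (ind (opc A)) (IndOb (dconst pt_index (c : opc A))) (IndOb (brow_diag D m)) :=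
    row_pt.
  change (pt \o fwd ka = (bwd w \o fwd w') \o ind_level aT).
  apply: (iso_monic (f := w)); rewrite !compcA bwdK comp1c.
  apply: ind_homP => n.
  have ptm := @ind_pt_mem (opc A) c (IndOb (brow_diag D m)) `|m - j|%N
    (p \o bdn D (le_trans (shift_le 0) (subz_le0 j 0)) h).
  have H1 := germs_comp (kaP n) (germs_comp ptm (wP _)).
  have H2 := germs_comp (ind_level_mem aT n) (w'P n).
  eexists; first exact: H1.
  apply/(germs_eq _ H2).
  have k1 : (m - (n + `|m - j|)%N%:Z <= m)%R by lia.
  have k2 : (m - (n + `|m - j|)%N%:Z <= m - `|m - j|%N%:Z)%R by lia.
  exists (col k1), (shift_le n), k2.
  change ((a n \o 'id_ _) \o bdn D (shift_le n) (fm n) =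
    ('id_ c \o ((p \o bdn D (le_trans (shift_le 0) (subz_le0 j 0)) h) \o 'id_ _))
      \o bdn D k2 (subz_le0 m `|m - j|%N)).
  have k3 : (m - (n + `|m - j|)%N%:Z <= j)%R by move: h; lia.
  by rewrite comp1c !compc1 /a -!compcA !(bdnM _ _ _ _ _ k3).
- pose bm : @hom (ind (opc A)) (IndOb (brow_diag D m)) (IndOb (brow_diag D j)) :=
    brow_map D h.
  change (bm \o (bwd w \o fwd w') = 'id_ _ \o ind_level bT).
  rewrite comp1c; apply: ind_homP => n; pose N := (n + `|m - j|)%N.
  have wb : germs (bwd w) (i := col (fm n)) (@Germ (opc A) (IndOb (brow_diag D m)) _ N
      (bdn D (shift_le n) (fm n))).
    have := @germs_bwd (opc A) _ _ w (col (fm n)) N (col (subz_le0 m N))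
      (bdn D (shift_le n) (fm n)) _ (shift_le n) (wP N).
    apply.
    change (bdn D (shift_le n) (fm n) \o 'id_ _ = bdn D (shift_le n) (fm n)).
    exact: compc1.
  have bmm := ind_level_mem
    (@DTrans nat_index (opc A) (brow_diag D m) (brow_diag D j) (brow_map_at D h)
       (fun m n u => esym (brow_map_subproof D h u))) N.
  have H1 := germs_comp (germs_comp (w'P n) wb) bmm.
  have H2 := ind_level_mem bT n.
  eexists; first exact: H1.
  apply/(germs_eq _ H2).
  have nN : (n <= N)%N by rewrite leq_addr.
  exists N, nN, (leqnn N).
  change (b n \o bdn D (subz_le j nN) (subz_le0 j n) =
    (('id_ _ \o bdn D (shift_le n) (fm n)) \o
      (bdn D (subz_le2 N h) (subz_le0 m N) \o bup D (subz_le0 j N) h))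
      \o bdn D (subz_le j (leqnn N)) (subz_le0 j N)).
  rewrite bdn1 compc1 comp1c compcA.
  rewrite (bdnM D _ _ _ _ (subz_le j nN)).
  have [e _] := bcart D (subz_le j nN) (subz_le0 j n) h (subz_le0 j N) (fm n).
  by rewrite /b -e.
Qed.

End RowSes.
End Rows.

Lemma pro_pt_pre (A : exact_cat) (L L' : proa A) n k (c : A)
    (q : @hom A (sval L n) c) (f : hom L' L) (t : @hom A (sval L' k) (sval L n)) :
  @germs (opc A) (sval L) (sval L') f n (@Germ (opc A) (sval L') _ k t) ->
  pro_pt L n q \o f = pro_pt L' k (q \o t).
Proof.
exact: (@ind_pt_comp (opc A) c (sval L) (sval L') n k q f t).
Qed.

Lemma row_pt_nat (A : exact_cat) (D : bsystem A) (j m m' : int)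
    (h : (j <= m)%R) (h' : (j <= m')%R) (k : (m <= m')%R) (c c' : A)
    (p : hom (bob D j m) c) (p' : hom (bob D j m') c') (z : hom c c') :
  z \o p = p' \o bup D h k ->
  row_pt h' p' \o brow_map D k = pcst_hom z \o row_pt h p.
Proof.
move=> e; rewrite [RHS]pro_pt_comp.
pose M := `|m' - j|%N; pose N := `|m - j|%N.
have bm := ind_level_mem
  (@DTrans nat_index (opc A) (brow_diag D m') (brow_diag D m) (brow_map_at D k)
    (fun m n u => esym (brow_map_subproof D k u))) M.
rewrite [LHS](@pro_pt_pre A (brow D m') (brow D m) M M _ _ (brow_map D k) _ bm).
apply/(@ind_pt_eq (opc A) c' (sval (brow D m))).
have NM : (N <= M)%N by rewrite /N /M; move: (h) (h') (k); lia.
exists M, (leqnn M), NM.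
change (((p' \o bdn D (le_trans (shift_le h' 0) (subz_le0 j 0)) h') \o
    (bdn D (subz_le2 M k) (subz_le0 m' M) \o bup D (subz_le0 m M) k))
    \o bdn D (subz_le m (leqnn M)) (subz_le0 m M) =
  (z \o (p \o bdn D (le_trans (shift_le h 0) (subz_le0 j 0)) h))
    \o bdn D (subz_le m NM) (subz_le0 m N)).
rewrite bdn1 compc1 -!compcA [RHS]compcA e.
have l : (m - M%:Z <= j)%R by rewrite /M; move: (h) (h') (k); lia.
rewrite (bdnM D _ _ _ _ l) (compcA (bdn D _ _) (bdn D _ _)) (bdnM D _ _ _ _ l).
have [e' _] := bcart D l h k (subz_le0 m M) h'.
by rewrite -e' compcA.
Qed.

Lemma countable_int : countable_index int_index.
Proof.
split=> [|i j]; first by exists pickle; apply: pcan_inj pickleK.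
by exists (fun _ => 0%N) => x y _; apply: (@Prop_irrelevance (is_true (i <= j)%R)).
Qed.

Definition from (j : int) : filtered := @under int_index j.

Lemma from_thin (j : int) (a b : from j) (u v : fhom a b) : u = v.
Proof.
case: u v => u e [v e']; apply: eq_exist.
exact: (@Prop_irrelevance (is_true (tag a <= tag b)%R)).
Qed.

Definition from_map (j : int) (a b : from j) (u : (tag a <= tag b)%R) : fhom a b :=
  exist (fun v : @fhom int_index (tag a) (tag b) => fcomp v (tagged a) = tagged b) u
    (@Prop_irrelevance (is_true (j <= tag b)%R) _ _).

Definition from_max (j m : int) : from j.
Proof.
by exists (Num.max m j); rewrite /fhom /= le_max lexx orbT.
Defined.

(** * Ind-objects and rows in the Beilinson category *)

Section IndSystem.
Variables (A : exact_cat) (j : int) (Z : diagram (from j) A).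
Hypothesis ZI : inda_ob (IndOb Z : ind A).

Lemma from_max_le (m m' : int) : (m <= m')%R ->
  (tag (from_max j m) <= tag (from_max j m'))%R.
Proof. by rewrite /= => h; rewrite ge_max !le_max h lexx !orbT. Qed.

Let up (m m' : int) (h : (m <= m')%R) : hom (Z (from_max j m)) (Z (from_max j m')) :=
  dmap Z (from_map (from_max_le h)).

Program Definition cof_from_max : cofinal int_index (from j) :=
  @Cofinal int_index (from j) (from_max j)
    (fun m m' h => from_map (from_max_le h)) _ _ _ _.
Next Obligation. by move=> *; apply: from_thin. Qed.
Next Obligation. by move=> *; apply: from_thin. Qed.
Next Obligation.
move=> [m h]; exists m; apply: inhabits; apply: from_map.
by rewrite /= le_max lexx.
Qed.
Next Obligation. by move=> a m u v; exists m, (lexx m); apply: from_thin. Qed.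

(** Z represents an object of the Beilinson category through a system whose
    rows are constant; as Z starts at the index j, so do the rows below j
    repeat Z_j. *)
Program Definition ind_system : bsystem A :=
  @BSystem A (fun i m => Z (from_max j m)) (fun i m m' _ h => up h)
    (fun i i' m _ _ => 'id_ (Z (from_max j m))) _ _ _ _ _ _ _.
Next Obligation. by move=> i m h h'; rewrite -dmap1; congr dmap; apply: from_thin. Qed.
Next Obligation. by move=> *; rewrite /up -dmapM; congr dmap; apply: from_thin. Qed.
Next Obligation. by []. Qed.
Next Obligation. by move=> *; apply: comp1c. Qed.
Next Obligation. by move=> *; apply: (proj2 ZI). Qed.
Next Obligation. by move=> *; apply: (@adm_mono_id (ops A)). Qed.
Next Obligation.
move=> i i' m m' hi him hm k l; split; first by rewrite compc1 comp1c.
move=> t x y; rewrite comp1c => <-; exists x; split; first by rewrite !comp1c.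
by move=> w [<- _]; rewrite comp1c.
Qed.

Lemma ind_beilinson : is_beilinson (exist _ _ (dpcst_inda (exist _ _ ZI)) : inda (proa A)).
Proof.
suff [f _] : exists f : @iso (ind (proa A)) (blim ind_system) (IndOb (dpcst Z)), True.
  by exists ind_system; apply: inhabits; apply: (iso_sym f).
pose row m : ind (opc A) := IndOb (brow_diag ind_system m).
have rowE m : exists w : @iso (ind (opc A)) (row m)
    (IndOb (dconst pt_index (Z (from_max j m) : opc A))),
    forall n, germs (fwd w) (i := n)
     (@Germ _ (IndOb (dconst pt_index (Z (from_max j m) : opc A))) _ tt ('id_ _)).
  apply: (@cofinal_iso (opc A) _ _ (cof_pt nat_index) (brow_diag ind_system m)
    (dconst pt_index (Z (from_max j m) : opc A)) (fun n => iso_id _)).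
  by move=> n p u; apply: erefl.
pose w m := sval (cid (rowE m)).
have wP m n : germs (fwd (w m)) (i := n)
    (@Germ _ (IndOb (dconst pt_index (Z (from_max j m) : opc A))) _ tt ('id_ _)).
  exact: (svalP (cid (rowE m)) n).
pose t m : @iso (proa A) (brow ind_system m) (pcst (Z (from_max j m))) :=
  @op_iso (inda_cat (ops A)) _ _
    (@full_iso _ _ (pcst (Z (from_max j m))) (brow ind_system m) (iso_sym (w m))).
suff tN m m' (u : @fhom int_index m m') : fwd (t m') \o dmap (bdiag ind_system) u =
    dmap (dpcst Z) (cof_map cof_from_max u) \o fwd (t m).
  have [f _] := @cofinal_iso (proa A) int_index (from j) cof_from_max
    (bdiag ind_system) (dpcst Z) t tN.
  by exists f.
pose v := dmap Z (cof_map cof_from_max u).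
pose bm : @hom (ind (opc A)) (row m') (row m) := @brow_map A ind_system m m' u.
pose V := @icst_hom (ops A) _ _ v.
suff E : fwd (w m) \o bm = (V : @hom (ind (opc A)) _ _) \o fwd (w m').
  change (bm \o bwd (w m') = bwd (w m) \o V).
  apply: (iso_monic (f := w m)); rewrite !compcA E bwdK -!compcA bwdK compc1.
  by rewrite [RHS]comp1c.
apply: ind_homP => n.
have bmm := ind_level_mem
  (@DTrans nat_index (opc A) (brow_diag ind_system m') (brow_diag ind_system m)
     (brow_map_at ind_system u)
     (fun m n v => esym (brow_map_subproof ind_system u v))) n.
have H1 := germs_comp bmm (wP m n).
have Vm := ind_level_mem (dconst_hom pt_index (v : @hom (opc A) _ _)) tt.
have H2 := germs_comp (wP m' n) Vm.
eexists; first exact: H1.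
apply/(germs_eq _ H2); exists tt, tt, tt.
change (('id_ _ \o v) \o 'id_ _ = (('id_ _ \o up u) \o 'id_ _) \o 'id_ _).
by rewrite !compc1.
Qed.

End IndSystem.

Section RowSystem.
Variables (A : exact_cat) (D : bsystem A) (j : int).
Local Notation X := (bob D).

Lemma min_col (i : int) : (Num.min i j <= j)%R.
Proof. by rewrite ge_min lexx orbT. Qed.

Lemma min_col_le (i i' : int) : (i <= i')%R -> (Num.min i j <= Num.min i' j)%R.
Proof. by move=> h; rewrite le_min !ge_min h lexx orbT. Qed.

Let dn (i i' : int) (h : (i <= i')%R) : hom (X (Num.min i j) j) (X (Num.min i' j) j) :=
  bdn D (min_col_le h) (min_col i').

(** The row j is repeated in all rows; as it stops at the column j, the columns
    after j repeat X_{j,j}. *)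
Program Definition row_system : bsystem A :=
  @BSystem A (fun i m => X (Num.min i j) j)
    (fun i m m' _ _ => 'id_ (X (Num.min i j) j)) (fun i i' m h _ => dn h)
    _ _ _ _ _ _ _.
Next Obligation. by []. Qed.
Next Obligation. by move=> *; apply: comp1c. Qed.
Next Obligation. by move=> i m h h'; apply: bdn1. Qed.
Next Obligation. by move=> *; apply: bdnM. Qed.
Next Obligation. by move=> *; apply: adm_mono_id. Qed.
Next Obligation. by move=> *; apply: bdn_epi. Qed.
Next Obligation.
move=> i i' m m' hi him hm k l; split; first by rewrite compc1 comp1c.
move=> t x y; rewrite comp1c => ->; exists y; split; first by rewrite !comp1c.
by move=> w [_ <-]; rewrite comp1c.
Qed.

Lemma row_beilinson : is_beilinson (icst (brow D j) : inda (proa A)).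
Proof.
suff [f _] : exists f : @iso (ind (proa A)) (blim row_system)
    (IndOb (dconst pt_index (brow D j))), True.
  by exists row_system; apply: inhabits; apply: (iso_sym f).
pose row m : ind (opc A) := IndOb (brow_diag row_system m).
have unb m i : exists n : nat, (Num.min (m - n%:Z) j <= i)%R.
  by have [n h] := sub_unbounded m i; exists n; rewrite ge_min h.
have rowE m : exists w : @iso (ind (opc A)) (row m) (IndOb (row_diag D j)),
    forall n : nat, germs (fwd w) (i := n)
      (@Germ (opc A) (IndOb (row_diag D j)) _ (col (min_col (m - n%:Z)%R)) ('id_ _)).
  apply: (@cofinal_iso (opc A) _ _
    (cof_columns (fun n : nat => min_col (m - n%:Z)%R)
      (fun n p h => min_col_le (subz_le m h)) (unb m))
    (brow_diag row_system m) (row_diag D j) (fun n => iso_id _)).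
  by move=> n p u; rewrite comp1c compc1; apply: bdn_irr.
pose w m := sval (cid (rowE m)).
have wP m (n : nat) : germs (fwd (w m)) (i := n)
    (@Germ (opc A) (IndOb (row_diag D j)) _ (col (min_col (m - n%:Z)%R)) ('id_ _)).
  exact: (svalP (cid (rowE m)) n).
have [b _] := brow_columns D j.
pose t m : @iso (proa A) (brow row_system m) (brow D j) :=
  @op_iso (inda_cat (ops A)) _ _
    (@full_iso _ _ (brow D j) (brow row_system m) (iso_comp (iso_sym (w m)) b)).
suff tN m m' (u : @fhom int_index m m') :
    fwd (t m') \o dmap (bdiag row_system) u = 'id_ (brow D j) \o fwd (t m).
  have [f _] := @cofinal_iso (proa A) int_index pt_index (cof_pt int_index)
    (bdiag row_system) (dconst pt_index (brow D j)) t tN.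
  by exists f.
pose bm : @hom (ind (opc A)) (row m') (row m) := @brow_map A row_system m m' u.
suff E : fwd (w m) \o bm = fwd (w m').
  rewrite comp1c; change (bm \o (bwd (w m') \o fwd b) = bwd (w m) \o fwd b).
  by apply: (iso_monic (f := w m)); rewrite !compcA E !bwdK.
apply: ind_homP => n.
have bmm := ind_level_mem
  (@DTrans nat_index (opc A) (brow_diag row_system m') (brow_diag row_system m)
     (brow_map_at row_system u)
     (fun m n v => esym (brow_map_subproof row_system u v))) n.
have H1 := germs_comp bmm (wP m n).
have H2 := wP m' n.
eexists; first exact: H1.
apply/(germs_eq _ H2).
exists (col (min_col (m - n%:Z)%R)), (min_col_le (subz_le2 n u)), (lexx _).
change ('id_ _ \o bdn D (min_col_le (subz_le2 n u)) (min_col (m' - n%:Z)%R) =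
  ((dn (subz_le2 n u) \o 'id_ _) \o 'id_ _) \o bdn D (lexx _) (min_col (m - n%:Z)%R)).
by rewrite bdn1 !compc1 comp1c.
Qed.

End RowSystem.

(** * Lattices in an object of the Beilinson category *)

Section RowQuotient.
Variables (A : exact_cat) (D : bsystem A) (j : int).

Definition row_in : @hom (ind (proa A)) (IndOb (dconst pt_index (brow D j))) (blim D) :=
  @ind_pt (proa A) (brow D j) (blim D) j ('id_ _).

(** The quotient of X by its row j is the ind-object of the quotients
    X_{j,m} / X_{j,j}, for m >= j. *)
Lemma row_quotient : exists (Z : inda A)
    (p : @hom (ind (proa A)) (blim D) (sval (ipcst Z))),
  is_beilinson (ipcst Z) /\
  @ind_ses (proa A) (IndOb (dconst pt_index (brow D j))) (blim D) (sval (ipcst Z))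
    row_in p.
Proof.
have H1 (a : from j) : bup D (tagged a) (sval (fid a)) = 'id_ (bob D j (tag a)).
  exact: bup1.
have HM (a b c : from j) (v : fhom b c) (u : fhom a b) :
    bup D (tagged a) (sval (fcomp v u)) =
    bup D (tagged b) (sval v) \o bup D (tagged a) (sval u).
  by symmetry; apply: bupM.
pose Y : diagram (from j) A := @Diagram (from j) A (fun a => bob D j (tag a))
  (fun a b u => bup D (tagged a) (sval u)) H1 HM.
have cJ : countable_index (from j) := @countable_under int_index j countable_int.
have YI : inda_ob (IndOb Y : ind A) by split=> // a b u; apply: bup_mono.
have fN (a b : from j) (u : fhom a b) :
    dmap Y u \o bup D (lexx j) (tagged a) = bup D (lexx j) (tagged b).
  exact: bupM.
have fM (a : from j) : adm_mono (bup D (lexx j) (tagged a)) by apply: bup_mono.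
have [Z [p [ZI s]]] := quot_diagram (noether_exact A) YI fN fM.
exists (exist _ _ ZI).
have [om omP] := @cofinal_iso (proa A) (from j) int_index (@cof_under int_index j)
  (restrict (@cof_under int_index j) (bdiag D)) (bdiag D)
  (fun a => iso_id _) (fun a b u => etrans (comp1c _) (esym (compc1 _))).
have bN (a b : from j) (u : fhom a b) :
    row_pt (tagged b) (p b) \o dmap (restrict (@cof_under int_index j) (bdiag D)) u =
    dmap (dpcst Z) u \o row_pt (tagged a) (p a).
  apply: (@row_pt_nat A D j (tag a) (tag b) (tagged a) (tagged b) (sval u)).
  exact: (esym (dtr_nat p u)).
pose bT := @DTrans (from j) (proa A) (restrict (@cof_under int_index j) (bdiag D))
  (dpcst Z) (fun a => row_pt (tagged a) (p a)) bN.
have aN (a b : from j) (u : fhom a b) :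
    dmap (restrict (@cof_under int_index j) (bdiag D)) u \o brow_map D (tagged a) =
    brow_map D (tagged b).
  by symmetry; apply: brow_mapM.
have [ka kaP] := dconst_iso (from j) (brow D j).
exists ((ind_level bT : @hom (ind (proa A)) _ _) \o bwd om); split.
  exact: ind_beilinson.
exists (from j), (dconst (from j) (brow D j)),
  (restrict (@cof_under int_index j) (bdiag D)), (dpcst Z), (cone aN), bT.
split.
- exact: (@inda_const (proa A)).
- apply: inda_restrict => // m m' u.
  have [c [q mq]] := bup_mono D (lexx m) u.
  by exists (pcst c), (row_pt u q); apply: row_ses.
- exact: (dpcst_inda (exist _ _ ZI)).
- by move=> a; apply: row_ses; apply: s.
exists ka, om, (iso_id _); split; last first.
  by rewrite -compcA fwdK compc1 [RHS]comp1c.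
apply: ind_homP => a.
have H2 := germs_comp (kaP a) (@ind_pt_mem (proa A) _ (blim D) j ('id_ _)).
have H3 := germs_comp (ind_level_mem (cone aN) a) (omP a).
eexists; first exact: H2.
apply/(germs_eq _ H3).
exists (tag a), (lexx _), (tagged a).
rewrite [RHS](_ : _ = (brow_map D (tagged a) \o 'id_ _) \o 'id_ _); last exact: compcA.
rewrite !compc1 -[LHS]/(brow_map D (lexx (tag a)) \o ('id_ _ \o brow_map D (tagged a))).
by rewrite brow_map1 !comp1c.
Qed.

End RowQuotient.

Section Lattice.
Variables (A : exact_cat) (X : beilinson A) (D : bsystem A).
Variable xi : @iso (ind (proa A)) (sval (sval X)) (blim D).

Definition row_ob (j : int) : beilinson A := exist _ (icst (brow D j)) (row_beilinson D j).

Definition row_hom (j : int) : hom (row_ob j) X :=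
  (bwd xi \o row_in D j : @hom (ind (proa A)) (sval (sval (row_ob j))) (sval (sval X))).

Lemma row_quo (j : int) : exists (Q : beilinson A) (p : hom X Q),
  bses (row_hom j) p /\ in_inda (sval Q).
Proof.
have [Z [p [ZB s]]] := row_quotient D j.
exists (exist _ (ipcst Z) ZB), (p \o fwd xi : @hom (ind (proa A)) _ _); split.
  apply: (ind_ses_iso (x' := iso_id _) (x := iso_sym xi) (x'' := iso_id _)) s.
  split; first by rewrite compc1.
  by rewrite -compcA bwdK compc1 [RHS]comp1c.
by exists Z; apply: inhabits; apply: iso_id.
Qed.

Lemma row_pro (j : int) : in_proa (sval (row_ob j)).
Proof. by exists (brow D j); apply: inhabits; apply: iso_id. Qed.

Definition row_sub (j : int) : subobject X := Subobject (row_quo j) (row_pro j).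

Definition sub_le (u v : subobject X) : Prop :=
  exists f : hom (sub_ob u) (sub_ob v), sub_hom v \o f = sub_hom u.

(** A morphism from a pro-object to the formal colimit of the rows comes from a
    morphism to one of them, hence to all the later ones. *)
Lemma sub_le_row (u : subobject X) : exists j, forall m, (j <= m)%R -> sub_le u (row_sub m).
Proof.
have [L [e]] := sub_pro u.
pose g : @hom (ind (proa A)) (IndOb (dconst pt_index L)) (blim D) :=
  (fwd xi \o (sub_hom u : @hom (ind (proa A)) _ _)) \o bwd (iso_full e).
have [j [a ga]] := @ind_pt_ex (proa A) L (blim D) g.
exists j => m jm; pose b := brow_map D jm \o a.
exists ((icst_hom b : @hom (ind (proa A)) _ _) \o fwd (iso_full e) : @hom (ind (proa A)) _ _).
change (((bwd xi \o row_in D m) \o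
  ((icst_hom b : @hom (ind (proa A)) (IndOb (dconst pt_index L)) (IndOb (dconst pt_index (brow D m))))
     \o fwd (iso_full e))) = (sub_hom u : @hom (ind (proa A)) _ _)).
have E : row_in D m \o (icst_hom b : @hom (ind (proa A)) (IndOb (dconst pt_index L))
    (IndOb (dconst pt_index (brow D m)))) = g.
  rewrite ga icst_homE.
  rewrite [LHS](@ind_pt_comp (proa A) L (sval (icst (brow D m))) (blim D) tt m b
    _ ('id_ _) (@ind_pt_mem (proa A) _ (blim D) m ('id_ _))).
  apply/(@ind_pt_eq (proa A)); exists m, (lexx m), jm.
  rewrite -[LHS]/(brow_map D (lexx m) \o ('id_ _ \o b)).
  by rewrite brow_map1 !comp1c.
rewrite -!compcA [row_in D m \o _]compcA E /g -!compcA fwdK compc1.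
by rewrite compcA fwdK comp1c.
Qed.

End Lattice.

Lemma sub_le_directed (A : exact_cat) (X : beilinson A) (u v : subobject X) :
  exists w, sub_le u w /\ sub_le v w.
Proof.
have [D [xi]] := svalP X.
have [j hj] := sub_le_row xi u; have [k hk] := sub_le_row xi v.
exists (row_sub xi (Num.max j k)); split.
  by apply: hj; rewrite le_max lexx.
by apply: hk; rewrite le_max lexx orbT.
Qed.

Lemma subobject_ex (A : exact_cat) (X : beilinson A) : inhabited (subobject X).
Proof. by have [D [xi]] := svalP X; apply: inhabits; apply: (row_sub xi 0%R). Qed.

(** * Equivalences of categories *)

Section Equivalences.
Variables (C D : category) (F : functor C D).

Lemma equivalence_faithful : is_equivalence F ->
  forall (a b : C) (f g : hom a b), fun_hom F f = fun_hom F g -> f = g.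
Proof.
move=> [G [[eta etaN] _]] a b f g e.
by apply: (iso_monic (f := eta b)); rewrite !etaN e.
Qed.

Lemma equivalence_full : is_equivalence F ->
  forall (a b : C) (g : hom (F a) (F b)), exists f : hom a b, fun_hom F f = g.
Proof.
move=> [G [[eta etaN] [eps epsN]]] a b g.
pose f := bwd (eta b) \o fun_hom G g \o fwd (eta a); exists f.
have e : fun_hom G (fun_hom F f) = fun_hom G g.
  apply: (iso_epic (f := eta a)); rewrite -etaN.
  by rewrite /f !compcA bwdK comp1c.
by apply: (iso_epic (f := eps (F a))); rewrite -!epsN e.
Qed.

Lemma ff_equivalence :
  (forall (a b : C) (f g : hom a b), fun_hom F f = fun_hom F g -> f = g) ->
  (forall (a b : C) (g : hom (F a) (F b)), exists f : hom a b, fun_hom F f = g) ->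
  (forall d : D, exists a, inhabited (iso (F a) d)) ->
  is_equivalence F.
Proof.
move=> fai ful sur.
pose G d := sval (cid (sur d)).
pose e d : iso (F (G d)) d := inhabited_witness (svalP (cid (sur d))).
have ex d d' (g : hom d d') : exists f : hom (G d) (G d'),
    fun_hom F f = bwd (e d') \o (g \o fwd (e d)) by apply: ful.
pose Gh d d' (g : hom d d') := sval (cid (ex d d' g)).
have GhP d d' (g : hom d d') : fun_hom F (Gh d d' g) = bwd (e d') \o (g \o fwd (e d)).
  exact: (svalP (cid (ex d d' g))).
have G1 d : Gh d d ('id_ d) = 'id_ (G d).
  by apply: fai; rewrite GhP comp1c fwdK fun_id.
have GM a b c (g : hom b c) (f : hom a b) : Gh a c (g \o f) = Gh b c g \o Gh a b f.
  apply: fai; rewrite fun_comp !GhP -!compcA; congr (_ \o _); congr (_ \o _).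
  by rewrite compcA bwdK comp1c.
have eta a : {f : iso a (G (F a)) | fun_hom F (fwd f) = bwd (e (F a))}.
  apply: cid; have [f fP] := ful _ _ (bwd (e (F a))).
  have [g gP] := ful _ _ (fwd (e (F a))).
  have fK : g \o f = 'id_ a by apply: fai; rewrite fun_comp fP gP bwdK fun_id.
  have gK : f \o g = 'id_ _ by apply: fai; rewrite fun_comp fP gP fwdK fun_id.
  by exists (Iso fK gK).
exists (@Functor D C G Gh G1 GM); split.
  exists (fun a => sval (eta a)) => a b f /=.
  apply: fai; rewrite !fun_comp GhP !(svalP (eta _)) -!compcA bwdK compc1.
  by [].
by exists e => a b g /=; rewrite GhP compcA bwdK comp1c.
Qed.

End Equivalences.

(** * Comparison of relative determinantal theories *)

Section Gamma.
Variables (A : exact_cat) (X : beilinson A).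
Local Notation B := (inda (proa A)).
Let gB : good_ses B := good_inda (good_proa (good_exact A)).

Lemma sub_monic (u : subobject X) : monic (sub_hom u).
Proof.
have [Q [p [s _]]] := sub_quo u; have [_ m _] := good_ker gB s.
by move=> T x y; apply: m.
Qed.

Lemma sub_eq_refl (u : subobject X) : sub_eq u u.
Proof. by exists (iso_id _); apply: compc1. Qed.

Definition gamma_of (u : subobject X) : gamma X :=
  exist _ (sub_eq u) (ex_intro _ u erefl).

Lemma gamma_rep (U : gamma X) : exists u, sval U u.
Proof. by case: U => c [u cu]; exists u; rewrite /= cu; apply: sub_eq_refl. Qed.

Lemma gamma_eq (U : gamma X) (u u' : subobject X) : sval U u -> sval U u' -> sub_eq u u'.
Proof.
case: U => c [w cw] /=; rewrite cw => -[f fP] [g gP]; exists (iso_comp g (iso_sym f)).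
rewrite [LHS]compcA gP; apply: (iso_epic (f := f)).
by rewrite -[LHS]compcA fwdK [LHS]compc1 fP.
Qed.

Definition gamma_le (U V : gamma X) : Prop :=
  exists u v, [/\ sval U u, sval V v & sub_le u v].

Lemma gamma_le_rep (U V : gamma X) u v :
  gamma_le U V -> sval U u -> sval V v -> sub_le u v.
Proof.
move=> [u' [v' [Uu' Vv' [f fP]]]] Uu Vv.
have [a aP] := gamma_eq Uu Uu'; have [b bP] := gamma_eq Vv' Vv.
exists (fwd b \o (f \o fwd a)).
by rewrite [LHS]compcA bP [LHS]compcA fP.
Qed.

Lemma gamma_directed (U V : gamma X) : exists W, gamma_le U W /\ gamma_le V W.
Proof.
have [u Uu] := gamma_rep U; have [v Vv] := gamma_rep V.
have [w [uw vw]] := sub_le_directed u v.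
by exists (gamma_of w); split; [exists u, w | exists v, w]; split=> //; apply: sub_eq_refl.
Qed.

Lemma gamma_le_trans (U V W : gamma X) : gamma_le U V -> gamma_le V W -> gamma_le U W.
Proof.
move=> UV VW.
have [u Uu] := gamma_rep U; have [v Vv] := gamma_rep V; have [w Ww] := gamma_rep W.
exists u, w; split=> //.
have [f fP] := gamma_le_rep UV Uu Vv; have [g gP] := gamma_le_rep VW Vv Ww.
by exists (g \o f); rewrite [LHS]compcA gP.
Qed.

Lemma rel_ses_le (U V : gamma X) : rel_ses U V -> gamma_le U V.
Proof.
by move=> S; exists (rs_u S), (rs_v S); split;
  [exact: rs_uP | exact: rs_vP | exists (rs_i S); apply: rs_over].
Qed.

(** The quotients are cokernels and A embeds fully in Ind^a(Pro^a(A)), so a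
    sequence over X is determined up to isomorphism by its ends. *)
Lemma rel_ses_iso_ex (U V : gamma X) (S T : rel_ses U V) : inhabited (rel_ses_iso S T).
Proof.
have [a aP] := gamma_eq (rs_uP S) (rs_uP T).
have [b bP] := gamma_eq (rs_vP S) (rs_vP T).
have e : rs_i T \o fwd a = fwd b \o rs_i S.
  apply: (sub_monic (u := rs_v T)).
  by rewrite !compcA rs_over aP bP rs_over.
have s : @ses B _ _ _ (rs_i S) (rs_p T \o (fwd b : @hom B _ _)).
  have gi := @good_iso _ gB _ _ _ _ _ _ (rs_i T) (rs_p T) (rs_i S)
    (rs_p T \o (fwd b : @hom B _ _)) (iso_full (iso_sym a)) (iso_full (iso_sym b)) (iso_id _).
  apply: gi (rs_ses T); split.
    apply: (iso_epic (f := iso_full a)).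
    change ((rs_i S \o bwd a) \o fwd a = (bwd b \o rs_i T) \o fwd a).
    by rewrite -!compcA e fwdK compc1 compcA fwdK comp1c.
  change ((rs_p T \o (fwd b : @hom B _ _)) \o (bwd b : @hom B _ _) = 'id_ _ \o rs_p T).
  by rewrite comp1c -compcA [X in _ \o X](bwdK b) compc1.
have [ps psP] := ker_uniq (C := opc B) (good_coker gB s) (good_coker gB (rs_ses S)).
pose qs : @iso B (emb (rs_q S)) (emb (rs_q T)) := iso_op ps.
have [f fE] := emb_hom_full (bwd qs); have [g gE] := emb_hom_full (fwd qs).
have fK : f \o g = 'id_ _.
  by apply: emb_hom_inj; rewrite emb_hom_comp emb_hom_id -fE -gE (fwdK qs).
have gK : g \o f = 'id_ _.
  by apply: emb_hom_inj; rewrite emb_hom_comp emb_hom_id -fE -gE (bwdK qs).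
apply: inhabits; apply: (@RelSesIso _ _ _ _ S T a b (Iso fK gK)) => //.
rewrite -[fwd (Iso fK gK)]/g -gE; exact: (esym psP).
Qed.

End Gamma.

Section Comparison.
Variables (A : exact_cat) (hA : AIC A) (P : picard) (h : det_theory A P).
Variable X : beilinson A.
Implicit Types (U V W : gamma X) (D : rel_det h X).

Lemma picard_iso (a b : P) (f : hom a b) : exists g : iso a b, fwd g = f.
Proof. by have [g [fK gK]] := pgroupoid f; exists (Iso fK gK). Qed.

Lemma thom_id_inj (a b q : P) (f g : hom a b) :
  f *** 'id_ q = g *** 'id_ q -> f = g.
Proof. exact: (equivalence_faithful (ptensor_right q)). Qed.

Lemma thom_id_full (a b q : P) (g : hom (a ** q) (b ** q)) :
  exists f : hom a b, f *** 'id_ q = g.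
Proof. exact: (equivalence_full (ptensor_right q)). Qed.

Definition compatible D D' U V (S : rel_ses U V) (f : hom (D U) (D' U))
    (g : hom (D V) (D' V)) : Prop :=
  g \o rdd D S = rdd D' S \o (f *** 'id_ (h (rs_q S))).

(** Any two sequences over U and V are isomorphic, and the structure
    isomorphisms of D and D' are natural. *)
Lemma compatible_any D D' U V (S T : rel_ses U V) (f : hom (D U) (D' U)) g :
  compatible S f g -> compatible T f g.
Proof.
have [r] := rel_ses_iso_ex S T => e.
have [w wE] := picard_iso ('id_ (D U) *** deth_iso h (rsi_q r)).
apply: (iso_epic (f := w)); rewrite wE -compcA -rdd_nat e -compcA.
by rewrite -thom_comp comp1c compc1 (rdd_nat D' r) -compcA -thom_comp comp1c compc1.
Qed.

Lemma compatible_ex D D' U V (S : rel_ses U V) (f : hom (D U) (D' U)) :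
  exists g, compatible S f g.
Proof.
have [w wE] := picard_iso (rdd D S).
exists ((rdd D' S \o (f *** 'id_ _)) \o bwd w).
by rewrite /compatible -wE -compcA fwdK compc1.
Qed.

Lemma compatible_uniq D D' U V (S : rel_ses U V) (f : hom (D U) (D' U)) g g' :
  compatible S f g -> compatible S f g' -> g = g'.
Proof.
move=> e e'; have [w wE] := picard_iso (rdd D S).
by apply: (iso_epic (f := w)); rewrite wE e e'.
Qed.

(** This uses that tensoring with h(V/U) is an equivalence. *)
Lemma compatible_exV D D' U V (S : rel_ses U V) (g : hom (D V) (D' V)) :
  exists f, compatible S f g.
Proof.
have [w wE] := picard_iso (rdd D' S).
have [f fE] := thom_id_full (bwd w \o (g \o rdd D S)); exists f.
by rewrite /compatible fE -wE compcA bwdK comp1c.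
Qed.

Lemma compatible_uniqV D D' U V (S : rel_ses U V) (f f' : hom (D U) (D' U)) g :
  compatible S f g -> compatible S f' g -> f = f'.
Proof.
move=> e e'; apply: (@thom_id_inj _ _ (h (rs_q S))).
have [w wE] := picard_iso (rdd D' S).
by apply: (iso_monic (f := w)); rewrite wE -e -e'.
Qed.

(** For the sequences given by nested_quotients, this is the associativity
    axiom of D and D'. *)
Lemma rel_ses_filtration U1 U2 U3 : gamma_le U1 U2 -> gamma_le U2 U3 ->
  exists (S12 : rel_ses U1 U2) (S23 : rel_ses U2 U3) (S13 : rel_ses U1 U3),
  forall D D' (f1 : hom (D U1) (D' U1)) (f2 : hom (D U2) (D' U2)) f3,
    compatible S12 f1 f2 -> compatible S23 f2 f3 -> compatible S13 f1 f3.
Proof.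
move=> l12 l23.
have [u1 m1] := gamma_rep U1; have [u2 m2] := gamma_rep U2; have [u3 m3] := gamma_rep U3.
have [i oi] := gamma_le_rep l12 m1 m2; have [j oj] := gamma_le_rep l23 m2 m3.
have oji : sub_hom u3 \o (j \o i) = sub_hom u1 by rewrite compcA oj.
have [Q1 [p1 [s1 Q1I]]] := sub_quo u1; have [Q2 [p2 [s2 Q2I]]] := sub_quo u2.
rewrite -oji in s1; rewrite -oj in s2.
have x3m : @monic (inda (proa A)) (sval (sub_ob u3)) (sval X) (sub_hom u3).
  have [Q3 [p3 [s3 _]]] := sub_quo u3.
  by have [] := good_ker (good_inda (good_proa (good_exact A))) s3.
have [q12 [q13 [q23 [p12 [p23 [p13 [k [l [s12 s23 s13 sq [e e']]]]]]]]]] :=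
  nested_quotients hA (i := i : @hom (inda (proa A)) _ _)
    (j := j : @hom (inda (proa A)) _ _) s1 s2 x3m Q1I Q2I (sub_pro u3).
exists (RelSes m1 m2 oi s12), (RelSes m2 m3 oj s23), (RelSes m1 m3 oji s13).
move=> D D' f1 f2 f3 c12 c23.
have a := rdd_assoc D m1 m2 m3 oi oj oji s12 s23 s13 sq e e'.
have a' := rdd_assoc D' m1 m2 m3 oi oj oji s12 s23 s13 sq e e'.
have [w wE] := picard_iso ('id_ (D U1) *** detl h sq).
apply: (iso_epic (f := w)); rewrite wE.
transitivity ((rdd D' (RelSes m2 m3 oj s23) \o (f2 *** 'id_ _)) \o
    ((rdd D (RelSes m1 m2 oi s12) *** 'id_ _) \o assoc (D U1) (h q12) (h q23))).
  by rewrite -c23 -[LHS]compcA a !compcA.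
rewrite -!compcA [(f2 *** _) \o _]compcA -thom_compl c12 thom_compl -[in LHS]compcA.
rewrite -assoc_nat thom_id -thom_comp comp1c compc1.
have -> : f1 *** detl h sq = ('id_ _ *** detl h sq) \o (f1 *** 'id_ (h q12 ** h q23)).
  by rewrite -thom_comp comp1c compc1.
by rewrite [RHS]compcA a' !compcA.
Qed.

Lemma rel_ses_ex U V : gamma_le U V -> inhabited (rel_ses U V).
Proof.
move=> UV; have VV : gamma_le V V.
  by have [v Vv] := gamma_rep V; exists v, v; split=> //; exists ('id_ _); apply: compc1.
by have [S _] := rel_ses_filtration UV VV.
Qed.

Lemma compatible_trans D D' U V W (S : rel_ses U V) (T : rel_ses V W)
    (R : rel_ses U W) (f1 : hom (D U) (D' U)) f2 f3 :
  compatible S f1 f2 -> compatible T f2 f3 -> compatible R f1 f3.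
Proof.
have [S12 [S23 [S13 H]]] := rel_ses_filtration (rel_ses_le S) (rel_ses_le T).
move=> c12 c23; apply: (compatible_any (S := S13)).
by apply: H; [apply: compatible_any c12 | apply: compatible_any c23].
Qed.

Lemma compatible_transV D D' U V W (S : rel_ses U V) (T : rel_ses V W)
    (R : rel_ses U W) (f1 : hom (D U) (D' U)) f2 f3 :
  compatible R f1 f3 -> compatible T f2 f3 -> compatible S f1 f2.
Proof.
move=> c13 c23; have [f cf] := compatible_exV S f2.
by rewrite (compatible_uniqV c13 (compatible_trans R cf c23)).
Qed.

Section Extension.
Variables (D D' : rel_det h X) (U0 : gamma X) (f0 : hom (D U0) (D' U0)).

(** The value f at U forced by f0, compared in a common larger lattice W. *)
Definition forced U (f : hom (D U) (D' U)) : Prop :=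
  exists W (S : rel_ses U0 W) (T : rel_ses U W) (e : hom (D W) (D' W)),
    compatible S f0 e /\ compatible T f e.

Lemma forced_above U (f : hom (D U) (D' U)) W (S : rel_ses U0 W)
    (T : rel_ses U W) (e : hom (D W) (D' W)) :
  forced f -> compatible S f0 e -> compatible T f e.
Proof.
move=> [W' [S' [T' [e' [c0 cU]]]]] c.
have [V [WV W'V]] := gamma_directed W W'.
have [R] := rel_ses_ex WV; have [R'] := rel_ses_ex W'V.
have [R0] := rel_ses_ex (gamma_le_trans (rel_ses_le S) WV).
have [RU] := rel_ses_ex (gamma_le_trans (rel_ses_le T) WV).
have [g cg] := compatible_ex R e; have [g' cg'] := compatible_ex R' e'.
have E : g = g'.
  exact: (compatible_uniq (compatible_trans R0 c cg) (compatible_trans R0 c0 cg')).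
rewrite -E in cg'.
exact: (compatible_transV _ (compatible_trans RU cU cg') cg).
Qed.

Lemma forced_ex U : exists f : hom (D U) (D' U), forced f.
Proof.
have [W [U0W UW]] := gamma_directed U0 U.
have [S] := rel_ses_ex U0W; have [T] := rel_ses_ex UW.
have [e ce] := compatible_ex S f0; have [f cf] := compatible_exV T e.
by exists f, W, S, T, e.
Qed.

Lemma forced_compatible U V (S : rel_ses U V) (f : hom (D U) (D' U)) g :
  forced f -> forced g -> compatible S f g.
Proof.
move=> ff fg; have [W [U0W VW]] := gamma_directed U0 V.
have [R0] := rel_ses_ex U0W; have [RV] := rel_ses_ex VW.
have [RU] := rel_ses_ex (gamma_le_trans (rel_ses_le S) VW).
have [e ce] := compatible_ex R0 f0.
exact: (compatible_transV _ (forced_above RU ff ce) (forced_above RV fg ce)).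
Qed.

Lemma forced_uniq U (f g : hom (D U) (D' U)) : forced f -> forced g -> f = g.
Proof.
move=> ff fg; have [W [U0W UW]] := gamma_directed U0 U.
have [R0] := rel_ses_ex U0W; have [RU] := rel_ses_ex UW.
have [e ce] := compatible_ex R0 f0.
exact: (compatible_uniqV (forced_above RU ff ce) (forced_above RU fg ce)).
Qed.

Lemma forced0 : forced f0.
Proof.
have [W [U0W _]] := gamma_directed U0 U0; have [S] := rel_ses_ex U0W.
by have [e ce] := compatible_ex S f0; exists W, S, S, e.
Qed.

(** Forced values agree with f0 in every lattice large enough, whichever lattice
    they were computed in; so they are compatible along an inclusion of U in V,
    as seen in a lattice containing V and U0. *)
Lemma rel_det_hom_extend : exists g : rel_det_hom D D', g U0 = f0.
Proof.
pose g U := sval (cid (forced_ex U)).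
have gP U : forced (g U) := svalP (cid (forced_ex U)).
exists (RelDetHom (fun U V S => forced_compatible S (gP U) (gP V))).
exact: (forced_uniq (gP U0) forced0).
Qed.

End Extension.

(** Two lattices have a common upper bound, and along an inclusion either value
    of a morphism determines the other. *)
Lemma rel_det_hom_uniq D D' (f g : rel_det_hom D D') (U0 : gamma X) :
  f U0 = g U0 -> f = g.
Proof.
move=> e; apply: rel_det_homP => U.
have [W [U0W UW]] := gamma_directed U0 U.
have [S] := rel_ses_ex U0W; have [T] := rel_ses_ex UW.
have E : f W = g W.
  have cf : compatible S (f U0) (f W) := rdhP f S.
  have cg : compatible S (g U0) (g W) := rdhP g S.
  by rewrite -e in cg; apply: compatible_uniq cf cg.
have cf : compatible T (f U) (f W) := rdhP f T.
have cg : compatible T (g U) (g W) := rdhP g T.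
by rewrite -E in cg; apply: compatible_uniqV cf cg.
Qed.

Lemma rel_det_groupoid : groupoid (rel_det_cat h X).
Proof.
move=> D D' f.
have [u] := subobject_ex X; pose U0 := gamma_of u.
have [g0 [fK gK]] := pgroupoid (f U0).
have [g gE] := rel_det_hom_extend g0.
exists g; split; apply: (@rel_det_hom_uniq _ _ _ _ U0).
  by change (rdh g U0 \o rdh f U0 = 'id_ (rdD D U0)); rewrite gE fK.
by change (rdh f U0 \o rdh g U0 = 'id_ (rdD D' U0)); rewrite gE gK.
Qed.

End Comparison.

Theorem theorem4p18 (A : exact_cat) (hA : AIC A) (X : beilinson A)
    (P : sym_picard) (h : det_theory A P) :
  is_torsor (rel_det_module h X).
Proof.
split; first exact: rel_det_groupoid.
(* Everything is tested at the single lattice U0. *)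
have [u] := subobject_ex X; pose U0 := gamma_of u.
move=> D; apply: ff_equivalence.
- move=> x y f g e; apply: (@thom_id_inj P x y (rdD D U0)).
  exact: (congr1 (fun k : rel_det_hom (rel_det_act x D) (rel_det_act y D) => k U0) e).
- move=> x y g.
  have [f fE] := @thom_id_full P x y (rdD D U0) (rdh g U0); exists f.
  exact: (@rel_det_hom_uniq _ hA _ _ _ _ _ _ _ U0).
- move=> D'.
  have [G [_ [eps _]]] := ptensor_right (rdD D U0).
  pose x := G (rdD D' U0).
  have [f _] := @rel_det_hom_extend A hA P h X (rel_det_act x D) D' U0 (fwd (eps _)).
  have [g [fK gK]] := rel_det_groupoid hA (f : @hom (rel_det_cat h X) _ _).
  by exists x; apply: inhabits; apply: (Iso fK gK).
Qed.
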